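(* There does not exist a non trivial projection $P:X_{ius}\to X_{ius}$; that is, there is no bounded linear projection on $X_{ius}$ whose range and kernel are both infinite dimensional (equivalently, $X_{ius}$ is indecomposable: it is not the sum of two infinite dimensional closed subspaces $Y,Z$ with $Y\cap Z=\{0\}$).
   Context: Scalars are real, $\mathbb{N}=\{1,2,\dots\}$. $c_{00}$ is the space of finitely supported sequences, with standard basis $(e_n)$, also written $(e_n^* )$ when its elements are viewed as functionals; $f(x)=\langle f,x\rangle=\sum_n f(n)x(n)$, $\|f\|_\infty=\max_n|f(n)|$. $\operatorname{supp}x=\{n:x(n)\ne 0\}$, $\operatorname{range}(x)$ is the smallest interval of $\mathbb{N}$ containing $\operatorname{supp}x$. For sets, $A<B$ means $\max A<\min B$; $x<y$ means $\operatorname{supp}x<\operatorname{supp}y$. For an interval $E\subset\mathbb{N}$, $Ex$ is the restriction of $x$ to $E$. Fix positive integers $m_j,n_j,s_j$ with $m_1=2$, $m_{j+1}=m_j^5$, $n_1=4$, $n_{j+1}=(4n_j)^{s_j}$, $2^{s_j}\ge m_{j+1}^3$. Let $\mathbf{Q}$ be the set of sequences with finite nonempty support, rational coordinates, all of modulus at most $1$, and $\mathbf{Q_s}$ the set of all $(x_1,f_1,\dots,x_n,f_n)$ with $x_i,f_i\in\mathbf{Q}$ and $\operatorname{range}(x_i)\cup\operatorname{range}(f_i)<\operatorname{range}(x_{i+1})\cup\operatorname{range}(f_{i+1})$ for $i<n$. Fix an injection $\sigma:\mathbf{Q_s}\to\{2j:j\in\mathbb{N}\}$ such that for every $\phi=(x_1,f_1,\dots,x_n,f_n)\in\mathbf{Q_s}$: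 $\sigma(x_1,f_1,\dots,x_{n-1},f_{n-1})<\sigma(\phi)$ and $\max\{\operatorname{range}(x_n)\cup\operatorname{range}(f_n)\}\le m_{\sigma(\phi)}^{1/2}$. Special sequences: $\phi=(x_1,f_1,\dots,x_{2k},f_{2k})\in\mathbf{Q_s}$, with $\phi_i=(x_1,f_1,\dots,x_i,f_i)$, is a special sequence of length $2k$ if: (1) for some $j\in\mathbb{N}$ with $m_{2j}^{1/2}>2k$, $x_1=\frac1{n_{2j}}\sum_{l=1}^{n_{2j}}e_{1,l}$ and $f_1=\frac1{m_{2j}}\sum_{l=1}^{n_{2j}}e^*_{1,l}$, where $(e_{1,l})_l$ are $n_{2j}$ distinct standard basis vectors; (2) for $1\le i\le k$, $\|f_{2i}\|_\infty\le\frac1{m_{\sigma(\phi_{2i-1})}}$ and $|f_{2i}(x_{2i})|\le\frac1{m_{\sigma(\phi_{2i-1})}}$; (3) for $1\le i<k$, with $p=\sigma(\phi_{2i})$, $x_{2i+1}=\frac1{n_p}\sum_{l=1}^{n_p}e_{2i+1,l}$ and $f_{2i+1}=\frac1{m_p}\sum_{l=1}^{n_p}e^*_{2i+1,l}$, where $(e_{2i+1,l})_l$ are $n_p$ distinct standard basis vectors. Norming set: $K_0=K_0^0=\{\pm e_n^*:n\in\mathbb{N}\}$, $K_0^j=\emptyset$ for $j\ge1$, and $K_n^0=K_0$ for all $n$. For $n\ge1$, $j\in\mathbb{N}$: $K_n^{2j}=K_{n-1}^{2j}\cup\{\frac1{m_{2j}}\sum_{i=1}^d f_i:d\le n_{2j},\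 f_1<\dots<f_d,\ f_i\in K_{n-1}\}$. For a special sequence $\phi=(x_1,f_1,\dots,x_{n_{2j+1}},f_{n_{2j+1}})$ of length $n_{2j+1}$ with $f_{2i}\in K_{n-1}^{\sigma(\phi_{2i-1})}$ for $i\le n_{2j+1}/2$, $K_{n,\phi}^{2j+1}$ is the set of all $\frac{\pm1}{m_{2j+1}}E\bigl(\sum_{i=1}^{n_{2j+1}/2}(\lambda_{f'_{2i}}f_{2i-1}+f'_{2i})\bigr)$, where $E$ is an interval, $f'_{2i}\in K_{n-1}^{\sigma(\phi_{2i-1})}$, $\operatorname{supp}f'_{2i}=\operatorname{supp}f_{2i}$, $|g(x_{2i})|\le\frac1{m_{\sigma(\phi_{2i-1})}}$ for all $g\in K_{n-1}^{\sigma(\phi_{2i-1})}$, and $\lambda_{f'_{2i}}=f'_{2i}(m_{\sigma(\phi_{2i-1})}x_{2i})$ if $f'_{2i}(x_{2i})\ne0$, $\lambda_{f'_{2i}}=\pm\frac1{n_{2j+1}^2}$ otherwise. $K_n^{2j+1}$ is the union of $K_{n-1}^{2j+1}$ and all $K_{n,\phi}^{2j+1}$, $\phi$ a special sequence of length $n_{2j+1}$. $K_n=\bigcup_jK_n^j$, $K=\bigcup_nK_n$. $X_{ius}$ is the completion of $c_{00}$ under $\|x\|=\|x\|_K=\sup\{f(x):f\in K\}$. *)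

(* Defs.v *)
From HB Require Import structures.
From mathcomp Require Import all_boot all_order all_algebra.
From mathcomp Require Import all_classical all_reals all_analysis.

Set Implicit Arguments.
Unset Strict Implicit.
Unset Printing Implicit Defensive.

Import Order.TTheory GRing.Theory Num.Theory.
Import numFieldNormedType.Exports.

Local Open Scope classical_set_scope.
Local Open Scope ring_scope.

(* Coordinates are 0-based: [x k] is the coordinate of index k + 1 in
   {1, 2, ...}.  The other indices (of m, n, s, and of the entries of special
   sequences) start at 1. *)
Notation rseq R := (nat -> R^o).

Section Sequences.
Context (R : realType).
Implicit Types (x f : rseq R) (A B E : set nat).

Definition supp x : set nat := [set k | x k != 0].

Definition basis (k : nat) : rseq R := fun l => (l == k)%:R.

(* Meant for finitely supported f and x; the sum is over all of nat. *)
Definition dual_pair f x : R := \sum_(k \in [set: nat]) f k * x k.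

Definition supnorm f : R := sup [set `|f k| | k in [set: nat]].

Definition nat_interval E := forall a b c : nat,
  E a -> E c -> (a <= b <= c)%N -> E b.

(* the range of a vector, not to be confused with the image of a function *)
Definition rng x : set nat := smallest nat_interval (supp x).

(* max A < min B; both sets have to be nonempty.  As E f may be 0, the zero
   functional belongs to the norming set: with an empty set allowed here,
   "f_1 < 0 < f_1" would hold. *)
Definition set_lt A B :=
  [/\ A !=set0, B !=set0 & forall a b, A a -> B b -> (a < b)%N].

Definition restr E x : rseq R := patch (fun=> 0) E x.

Definition c00_pred : {pred rseq R} := fun x => `[< finite_set (supp x) >].

Lemma c00_submod_closed : submod_closed c00_pred.
Proof.
split=> [|a x y /asboolP fx /asboolP fy]; apply/asboolP.
  by rewrite (_ : supp 0 = set0) // -subset0 => k; rewrite /supp /= eqxx.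
apply: (@sub_finite_set _ _ (supp x `|` supp y)); last by rewrite finite_setU.
move=> k; rewrite /supp /= => nz; have [xk|] := eqVneq (x k) 0; last by left.
right; apply: contra_neq nz => yk.
by change (a * x k + y k = 0); rewrite xk yk mulr0 addr0.
Qed.

HB.instance Definition _ :=
  GRing.isSubmodClosed.Build R (rseq R) c00_pred c00_submod_closed.

Record c00 := C00 { c00_val : rseq R; _ : c00_val \in c00_pred }.

HB.instance Definition _ := [isSub for c00_val].
HB.instance Definition _ := [Choice of c00 by <:].
HB.instance Definition _ := [SubChoice_isSubLmodule of c00 by <:].

Definition Qvec : set (rseq R) := [set x |
  [/\ finite_set (supp x), supp x !=set0,
      forall k, exists q : rat, x k = ratr q & forall k, `|x k| <= 1]].

(* (x_1, f_1, ..., x_n, f_n) is encoded as [:: (x_1, f_1); ...; (x_n, f_n)]. *)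
Definition vecs := seq (rseq R * rseq R).

(* x_i and f_i for i >= 1 *)
Definition xs (phi : vecs) (i : nat) : rseq R := (nth (0, 0) phi i.-1).1.
Definition fs (phi : vecs) (i : nat) : rseq R := (nth (0, 0) phi i.-1).2.

Definition rngs (phi : vecs) (i : nat) := rng (xs phi i) `|` rng (fs phi i).

Definition Qs : set vecs := [set phi |
  [/\ (0 < size phi)%N,
      forall i, (1 <= i <= size phi)%N -> Qvec (xs phi i) /\ Qvec (fs phi i) &
      forall i, (1 <= i < size phi)%N ->
        set_lt (rngs phi i) (rngs phi i.+1)]].

End Sequences.

Definition parameters (m n s : nat -> nat) : Prop :=
  [/\ forall j, (1 <= j)%N -> [/\ (0 < m j)%N, (0 < n j)%N & (0 < s j)%N],
      m 1%N = 2%N /\ (forall j, (1 <= j)%N -> m j.+1 = (m j ^ 5)%N),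
      n 1%N = 4%N /\
        (forall j, (1 <= j)%N -> n j.+1 = ((4 * n j) ^ s j)%N) &
      forall j, (1 <= j)%N -> (m j.+1 ^ 3 <= 2 ^ s j)%N].

Section NormingSet.
Context (R : realType) (m n : nat -> nat) (sigma : vecs R -> nat).
Implicit Types (phi : vecs R) (f g x : rseq R).

(* Only the values of sigma on Qs are constrained (and used). *)
Definition coding : Prop :=
  [/\ forall phi, Qs phi -> exists2 j, (1 <= j)%N & sigma phi = (2 * j)%N,
      forall phi psi, Qs phi -> Qs psi -> sigma phi = sigma psi -> phi = psi,
      (forall phi, Qs phi -> (1 < size phi)%N ->
        (sigma (take (size phi).-1 phi) < sigma phi)%N) &
      forall phi, Qs phi -> forall k, rngs phi (size phi) k ->
        k.+1%:R <= Num.sqrt (m (sigma phi))%:R :> R].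

Definition averages (p : nat) x f : Prop :=
  exists e : 'I_(n p) -> nat, [/\ injective e,
    x = (n p)%:R^-1 *: \sum_(l < n p) basis R (e l) &
    f = (m p)%:R^-1 *: \sum_(l < n p) basis R (e l)].

(* sigma (phi_i) *)
Definition code phi (i : nat) : nat := sigma (take i phi).

(* special sequences of length 2k *)
Definition special (k : nat) phi : Prop :=
  [/\ Qs phi /\ size phi = (2 * k)%N,
      exists j, [/\ (1 <= j)%N,
        (2 * k)%:R < Num.sqrt (m (2 * j)%N)%:R :> R &
        averages (2 * j) (xs phi 1) (fs phi 1)],
      forall i, (1 <= i <= k)%N ->
        supnorm (fs phi (2 * i)) <= (m (code phi (2 * i).-1))%:R^-1 /\
        `|dual_pair (fs phi (2 * i)) (xs phi (2 * i))|
          <= (m (code phi (2 * i).-1))%:R^-1 &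
      forall i, (1 <= i < k)%N ->
        averages (code phi (2 * i)) (xs phi (2 * i).+1) (fs phi (2 * i).+1)].

Definition K_basis : set (rseq R) := [set f |
  exists k, f = basis R k \/ f = - basis R k].

(* the functionals added to K_n^p, p even, given L = (K_{n-1}^j)_j *)
Definition even_step (L : nat -> set (rseq R)) (p : nat) : set (rseq R) :=
  [set g | exists d (f : 'I_d -> rseq R),
    [/\ (1 <= d <= n p)%N,
        forall i j : 'I_d, j = i.+1 :> nat -> set_lt (supp (f i)) (supp (f j)),
        forall i, (\bigcup_j L j) (f i) &
        g = (m p)%:R^-1 *: \sum_(i < d) f i]].

(* K_{n,phi}^p for p odd, n_p = 2k, where F i = f'_{2i},
   lam i = lambda_{f'_{2i}} and eps is the global sign *)
Definition odd_step (L : nat -> set (rseq R)) (p k : nat) phi :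
    set (rseq R) :=
  [set g | exists (E : set nat) (eps : R) (F : nat -> rseq R) (lam : nat -> R),
    [/\ nat_interval E,
        eps = 1 \/ eps = -1,
        forall i, (1 <= i <= k)%N ->
          let q := code phi (2 * i).-1 in
          let x := xs phi (2 * i) in
          [/\ L q (F i),
              supp (F i) = supp (fs phi (2 * i)),
              forall h, L q h -> `|dual_pair h x| <= (m q)%:R^-1,
              dual_pair (F i) x != 0 ->
                lam i = dual_pair (F i) ((m q)%:R *: x) &
              dual_pair (F i) x = 0 ->
                lam i = ((n p)%:R ^+ 2)^-1 \/ lam i = - ((n p)%:R ^+ 2)^-1] &
        g = (eps / (m p)%:R) *: restr E (\sum_(1 <= i < k.+1)
              (lam i *: fs phi (2 * i).-1 + F i))]].

(* [Klevel N j] is K_N^j; there is nothing to add at level j = 1. *)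
Fixpoint Klevel (N j : nat) : set (rseq R) :=
  if j == 0%N then K_basis else
  if N is N'.+1 then
    Klevel N' j `|`
    (if ~~ odd j then even_step (Klevel N') j
     else [set g | exists k phi,
       [/\ (3 <= j)%N, n j = (2 * k)%N, special k phi,
           forall i, (1 <= i <= k)%N ->
             Klevel N' (code phi (2 * i).-1) (fs phi (2 * i)) &
           odd_step (Klevel N') j k phi g]])
  else set0.

Definition Kset : set (rseq R) := \bigcup_N \bigcup_j Klevel N j.

Definition normK x : R := sup [set dual_pair f x | f in Kset].

(* X is the completion of (c00, normK), with canonical embedding iota. *)
Definition is_Xius (X : completeNormedModType R)
    (iota : {linear c00 R -> X}) : Prop :=
  (forall u, `|iota u| = normK (c00_val u)) /\ dense (range iota).

End NormingSet.

Section Subspaces.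
Context (R : realType) (X : normedModType R).
Implicit Types Y Z : set X.

Definition subspace Y : Prop :=
  Y 0 /\ forall (a : R) u v, Y u -> Y v -> Y (a *: u + v).

Definition finite_dim Y : Prop := exists d (b : 'I_d -> X),
  Y = [set \sum_(i < d) c i *: b i | c in [set: 'I_d -> R]].

Definition bounded_operator (P : X -> X) : Prop :=
  exists M : R, forall x, `|P x| <= M * `|x|.

Definition nontrivial_projection (P : {linear X -> X}) : Prop :=
  [/\ bounded_operator P, forall x, P (P x) = P x,
      ~ finite_dim (range P) & ~ finite_dim (P @^-1` [set 0])].

Definition decomposable : Prop := exists Y Z : set X,
  [/\ [/\ subspace Y, closed Y & ~ finite_dim Y],
      [/\ subspace Z, closed Z & ~ finite_dim Z],
      Y `&` Z = [set 0] &
      forall x, exists y z, [/\ Y y, Z z & x = y + z]].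

End Subspaces.

(* Main.v *)
From HB Require Import structures.
Require Import Defs.
From mathcomp Require Import all_boot all_order all_algebra.
From mathcomp Require Import all_classical all_reals all_analysis.
From mathcomp Require Import ring lra zify.

(** The space admits few operators because the coding ties consecutive vectors
    of special sequences together.  Three estimates express this.

    The basic inequality [basic_inequality] bounds the norm of a sum of [t]
    blocks by [C (psi t + t tau)], if functionals of weight [m_p] with [p < J]
    are small of order [1 / m_p] on single blocks and the other functionals are
    bounded by [C (1 + t tau)].  Here [psi t = t ^ th] is a concave function,
    built in [concave_growth], with [psi (n_J) <= n_J / m_J ^ 3]; it takes the
    place of the norm of an auxiliary mixed Tsirelson space.  Consequently
    averages of rapidly increasing sequences are exact vectors ([ris_exact]):
    after multiplication by a weight, they are essentially seen by functionals
    of that weight only.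

    Let [x_1, f_1, ..., x_(2 k), f_(2 k)], with [2 k = n_J] and [J] odd, be a
    special sequence whose vectors, times the weights of their functionals, are
    exact vectors [z_l].  A functional of weight [m_J] comes from another
    special sequence, which shares with this one a beginning and, the coding
    being injective, hardly any weight after it.  On the common part the
    coefficients [lam_i] make the contributions of [z_(2 i - 1)] and [- z_(2 i)]
    cancel.  Only the ends of the interval and the place of branching remain, so
    the functional is bounded by a constant on the alternating sum
    ([dependent_functional]), and the basic inequality gives the norm at most
    [40 n_J / m_J ^ 3] ([dependent_norm]).  The same holds for the sum of the
    [- z_(2 i)] alone, if [f_(2 i)] does not see [z_(2 i)].

    On the other hand let [T] be bounded, let the images of the [z_(2 i - 1)]
    be negligible, unless these vectors are omitted, and let [f_(2 i)] be at least [c] on the image of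
    [z_(2 i)].  The functional of weight [m_J] carried by the sequence shows
    that the image of the alternating sum has norm at least of order
    [c n_J / m_J].  For large [J] this contradicts the upper bound
    ([link_contradiction]).  The special sequences are built entry by
    entry, from any infinite supply of candidates for both kinds of entries.

    This is used twice.  If the images of infinitely many basis vectors [e_i]
    had a distance at least [delta] from the multiples of [e_i], there would be
    functionals that are large on these images and vanish at [e_i]; hence
    [T e_i] is asymptotically a multiple of [e_i] ([almost_diagonal]).  For a
    projection [P] the factors are close to 0 or 1 ([diagonal_values]), so one
    of [P] and [1 - P], say [P], is small on infinitely many basis vectors.  If
    the range of [P] has infinite dimension, it nearly
    contains a block sequence, hence averages that form a rapidly increasing
    sequence ([averages_seed]); [P] almost fixes them and almost annihilates the
    basis vectors, which is again impossible ([idempotent_basis]).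

    Finally, two closed subspaces that decompose the space define a bounded
    projection, by Baire's theorem ([projection_bounded]). *)

Set Implicit Arguments.
Unset Strict Implicit.
Unset Printing Implicit Defensive.

Import Order.TTheory GRing.Theory Num.Theory.
Import numFieldNormedType.Exports.

Local Open Scope classical_set_scope.
Local Open Scope ring_scope.

(* In contexts with many hypotheses on real numbers [lia] becomes slow; those
   that are not about natural numbers are dropped first. *)
Local Ltac nlia := repeat match goal with H : ?T |- _ =>
  lazymatch T with
  | nat => fail | is_true (leq _ _) => fail | is_true (andb _ _) => fail
  | is_true (orb _ _) => fail | is_true (negb _) => fail
  | @eq nat _ _ => fail | or _ _ => fail
  | _ => clear H end end; lia.

(** * Arithmetic of the parameters *)

Lemma leq_pexp a k : (0 < k)%N -> (a <= a ^ k)%N.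
Proof.
by case: k => // k _; case: a => // a; rewrite expnS leq_pmulr // expn_gt0.
Qed.

Section Weights.
Variables (m n s : nat -> nat).
Hypothesis hparam : parameters m n s.

Lemma param_s_gt0 j : (1 <= j)%N -> (0 < s j)%N.
Proof. by case: hparam => h _ _ _ /h[]. Qed.

Lemma param_n_gt0 j : (1 <= j)%N -> (0 < n j)%N.
Proof. by case: hparam => h _ _ _ /h[]. Qed.

Lemma param_m_succ j : (1 <= j)%N -> m j.+1 = (m j ^ 5)%N.
Proof. by case: hparam => _ [_ h] _ _ /h. Qed.

Lemma param_n_succ j : (1 <= j)%N -> n j.+1 = ((4 * n j) ^ s j)%N.
Proof. by case: hparam => _ _ [_ h] _ /h. Qed.

Lemma param_m_s j : (1 <= j)%N -> (m j.+1 ^ 3 <= 2 ^ s j)%N.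
Proof. by case: hparam => _ _ _ h /h. Qed.

Lemma param_m_ge2 j : (1 <= j)%N -> (2 <= m j)%N.
Proof.
case: j => // j _; elim: j => [|j IH]; first by case: hparam => _ [-> _] _ _.
rewrite param_m_succ //; apply: leq_trans IH _.
exact: leq_pexp.
Qed.

Lemma param_m_gt0 j : (1 <= j)%N -> (0 < m j)%N.
Proof. by move=> /param_m_ge2; apply: leq_trans. Qed.

Lemma param_m_mono i j : (1 <= i)%N -> (i <= j)%N -> (m i <= m j)%N.
Proof.
move=> i1; elim: j => [|j IH]; first by case: i i1.
rewrite leq_eqVlt => /predU1P[->//|]; rewrite ltnS => ij.
have j1 : (1 <= j)%N by apply: leq_trans ij.
apply: leq_trans (IH ij) _; rewrite param_m_succ //.
exact: leq_pexp.
Qed.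

Lemma param_m_lt i j : (1 <= i)%N -> (i < j)%N -> (m i ^ 5 <= m j)%N.
Proof.
by move=> i1 ij; rewrite -param_m_succ //; apply: param_m_mono.
Qed.

Lemma param_m_inj_lt i j : (1 <= i)%N -> (1 <= j)%N ->
  (m i < m j)%N -> (i < j)%N.
Proof.
move=> i1 j1; rewrite ltnNge => /negP h; rewrite ltnNge; apply/negP => ji.
by apply: h; apply: param_m_mono.
Qed.

Lemma param_m_ge j : (1 <= j)%N -> (j < m j)%N.
Proof.
case: j => // j _; elim: j => [|j IH]; first by rewrite param_m_ge2.
rewrite param_m_succ //; have := param_m_ge2 (ltn0Sn j) => h2.
apply: leq_ltn_trans IH _.
by rewrite -{1}(expn1 (m j.+1)) ltn_exp2l.
Qed.

Lemma param_n_step j : (1 <= j)%N -> (4 * n j <= n j.+1)%N.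
Proof.
by move=> j1; rewrite param_n_succ //; apply/leq_pexp/param_s_gt0.
Qed.

Lemma param_n_mono i j : (1 <= i)%N -> (i <= j)%N -> (n i <= n j)%N.
Proof.
move=> i1; elim: j => [|j IH]; first by case: i i1.
rewrite leq_eqVlt => /predU1P[->//|]; rewrite ltnS => ij.
have j1 : (1 <= j)%N by apply: leq_trans ij.
by apply: leq_trans (IH ij) _; have := param_n_step j1; lia.
Qed.

Lemma param_n_even j : (2 <= j)%N -> exists2 k, (0 < k)%N & n j = (2 * k)%N.
Proof.
case: j => [|[|j]] // _; have := param_s_gt0 (ltn0Sn j).
have := param_n_gt0 (ltn0Sn j).
rewrite (param_n_succ (ltn0Sn j)); case: (s j.+1) => // t nj _.
exists (2 * n j.+1 * (4 * n j.+1) ^ t)%N; last by rewrite expnS; lia.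
by rewrite !muln_gt0 /= nj /= expn_gt0 muln_gt0 nj.
Qed.

Lemma param_m_le_n j : (2 <= j)%N -> (m j ^ 6 <= n j)%N.
Proof.
case: j => [|[|j]] // _; have := param_m_s (ltn0Sn j) => h.
rewrite (param_n_succ (ltn0Sn j)).
have -> : (m j.+2 ^ 6 = (m j.+2 ^ 3) * (m j.+2 ^ 3))%N by rewrite -expnD.
apply: (@leq_trans (2 ^ s j.+1 * 2 ^ s j.+1)); first exact: leq_mul.
rewrite -expnMn leq_exp2r; last exact: param_s_gt0.
by have := param_n_gt0 (ltn0Sn j); lia.
Qed.

End Weights.

(** * A concave growth function *)

Section Growth.
Context {R : realType}.

(** The concave function [u ^ th] lies below its tangent at 1; writing [u ^
    th] as an exponential, this is the combination with weights [1 - th] and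
    [th] of two instances of [1 + x <= exp x]. *)
Lemma powR_tangent (th u : R) : 0 <= th <= 1 -> 0 < u ->
  u `^ th <= 1 - th + th * u.
Proof.
move=> /andP[t0 t1] u0; rewrite /powR gt_eqF //.
set a := th * ln u; set w := expR a.
have w0 : 0 < w := expR_gt0 a.
have h0 : w * (1 - a) <= 1.
  have := expR_ge1Dx (- a); rewrite -(ler_pM2l w0) -/w -expRD subrr expR0.
  by [].
have h1 : w * (1 + (ln u - a)) <= u.
  have := expR_ge1Dx (ln u - a); rewrite -(ler_pM2l w0) -expRD.
  by rewrite (_ : a + (ln u - a) = ln u) ?lnK //; ring.
have -> : w = (1 - th) * (w * (1 - a)) + th * (w * (1 + (ln u - a))).
  by rewrite /a; ring.
apply: lerD; last exact: ler_wpM2l.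
by rewrite -[leRHS]mulr1 ler_wpM2l // subr_ge0.
Qed.

Variables (m n s : nat -> nat).
Hypothesis hparam : parameters m n s.

(** The norm of a sum of [t] basis vectors in a mixed Tsirelson space whose
    weights are [m_p] with [p < J] grows at most like [t ^ th], where the
    exponent is chosen so that [(4 n_(J-1)) ^ (1 - th) = 2]. What the
    estimates use is that [psi] is dominated by affine functions that are
    adapted to a splitting into [2 d] pieces, and that its value at [n_J] is
    small: this is where the fast growth [n_J = (4 n_(J-1)) ^ s_(J-1)] and [2
    ^ s_(J-1) >= m_J ^ 3] come from. *)
Lemma concave_growth J : (2 <= J)%N -> exists psi : nat -> R,
  [/\ forall t, (1 <= t)%N -> 1 <= psi t,
      forall d t, (1 <= d <= n J.-1)%N -> (1 <= t)%N -> exists A B : R,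
        [/\ 0 <= A, 0 <= B,
            forall u, (1 <= u)%N -> psi u <= A + B * u%:R &
            (2 * d)%:R * A + B * t%:R <= 2 * psi t] &
      psi (n J) <= (n J)%:R / (m J)%:R ^+ 3].
Proof.
case: J => [|J] // J2; rewrite /=.
have J1 : (1 <= J)%N by [].
set N : R := (4 * n J)%:R.
have N4 : 4 <= N.
  by rewrite /N ler_nat; have := param_n_gt0 hparam J1; lia.
have N0 : 0 < N by lra.
set ka := ln 2 / ln N.
have l2 : 0 < ln (2 : R) by rewrite ln_gt0 //; lra.
have lN : ln (2:R) <= ln N by rewrite ler_ln ?posrE //; lra.
have lN0 : 0 < ln N by lra.
have ka0 : 0 <= ka by rewrite divr_ge0 // ltW.
have ka1 : ka <= 1 by rewrite ler_pdivrMr // mul1r.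
have Nka : N `^ ka = 2.
  by rewrite /powR gt_eqF // /ka mulrVK ?unitfE ?gt_eqF // lnK // posrE; lra.
pose th := 1 - ka.
have t01 : 0 <= th <= 1 by rewrite /th; apply/andP; split; lra.
exists (fun t => t%:R `^ th); split.
- move=> t t1; rewrite -[leLHS](powRr0 t%:R); apply: ler_powR; last by case/andP: t01.
  by rewrite ler1n.
- move=> d t /andP[d1 dn] t1.
  have D0 : 0 < (2 * d)%:R :> R by rewrite ltr0n; lia.
  have T0 : 0 < t%:R :> R by rewrite ltr0n.
  set c : R := t%:R / (2 * d)%:R.
  have c0 : 0 < c by rewrite divr_gt0.
  have cth : 0 <= c `^ th := powR_ge0 c th.
  (* the tangent at [c], the average length of the [2 d] pieces *)
  exists ((1 - th) * c `^ th), (th * c `^ th / c); split.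
  + by rewrite mulr_ge0 //; case/andP: t01; lra.
  + apply: divr_ge0; last exact: ltW.
    by apply: mulr_ge0 => //; case/andP: t01.
  + move=> u u1; have u0 : 0 < u%:R :> R by rewrite ltr0n.
    have -> : u%:R = c * (u%:R / c) :> R by field; rewrite gt_eqF.
    rewrite (powRM _ (ltW c0) (ltW (divr_gt0 u0 c0))).
    have := powR_tangent t01 (divr_gt0 u0 c0).
    move=> /(ler_wpM2l cth) h.
    have -> : (1 - th) * c `^ th + th * c `^ th / c * (c * (u%:R / c)) =
       c `^ th * (1 - th + th * (u%:R / c)) by field; rewrite gt_eqF.
    by [].
  + have -> : (2 * d)%:R * ((1 - th) * c `^ th) + th * c `^ th / c * t%:R
       = (2 * d)%:R * c `^ th.
      have tE : t%:R = c * (2 * d)%:R :> R by rewrite /c mulrVK // unitfE gt_eqF.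
      by rewrite tE; field; rewrite gt_eqF.
    (* splitting into [2 d] pieces costs [(2 d) ^ ka <= N ^ ka = 2] *)
    have -> : (2 * d)%:R * c `^ th = (2 * d)%:R `^ ka * t%:R `^ th.
      have -> : t%:R = c * (2 * d)%:R :> R by rewrite /c mulrVK // unitfE gt_eqF.
      have E : (2 * d)%:R `^ ka * (2 * d)%:R `^ th = (2 * d)%:R :> R.
        rewrite -powRD; last by apply/implyP => _; rewrite gt_eqF.
        by rewrite (_ : ka + th = 1) ?(powRr1 (ltW D0)) // /th; ring.
      by rewrite (powRM _ (ltW c0) (ltW D0)) mulrCA E mulrC.
    apply: ler_wpM2r; first exact: powR_ge0.
    rewrite -Nka; apply: ge0_ler_powR => //; rewrite ?nnegrE; [exact: ltW..|].
    by rewrite /N ler_nat; lia.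
- rewrite (param_n_succ hparam) // natrX -/N.
  have NS : 0 < N ^+ s J by rewrite exprn_gt0.
  rewrite /th powRB ?(powRr1 (ltW NS)); last by rewrite (gt_eqF NS) implybT.
  apply: ler_wpM2l; first exact: ltW.
  rewrite lef_pV2 ?posrE ?powR_gt0 //; last first.
    by rewrite exprn_gt0 // ltr0n (param_m_gt0 hparam).
  have -> : (N ^+ s J) `^ ka = 2 ^+ s J.
    by rewrite -(powR_mulrn _ (ltW N0)) -powRrM mulrC powRrM Nka powR_mulrn.
  by rewrite -natrX -[2 ^+ _]natrX ler_nat (param_m_s hparam).
Qed.

End Growth.

(** * Finitely supported vectors and functionals *)

Section Vectors.
Context {R : realType}.
Implicit Types (f g x : nat -> R) (u v : c00 R).

Local Coercion c00_val : c00 >-> Funclass.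
Local Arguments c00_val : simpl never.

Lemma c00D u v k : (u + v) k = u k + v k. Proof. by []. Qed.
Lemma c00N u k : (- u) k = - u k. Proof. by []. Qed.
Lemma c00Z a u k : (a *: u) k = a * u k. Proof. by []. Qed.
Lemma c000 k : (0 : c00 R) k = 0. Proof. by []. Qed.

Lemma c00_sum I (r : seq I) (P : pred I) (F : I -> c00 R) k :
  (\sum_(i <- r | P i) F i) k = \sum_(i <- r | P i) F i k.
Proof.
by elim/big_rec2: _ => [|i x y _ <-]; rewrite ?c000 ?c00D.
Qed.

Lemma finite_supp_bound x : finite_set (supp x) ->
  exists M : nat, forall k, (M <= k)%N -> x k = 0.
Proof.
move=> /finite_seqP[r rE]; exists (\max_(i <- r) i).+1 => k Mk.
apply/eqP; apply: contraTT Mk => xk; rewrite -ltnNge ltnS.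
have kr : k \in r by have : supp x k by []; rewrite rE.
by apply: leq_bigmax_seq.
Qed.

Lemma supp_bound_finite x (M : nat) : (forall k, (M <= k)%N -> x k = 0) ->
  finite_set (supp x).
Proof.
move=> h; apply: (@sub_finite_set _ _ `I_M); last exact: finite_II.
move=> k /= /eqP xk; rewrite ltnNge; apply/negP => /h.
by [].
Qed.

Lemma c00_bound u : exists M : nat, forall k, (M <= k)%N -> u k = 0.
Proof. by case: u => x hx; apply: finite_supp_bound; apply/asboolP/hx. Qed.

Lemma c00_pred_bound x (M : nat) : (forall k, (M <= k)%N -> x k = 0) ->
  x \in @c00_pred R.
Proof. by move=> h; apply/asboolP/supp_bound_finite/h. Qed.

Definition mkc00 x (M : nat) (h : forall k, (M <= k)%N -> x k = 0) : c00 R :=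
  C00 (c00_pred_bound h).

Lemma c00_eqP u v : (forall k, u k = v k) -> u = v.
Proof. by move=> h; apply/val_inj/funext. Qed.

Lemma dual_pair_fin f x M : (forall k, (M <= k)%N -> x k = 0) ->
  dual_pair f x = \sum_(k < M) f k * x k.
Proof.
move=> h; rewrite -(big_mkord xpredT (fun k => f k * x k)) /index_iota subn0.
rewrite /dual_pair (@fsbigE _ _ _ _ _ (iota 0 M)) //=.
- by apply: eq_bigl => k; rewrite in_setT.
- exact: iota_uniq.
- by move=> k _; rewrite mem_iota add0n /= -leqNgt => /h ->; rewrite mulr0.
Qed.

Definition ev f u : R := dual_pair f u.

Lemma ev_fin f u M : (forall k, (M <= k)%N -> u k = 0) ->
  ev f u = \sum_(k < M) f k * u k.
Proof. exact: dual_pair_fin. Qed.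

Lemma ev_fin2 f u v M : (forall k, (M <= k)%N -> u k = 0) ->
   (forall k, (M <= k)%N -> v k = 0) -> forall a,
   ev f (a *: u + v) = a * ev f u + ev f v.
Proof.
move=> hu hv a; rewrite (ev_fin f hu) (ev_fin f hv) (@ev_fin _ _ M); last first.
  by move=> k Mk; rewrite c00D c00Z hu // hv // mulr0 addr0.
rewrite big_distrr -big_split /=; apply: eq_bigr => k _.
by rewrite c00D c00Z mulrDr mulrCA.
Qed.

Lemma c00_bound2 u v : exists M : nat,
  (forall k, (M <= k)%N -> u k = 0) /\ (forall k, (M <= k)%N -> v k = 0).
Proof.
have [M1 h1] := c00_bound u; have [M2 h2] := c00_bound v.
exists (maxn M1 M2); split=> k; rewrite geq_max => /andP[/h1 ? /h2 ?] //.
Qed.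

Fact ev_linear f : linear_for *%R (ev f).
Proof.
by move=> a u v; have [M [hu hv]] := c00_bound2 u v; exact: (ev_fin2 f hu hv a).
Qed.

HB.instance Definition _ f :=
  GRing.isLinear.Build R (c00 R) R *%R (ev f) (ev_linear f).

Lemma evD f u v : ev f (u + v) = ev f u + ev f v. Proof. exact: linearD. Qed.
Lemma evZ f a u : ev f (a *: u) = a * ev f u. Proof. exact: linearZ. Qed.
Lemma ev0 f : ev f 0 = 0. Proof. exact: linear0. Qed.
Lemma ev_sum f I (r : seq I) (P : pred I) (F : I -> c00 R) :
  ev f (\sum_(i <- r | P i) F i) = \sum_(i <- r | P i) ev f (F i).
Proof. exact: linear_sum. Qed.

Lemma evZl f a u : ev (fun k => a * f k) u = a * ev f u.
Proof.
have [M h] := c00_bound u; rewrite !(ev_fin _ h) big_distrr /=.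
by apply: eq_bigr => k _; rewrite mulrA.
Qed.

Lemma ev_suml I (r : seq I) (P : pred I) (F : I -> nat -> R) u :
  ev (fun k => \sum_(i <- r | P i) F i k) u = \sum_(i <- r | P i) ev (F i) u.
Proof.
have [M h] := c00_bound u; rewrite (ev_fin _ h).
under eq_bigr do rewrite big_distrl /=.
by rewrite exchange_big; apply: eq_bigr => i _; rewrite (ev_fin _ h).
Qed.

Lemma eq_ev f g u v : (forall k, f k * u k = g k * v k) -> ev f u = ev g v.
Proof.
move=> h; have [M [hu hv]] := c00_bound2 u v.
by rewrite (ev_fin _ hu) (ev_fin _ hv); apply: eq_bigr.
Qed.

Lemma ev_disj f u : (forall k, f k = 0 \/ u k = 0) -> ev f u = 0.
Proof.
move=> h; rewrite -(ev0 f); apply: eq_ev => k.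
by rewrite c000 mulr0; case: (h k) => ->; rewrite ?mul0r ?mulr0.
Qed.

Lemma ev_neq0 f u : ev f u != 0 -> exists k, f k != 0 /\ u k != 0.
Proof.
move=> nz; apply: contrapT => none; move/eqP: nz; apply; apply: ev_disj => k.
have [->|fk] := eqVneq (f k) 0; [by left|right].
by apply/eqP/negPn/negP => uk; apply: none; exists k.
Qed.

Lemma sum_neq0 d (g : nat -> R) : \sum_(i < d) g i != 0 ->
  exists2 i, (i < d)%N & g i != 0.
Proof.
move=> nz; apply: contrapT => none; move/eqP: nz; apply; rewrite big1 // => i _.
by apply/eqP/negPn/negP => gi; apply: none; exists i.
Qed.

Lemma ev_abs_le f u M c : (forall k, (M <= k)%N -> u k = 0) ->
  (forall k, `|f k| <= c) -> `|ev f u| <= c * \sum_(k < M) `|u k|.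
Proof.
move=> h fc; rewrite (ev_fin _ h); apply: (le_trans (ler_norm_sum _ _ _)).
rewrite big_distrr; apply: ler_sum => k _.
by rewrite normrM ler_wpM2r.
Qed.

(** Being within successive windows replaces the relation [set_lt] between
    supports: it also makes sense for vectors that vanish. *)
Definition within (a b : nat) x := forall k, x k != 0 -> (a <= k < b)%N.

Lemma within_out a b x k : within a b x -> ~~ (a <= k < b)%N -> x k = 0.
Proof. by move=> h /negP nk; apply/eqP; apply: contraT => /h /nk. Qed.

Lemma within_sub a b a' b' x : within a b x -> (a' <= a)%N -> (b <= b')%N ->
  within a' b' x.
Proof. by move=> h aa bb k /h; lia. Qed.

Lemma within_ev0 a b c d f u : within a b f -> within c d u ->
  (b <= c)%N \/ (d <= a)%N -> ev f u = 0.
Proof.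
move=> hf hu h; apply: ev_disj => k.
have [/hf kf|/negbNE/eqP] := boolP (f k != 0); last by left.
by right; apply: (within_out hu); apply/negP; lia.
Qed.

Lemma within_sum I (r : seq I) (P : pred I) (F : I -> c00 R) a b :
  (forall i, P i -> within a b (F i)) -> within a b (\sum_(i <- r | P i) F i).
Proof.
move=> h k; rewrite c00_sum => nz; apply/negPn/negP => nk.
move/negP: nz; apply; rewrite big1 // => i Pi.
by apply: within_out (h i Pi) nk.
Qed.

Lemma withinZ a b c u : within a b u -> within a b (c *: u).
Proof.
by move=> h k; rewrite c00Z => nz; apply: h; apply: contra_neq nz => ->; rewrite mulr0.
Qed.

Lemma within_bound a b u : within a b u -> forall k, (b <= k)%N -> u k = 0.
Proof. by move=> h k bk; apply: (within_out h); apply/negP; lia. Qed.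

Fact eb_proof (i k : nat) : (i.+1 <= k)%N -> Defs.basis R i k = 0.
Proof. by rewrite /Defs.basis => ik; rewrite gtn_eqF. Qed.

Definition eb i : c00 R := mkc00 (@eb_proof i).

Lemma ebE i k : eb i k = (k == i)%:R. Proof. by []. Qed.

Lemma ev_eb f i : ev f (eb i) = f i.
Proof.
rewrite (@ev_fin f (eb i) i.+1 (@eb_proof i)) big_ord_recr /= big1 => [|j _].
  by rewrite ebE eqxx mulr1 add0r.
by rewrite ebE ltn_eqF ?mulr0.
Qed.

Lemma within_eb i : within i i.+1 (eb i).
Proof.
move=> k; rewrite ebE; have [->|_] := eqVneq k i.
  by rewrite leqnn ltnSn.
by rewrite eqxx.
Qed.

Lemma cut_pred (E : pred nat) u :
  (fun k => if E k then u k else 0) \in @c00_pred R.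
Proof.
have [M h] := c00_bound u; apply: (@c00_pred_bound _ M) => k /h ->.
by case: ifP.
Qed.

Definition cut (E : pred nat) u : c00 R := C00 (cut_pred E u).

Lemma cutE E u k : cut E u k = if E k then u k else 0. Proof. by []. Qed.

Lemma restrE (E : set nat) f k : restr E f k = if k \in E then f k else 0.
Proof. by []. Qed.

Lemma ev_restr (E : set nat) f u :
  ev (restr E f) u = ev f (cut (fun k => k \in E) u).
Proof.
by apply: eq_ev => k; rewrite restrE cutE; case: ifP; rewrite ?mul0r ?mulr0.
Qed.

Lemma nat_interval_itv (a b : nat) : nat_interval [set k | (a <= k < b)%N].
Proof. by move=> i j k /=; lia. Qed.

Lemma nat_intervalI E F : nat_interval E -> nat_interval F ->
  nat_interval (E `&` F).
Proof.
by move=> hE hF a b c [Ea Fa] [Ec Fc] abc; split; [exact: (hE a b c)|exact: (hF a b c)].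
Qed.

Lemma in_itv_set (a b k : nat) :
  (k \in [set i | (a <= i < b)%N]) = (a <= k < b)%N.
Proof. by apply/idP/idP; rewrite inE. Qed.

End Vectors.

(** * The structure of the norming set *)

Lemma fin_bound (d : nat) (P : nat -> nat -> Prop) :
  (forall i M M', (M <= M')%N -> P i M -> P i M') ->
  (forall i, (i < d)%N -> exists M, P i M) ->
  exists M, forall i, (i < d)%N -> P i M.
Proof.
move=> mono; elim: d => [_|d IH h]; first by exists 0%N.
have [|M hM] := IH; first by move=> i id; apply: h; apply: ltnW.
have [M' hM'] := h d (ltnSn d); exists (maxn M M') => i.
rewrite ltnS leq_eqVlt => /predU1P[->|id].
  by apply: mono hM'; rewrite leq_maxr.
by apply: mono (hM _ id); rewrite leq_maxl.
Qed.

Section Windows.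
Context {R : realType}.

(** The windows start at the minima of the sets [F i]; a bound on the supports
    is needed for the end of the last window only. *)
Lemma windows (d : nat) (F : nat -> set nat) (G : nat -> nat -> R) :
  (forall i, (i.+1 < d)%N -> set_lt (F i) (F i.+1)) ->
  (forall i, (i < d)%N -> supp (G i) `<=` F i) ->
  (exists M, forall i, (i < d)%N -> forall k, (M <= k)%N -> G i k = 0) ->
  exists c : nat -> nat, {homo c : i j / (i <= j)%N} /\
    forall i, (i < d)%N -> within (c i) (c i.+1) (G i).
Proof.
move=> hF hG [M hM].
have hmin i : exists a : nat, (forall k, F i k -> (a <= k)%N) /\
    (F i !=set0 -> F i a).
  have [[k Fk]|nF] := pselect (F i !=set0); last first.
    by exists 0%N; split=> // /nF.
  have ex : exists k, `[< F i k >] by exists k; apply/asboolP.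
  case: (ex_minnP ex) => a /asboolP Fa amin.
  by exists a; split=> // j Fj; apply: amin; apply/asboolP.
have [a ha] := choice hmin.
pose c i := if (i < d)%N then a i else maxn M (a d.-1).
have ac i : (i.+1 < d)%N -> (a i < a i.+1)%N.
  move=> id; have [n1 n2 lt] := hF _ id.
  by apply: lt; [apply: (ha i).2 | apply: (ha i.+1).2].
exists c; split.
  apply: (homo_leq (r := leq)) => [//|x y z|i]; first exact: leq_trans.
  rewrite /c; case: ltnP => id; case: ltnP => id'.
  - exact/ltnW/ac.
  - have -> : i = d.-1 by lia.
    exact: leq_maxr.
  - lia.
  - by [].
move=> i id k Gk; rewrite /c id (ha i).1 /=; last exact: hG.
case: (ltnP i.+1 d) => id'.
  have [n1 n2 lt] := hF _ id'.
  by apply: lt; [apply: hG id _ Gk | apply: (ha i.+1).2].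
rewrite leq_max; apply/orP; left; rewrite ltnNge; apply/negP => Mk.
by move/eqP: Gk; apply; apply: hM Mk.
Qed.

(** At each point at most one of the functions is nonzero, as the windows do
    not overlap. *)
Lemma windows_sum_le (d : nat) (c : nat -> nat) (h : nat -> nat -> R) (a : R) k :
  {homo c : i j / (i <= j)%N} ->
  (forall i, (i < d)%N -> within (c i) (c i.+1) (h i)) -> 0 <= a ->
  (forall i, (i < d)%N -> `|h i k| <= a) -> `|\sum_(i < d) h i k| <= a.
Proof.
move=> hc hw a0 ha.
have [->|] := eqVneq (\sum_(i < d) h i k) 0; first by rewrite normr0.
move=> /(@sum_neq0 R d (fun i => h i k))[i id hik].
rewrite (bigD1 (Ordinal id)) //= big1 ?addr0 => [|j ji]; first exact: ha.
apply/eqP; apply: contraNT ji => hjk; apply/eqP/val_inj => /=.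
have /andP[i1 i2] := hw _ id _ hik; have /andP[j1 j2] := hw _ (ltn_ord j) _ hjk.
apply/eqP; rewrite eqn_leq; apply/andP; split; rewrite leqNgt; apply/negP => lt.
  by have := hc _ _ lt; lia.
by have := hc _ _ lt; lia.
Qed.

End Windows.

Section Structure.
Context {R : realType}.
Variables (m n : nat -> nat) (sigma : vecs R -> nat).
Implicit Types (f g h : nat -> R) (phi psi : vecs R).

Local Notation Kl := (Klevel m n sigma).

Lemma Klevel0 N : Kl N 0 = @K_basis R. Proof. by case: N. Qed.

Definition odd_data (L : nat -> set (rseq R)) (p : nat) : set (rseq R) :=
  [set g | exists k phi,
       [/\ (3 <= p)%N, n p = (2 * k)%N, special m n sigma k phi,
           forall i, (1 <= i <= k)%N ->
             L (Defs.code sigma phi (2 * i).-1) (fs phi (2 * i)) &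
           odd_step m n sigma L p k phi g]].

Lemma KlevelS N p : (0 < p)%N -> Kl N.+1 p =
  Kl N p `|` (if ~~ odd p then even_step m n (Kl N) p else odd_data (Kl N) p).
Proof. by case: p. Qed.

Lemma Klevel00 p : (0 < p)%N -> Kl 0 p = set0.
Proof. by case: p. Qed.

Lemma Klevel_mono N N' p : (N <= N')%N -> Kl N p `<=` Kl N' p.
Proof.
case: (posnP p) => [->|p0]; first by rewrite !Klevel0 => _ g.
elim: N' => [|N' IH]; first by rewrite leqn0 => /eqP->.
rewrite leq_eqVlt => /predU1P[->//|]; rewrite ltnS => /IH h g /h Kg.
by rewrite KlevelS //; left.
Qed.

Lemma Klevel_cases N p g : (0 < p)%N -> Kl N p g -> exists2 N', (N' < N)%N &
  if ~~ odd p then even_step m n (Kl N') p g else odd_data (Kl N') p g.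
Proof.
move=> p0; elim: N => [|N IH]; first by rewrite Klevel00.
rewrite KlevelS // => -[/IH[N' NN' h]|h].
  by exists N' => //; apply: ltnW.
exists N => //; move: h; by case: (~~ odd p).
Qed.

(** The summands of a functional of even weight have to be separated as sets,
    so the zero functions among the [h i] are dropped first; what is left is
    not empty. *)
Lemma even_build N p d (c : nat -> nat) (h : nat -> nat -> R) :
  (0 < p)%N -> ~~ odd p -> (d <= n p)%N -> {homo c : i j / (i <= j)%N} ->
  (forall i, (i < d)%N -> within (c i) (c i.+1) (h i)) ->
  (forall i, (i < d)%N -> (forall k, h i k = 0) \/ exists q, Kl N q (h i)) ->
  (exists2 i, (i < d)%N & exists k, h i k != 0) ->
  Kl N.+1 p (fun k => (m p)%:R^-1 * \sum_(i < d) h i k).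
Proof.
move=> p0 op dn hc hw hK [i0 i0d [k0 hk0]].
rewrite KlevelS // op; right.
(* the indices of the nonzero summands, in increasing order *)
pose P i := `[< exists k, h i k != 0 >].
pose r := [seq i <- iota 0 d | P i].
have ri i : i \in r -> P i /\ (i < d)%N.
  by rewrite mem_filter mem_iota add0n => /andP[].
have i0r : i0 \in r.
  by rewrite mem_filter mem_iota add0n leq0n i0d !andbT; apply/asboolP; exists k0.
have rs : sorted ltn r by apply: sorted_filter (iota_ltn_sorted 0 d); exact: ltn_trans.
exists (size r), (fun i => h (nth 0%N r i)); split.
- rewrite (leq_trans _ dn) ?andbT.
    by case: (r) i0r.
  by rewrite size_filter (leq_trans (count_size _ _)) // size_iota.
- move=> i j ij.
  have /ri[/asboolP[a ha] id] := mem_nth 0%N (ltn_ord i).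
  have /ri[/asboolP[b hb] jd] := mem_nth 0%N (ltn_ord j).
  split; [by exists a | by exists b |] => a' b' /= /(hw _ id) ha' /(hw _ jd) hb'.
  have lt : (nth 0%N r i < nth 0%N r j)%N.
    by apply: (sorted_ltn_nth ltn_trans) => //; rewrite ?inE ?ltn_ord // ij.
  case/andP: ha' => _ q1; case/andP: hb' => q2 _.
  exact: leq_trans q1 (leq_trans (hc _ _ lt) q2).
- move=> i; have /ri[/asboolP[a ha] id] := mem_nth 0%N (ltn_ord i).
  have [h0|[q hq]] := hK _ id; first by rewrite h0 eqxx in ha.
  by exists q.
- apply/funext => k; rewrite fctE; congr (_ * _).
  rewrite fct_sumE.
  rewrite -(big_mkord xpredT (fun i => h i k)) /index_iota subn0.
  rewrite -(big_mkord xpredT (fun i => h (nth 0%N r i) k)) -(big_nth 0%N xpredT (fun i => h i k)).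
  rewrite big_filter [RHS]big_mkcond /=; apply: eq_bigr => i _.
  case: ifP => // /asboolPn hn; apply/eqP/negPn/negP => hik.
  by apply: hn; exists k.
Qed.

End Structure.

(** * Special sequences and their weights *)

Section Special.
Context {R : realType}.
Variables (m n s : nat -> nat) (sigma : vecs R -> nat).
Hypothesis hparam : parameters m n s.
Hypothesis hsigma : coding m sigma.
Implicit Types (f g h : nat -> R) (phi psi : vecs R).

Lemma xs_take phi i j : (1 <= j <= i)%N -> xs (take i phi) j = xs phi j.
Proof. by move=> ij; rewrite /xs nth_take //; lia. Qed.

Lemma fs_take phi i j : (1 <= j <= i)%N -> fs (take i phi) j = fs phi j.
Proof. by move=> ij; rewrite /fs nth_take //; lia. Qed.

Lemma Qs_take phi i : Qs phi -> (1 <= i <= size phi)%N -> Qs (take i phi).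
Proof.
move=> [s0 hQ hlt] /andP[i1 i2]; have si : size (take i phi) = i by apply: size_takel.
split; first by rewrite si.
- by move=> j; rewrite si => /andP[j1 j2]; rewrite xs_take ?fs_take ?j1 //; apply: hQ; lia.
- move=> j; rewrite si => /andP[j1 j2]; rewrite /rngs !xs_take ?fs_take; try lia.
  by apply: hlt; lia.
Qed.

Lemma code_even phi i : Qs phi -> (1 <= i <= size phi)%N ->
  exists2 j, (1 <= j)%N & Defs.code sigma phi i = (2 * j)%N.
Proof.
by case: hsigma => h _ _ _ hQ hi; apply: h; apply: Qs_take.
Qed.

Lemma code_lt phi i : Qs phi -> (1 <= i)%N -> (i.+1 <= size phi)%N ->
  (Defs.code sigma phi i < Defs.code sigma phi i.+1)%N.
Proof.
case: hsigma => _ _ h _ hQ i1 is_.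
have /h : Qs (take i.+1 phi) by apply: Qs_take.
by rewrite size_takel // take_takel // => -> //; lia.
Qed.

(** A code determines the history that it encodes, and in particular its
    length. *)
Lemma code_inj phi psi i j : Qs phi -> Qs psi ->
  (1 <= i <= size phi)%N -> (1 <= j <= size psi)%N ->
  Defs.code sigma phi i = Defs.code sigma psi j ->
  i = j /\ take i phi = take i psi.
Proof.
case: hsigma => _ h _ _ h1 h2 hi hj /h => /(_ (Qs_take h1 hi) (Qs_take h2 hj)) e.
have ij : i = j.
  have : size (take i phi) = size (take j psi) by rewrite e.
  by rewrite !size_takel; lia.
by split=> //; rewrite e ij.
Qed.

(** The weight of the functional [f_i] is the code of the preceding entries,
    except for [i = 1], where the definition of a special sequence leaves it
    free; [W] treats both cases alike. *)
Definition special_weight k phi (W : nat -> nat) :=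
  [/\ forall i, (1 <= i <= 2 * k)%N -> (2 <= W i)%N /\ ~~ odd (W i),
      forall i, (1 <= i <= 2 * k)%N -> ((2 * k) ^ 2 < m (W i))%N,
      forall i, (2 <= i <= 2 * k)%N -> W i = Defs.code sigma phi i.-1 &
      forall i, (i < k)%N ->
        averages m n (W (2 * i).+1) (xs phi (2 * i).+1) (fs phi (2 * i).+1)].

Lemma averages_sorted p (x f : nat -> R) : averages m n p x f ->
  exists r : seq nat, [/\ size r = n p, sorted ltn r,
    forall k, x k = (n p)%:R^-1 * (k \in r)%:R &
    forall k, f k = (m p)%:R^-1 * (k \in r)%:R].
Proof.
move=> [e [einj -> ->]]; pose r0 := [seq e l | l <- enum 'I_(n p)].
have u0 : uniq r0 by rewrite map_inj_uniq // enum_uniq.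
exists (sort leq r0).
have sumE k : \sum_(l < n p) Defs.basis R (e l) k = (k \in sort leq r0)%:R.
  rewrite mem_sort.
  have -> : (k \in r0) = (k \in [seq e l | l : 'I_(n p)]) by [].
  have [kr|kr] := boolP (k \in _).
    have /mapP[l _ kl] := kr.
    rewrite (bigD1 l) //= {1}/Defs.basis kl eqxx big1 ?addr0 // => j jl.
    rewrite /Defs.basis; case: eqP => // /einj lj; by rewrite lj eqxx in jl.
  rewrite big1 // => l _; rewrite /Defs.basis; case: eqP => // kl.
  by rewrite kl map_f ?mem_enum in kr.
split.
- by rewrite size_sort size_map size_enum_ord.
- by rewrite ltn_sorted_uniq_leq sort_uniq u0 sort_sorted //; exact: leq_total.
- by move=> k; rewrite -sumE fctE fct_sumE.
- by move=> k; rewrite -sumE fctE fct_sumE.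
Qed.

Lemma sorted_ltn_last (r : seq nat) : sorted ltn r -> (0 < size r)%N ->
  exists2 k, k \in r & (size r <= k.+1)%N.
Proof.
move=> sr r0; exists (nth 0%N r (size r).-1); first by apply: mem_nth; rewrite ltn_predL.
suff h : forall i, (i < size r)%N -> (i <= nth 0%N r i)%N.
  by rewrite -(prednK r0) ltnS; apply: h; rewrite prednK.
elim=> [//|i IH] ir; apply: leq_ltn_trans (IH _) _; first by lia.
by apply: (sorted_ltn_nth ltn_trans); rewrite ?inE //; lia.
Qed.

Lemma supp_rng (x : nat -> R) : supp x `<=` rng x.
Proof. by apply: sub_smallest. Qed.

Definition weight_from w1 phi i :=
  if i is i'.+2 then Defs.code sigma phi i'.+1 else w1.

(** The first weight is large by assumption. The second one is, by the choice
    of the coding, at least the maximum of the support of [x_1], hence at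
    least [n_(W 1) >= m_(W 1) ^ 6]; the others follow since codes increase. *)
Lemma special_weight_from k phi j : (0 < k)%N -> special m n sigma k phi ->
  (1 <= j)%N -> (2 * k)%:R < Num.sqrt (m (2 * j)%N)%:R :> R ->
  averages m n (2 * j) (xs phi 1) (fs phi 1) ->
  special_weight k phi (weight_from (2 * j) phi).
Proof.
move=> k0 [[hQ hs] _ _ hod] j1 hj hav; set W := weight_from (2 * j) phi.
have Wc i : (2 <= i <= 2 * k)%N -> W i = Defs.code sigma phi i.-1 by case: i => [|[|i]].
have Wev i : (1 <= i <= 2 * k)%N -> (2 <= W i)%N /\ ~~ odd (W i).
  move=> ik; have [i1|i1] := leqP i 1.
    have -> : i = 1%N by lia.
    by rewrite /W /weight_from; split; [lia|rewrite oddM].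
  rewrite Wc; last by lia.
  have [|j' j'1 ->] := @code_even phi i.-1 hQ; first by lia.
  by split; [lia|rewrite oddM].
have m1 : ((2 * k) ^ 2 < m (W 1%N))%N.
  rewrite /W /weight_from -(ltr_nat R) natrX.
  have : 0 <= (2 * k)%:R :> R by [].
  have := sqr_sqrtr (ler0n R (m (2 * j))) => <- h.
  by rewrite ltr_pXn2r // nnegrE sqrtr_ge0.
have W1n : (n (W 1%N) <= m (W 2%N))%N.
  have hW2 : W 2%N = sigma (take 1 phi) by [].
  have hQ1 : Qs (take 1 phi) by apply: Qs_take => //; lia.
  case: hsigma => _ _ _ /(_ _ hQ1); rewrite -hW2 size_takel; last by lia.
  have [r [sr so xr _]] := averages_sorted hav.
  have [|l lr ll] := sorted_ltn_last so.
    by rewrite sr (param_n_gt0 hparam) //; lia.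
  move=> /(_ l); rewrite sr in ll.
  have n0 : (0 < n (2 * j))%N by rewrite (param_n_gt0 hparam) //; lia.
  have rl : rngs (take 1 phi) 1 l.
    left; apply: supp_rng; rewrite /supp /= xs_take // xr lr mulr1 invr_eq0.
    by rewrite pnatr_eq0 -lt0n.
  move=> /(_ rl) h; rewrite /W /weight_from.
  have m2 : 1 <= (m (W 2%N))%:R :> R.
    by rewrite ler1n (param_m_gt0 hparam) //; have [] := Wev 2%N; lia.
  have : l.+1%:R <= (m (W 2%N))%:R :> R.
    apply: le_trans h _; rewrite -[leRHS]sqr_sqrtr ?ler0n //.
    rewrite expr2 ler_peMr ?sqrtr_ge0 //.
    by have := ler_wsqrtr m2; rewrite sqrtr1.
  by rewrite ler_nat; apply: leq_trans.
have m2 : ((2 * k) ^ 2 < m (W 2%N))%N.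
  apply: leq_trans W1n; apply: leq_trans m1 _.
  have [w1 _] := Wev 1%N ltac:(lia).
  by apply: leq_trans (param_m_le_n hparam w1); apply: leq_pexp.
have mi i : (2 <= i <= 2 * k)%N -> ((2 * k) ^ 2 < m (W i))%N.
  elim: i => // i IH ik; have [i1|i1] := leqP i 1.
    by have -> : i = 1%N by lia.
  have ik' : (2 <= i <= 2 * k)%N by lia.
  apply: leq_trans (IH ik') _; have [] := Wev i; first by lia.
  move=> wi _; apply: (param_m_mono hparam); first by lia.
  rewrite !Wc //=.
  have -> : i = i.-1.+1 by lia.
  by apply: ltnW; apply: code_lt => //; lia.
split=> //.
  move=> i ik; have [i1|i1] := leqP i 1; last by apply: mi; lia.
  by have -> : i = 1%N by lia.
case=> [|i] ik; first by rewrite muln0.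
have -> : W (2 * i.+1).+1 = Defs.code sigma phi (2 * i.+1) by rewrite Wc //=; lia.
by apply: hod; lia.
Qed.

Lemma special_weightP k phi : (0 < k)%N -> special m n sigma k phi ->
  exists W, special_weight k phi W.
Proof.
move=> k0 hphi; have [_ [j [j1 hj hav]] _ _] := hphi.
by exists (weight_from (2 * j) phi); apply: special_weight_from.
Qed.

End Special.

(** * Functionals as averages of shorter functionals *)

Section Nodes.
Context {R : realType}.
Variables (m n s : nat -> nat) (sigma : vecs R -> nat).
Hypothesis hparam : parameters m n s.
Hypothesis hsigma : coding m sigma.
Implicit Types (f g h : nat -> R) (phi psi : vecs R).

Local Notation Kl := (Klevel m n sigma).

(** A functional of odd weight, with pairs of entries numbered from 0, the
    sign and the factor [1 / m_p] in one coefficient, and the codes replaced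
    by the weights [W]. *)
Definition odd_form N p g k psi W (E : set nat) (al : R) (F : nat -> nat -> R)
    (lam : nat -> R) :=
  [/\ [/\ (0 < k)%N, n p = (2 * k)%N & special m n sigma k psi],
      special_weight m n sigma k psi W, nat_interval E, `|al| = (m p)%:R^-1 &
      (forall i, (i < k)%N ->
         [/\ Kl N (W (2 * i).+2) (F i), supp (F i) = supp (fs psi (2 * i).+2),
             `|lam i| <= 1,
             dual_pair (F i) (xs psi (2 * i).+2) != 0 ->
               lam i = (m (W (2 * i).+2))%:R * dual_pair (F i) (xs psi (2 * i).+2) &
             dual_pair (F i) (xs psi (2 * i).+2) = 0 ->
               `|lam i| = ((n p)%:R ^+ 2)^-1]) /\
      forall j, g j = al * (if j \in E then
        \sum_(i < k) (lam i * fs psi (2 * i).+1 j + F i j) else 0)].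

Lemma dual_pairZr f (x : nat -> R) a : finite_set (supp x) ->
  dual_pair f (fun k => a * x k) = a * dual_pair f x.
Proof.
move=> /finite_supp_bound[M h]; rewrite (dual_pair_fin _ h).
rewrite (@dual_pair_fin _ _ _ M) => [|k /h ->]; last by rewrite mulr0.
by rewrite big_distrr; apply: eq_bigr => k _; rewrite mulrCA.
Qed.

Lemma odd_dataP N p g : odd_data m n sigma (Kl N) p g ->
  exists k psi W E al F lam, odd_form N p g k psi W E al F lam.
Proof.
move=> [k [psi [p3 nk sp _ [E [eps [F [lam [hE heps hF gE]]]]]]]].
have p1 : (0 < p)%N by lia.
have k0 : (0 < k)%N by have := param_n_gt0 hparam p1; lia.
have [W hW] := special_weightP hparam hsigma k0 sp.
have [Wev Wm Wc Wav] := hW.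
have [[[_ hQv _] szp] _ _ _] := sp.
have n1 : 1 <= (n p)%:R :> R by rewrite ler1n (param_n_gt0 hparam).
have eps1 : `|eps| = 1 by case: heps => ->; rewrite ?normrN normr1.
exists k, psi, W, E, (eps / (m p)%:R), (fun i => F i.+1), (fun i => lam i.+1).
split=> //.
  by rewrite normrM eps1 mul1r ger0_norm // invr_ge0 ler0n.
split=> [i ik|j].
- have e2 : (2 * i.+1 = (2 * i).+2)%N by lia.
  have := hF i.+1; rewrite e2 /= => /(_ ltac:(lia)).
  have <- : W (2 * i).+2 = Defs.code sigma psi (2 * i).+1 by rewrite Wc //; lia.
  move=> [FK Fs Fx lam1 lam0].
  have W2 := Wev (2 * i).+2 ltac:(lia).
  have mW : 0 < (m (W (2 * i).+2))%:R :> R.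
    by rewrite ltr0n (param_m_gt0 hparam) //; lia.
  have [[Fin _ _ _] _] := hQv (2 * i).+2 ltac:(lia).
  have lamE : dual_pair (F i.+1) (xs psi (2 * i).+2) != 0 -> lam i.+1 =
    (m (W (2 * i).+2))%:R * dual_pair (F i.+1) (xs psi (2 * i).+2).
    by move=> /lam1 ->; rewrite -dual_pairZr.
  have lamN : dual_pair (F i.+1) (xs psi (2 * i).+2) = 0 ->
      `|lam i.+1| = ((n p)%:R ^+ 2)^-1.
    move=> /lam0; have q : `|((n p)%:R ^+ 2)^-1| = ((n p)%:R ^+ 2)^-1 :> R.
      by rewrite ger0_norm // invr_ge0 exprn_ge0.
    by case=> ->; rewrite ?normrN q.
  split=> //.
  have [d0|d0] := eqVneq (dual_pair (F i.+1) (xs psi (2 * i).+2)) 0.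
    by rewrite lamN // invf_le1 ?exprn_gt0 ?exprn_ege1 // (lt_le_trans _ n1).
  rewrite lamE // normrM gtr0_norm // -ler_pdivlMl // mulr1.
  exact: Fx.
- rewrite gE /restr; change ((eps / (m p)%:R) * patch (fun=> 0) E (\sum_(1 <= i < k.+1)
              (lam i *: fs psi (2 * i).-1 + F i)) j = eps / (m p)%:R *
 (if j \in E
  then \sum_(i < k) (lam i.+1 * fs psi (2 * i).+1 j + F i.+1 j)
  else 0)).
  rewrite /patch; congr (_ * _); case: ifP => // _.
  rewrite big_add1 /= big_mkord fct_sumE; apply: eq_bigr => i _.
  have -> : ((i + 1 * i.+1)%coq_nat = (2 * i).+1)%N by lia.
  by [].
Qed.

Lemma special_size k psi i : special m n sigma k psi -> (0 < i <= 2 * k)%N ->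
  Qvec (xs psi i) /\ Qvec (fs psi i).
Proof. by move=> [[[_ h _] sz] _ _ _] ik; apply: h; rewrite sz. Qed.

Lemma averages_K p (x f : nat -> R) : (0 < p)%N -> ~~ odd p ->
  averages m n p x f -> Kl 1 p f.
Proof.
move=> p0 op /averages_sorted[r [sr so _ fE]].
have np := param_n_gt0 hparam p0.
have nthlt i j : (i < j)%N -> (j < n p)%N -> (nth 0 r i < nth 0 r j)%N.
  by move=> ij jn; apply: (sorted_ltn_nth ltn_trans); rewrite ?inE ?sr //; lia.
have [|i ip k||c [hc hw]] := @windows R (n p) (fun i => [set nth 0%N r i])
  (fun i => Defs.basis R (nth 0%N r i)).
- move=> i ip; split; [by exists (nth 0%N r i) | by exists (nth 0%N r i.+1)|].
  by move=> a b -> ->; apply: nthlt.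
- by rewrite /supp /Defs.basis /=; case: (k =P _) => //; rewrite eqxx.
- apply: fin_bound; first by move=> i M M' MM h k Mk; apply: h; apply: leq_trans Mk.
  by move=> i _; exists (nth 0%N r i).+1 => k; rewrite /Defs.basis => /gtn_eqF ->.
have -> : f = fun k => (m p)%:R^-1 * \sum_(i < n p) Defs.basis R (nth 0%N r i) k.
  apply/funext => k; rewrite fE; congr (_ * _).
  have ur : uniq r by move: so; rewrite ltn_sorted_uniq_leq => /andP[].
  rewrite -(big_mkord xpredT (fun i => Defs.basis R (nth 0%N r i) k)) -sr.
  rewrite -(big_nth 0%N xpredT (fun i => Defs.basis R i k)).
  have [kr|kr] := boolP (k \in r).
    rewrite (bigD1_seq k) //= big1 /Defs.basis ?eqxx ?addr0 // => i ik.
    by rewrite eq_sym (negbTE ik).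
  rewrite big1_seq // => i /= ir; rewrite /Defs.basis; case: eqP => // ki.
  by rewrite ki ir in kr.
apply: (@even_build R m n sigma 0 p (n p) c (fun i => Defs.basis R (nth 0%N r i)) p0 op (leqnn _) hc hw).
  move=> i ip; right; exists 0%N; rewrite Klevel0; exists (nth 0%N r i); by left.
exists 0%N => //; exists (nth 0%N r 0%N); by rewrite /Defs.basis eqxx oner_neq0.
Qed.

(** The functionals of weight [m_p], scaled by coefficients of modulus at most
    1 and restricted to intervals. The successors of a functional of odd
    weight include the multiples [lam_i f_(2 i - 1)] and are restricted to an
    interval, so they need not belong to the norming set; they belong to this
    larger set, which gives the same norm. *)
Definition Kw N p f := exists (a : R) (E : set nat) g,
  [/\ `|a| <= 1, nat_interval E, Kl N p g & forall k, f k = a * restr E g k].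

Lemma Kw_K N p g : Kl N p g -> Kw N p g.
Proof.
move=> h; exists 1, setT, g; split; rewrite ?normr1 // => k.
by rewrite mul1r restrE in_setT.
Qed.

Lemma Kw_restr N p f a E : `|a| <= 1 -> nat_interval E -> Kw N p f ->
  Kw N p (fun k => a * restr E f k).
Proof.
move=> a1 hE [b [E' [g [b1 hE' hg fE]]]]; exists (a * b), (E `&` E'), g; split=> //.
- by rewrite normrM mulr_ile1.
- exact: nat_intervalI.
- move=> k; rewrite !restrE fE restrE in_setI.
  by case: (k \in E); case: (k \in E'); rewrite ?mulr0 ?mulrA.
Qed.

(** The shape that even and odd weights have in common. It forgets how the
    successors of a functional of odd weight are related, and suffices for all
    norm estimates but the one for dependent sequences. *)
Definition node N p f := exists N' d (c : nat -> nat) (h : nat -> nat -> R),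
  [/\ (N' < N)%N, (d <= n p)%N, {homo c : i j / (i <= j)%N},
      forall i, (i < d)%N -> within (c i) (c i.+1) (h i) /\
        exists q, Kw N' q (h i) &
      forall k, f k = (m p)%:R^-1 * \sum_(i < d) h i k].

Lemma within_restr a b (c : R) (E : set nat) f : within a b f ->
  within a b (fun k => c * restr E f k).
Proof.
move=> h k; rewrite restrE => nz; apply: h; apply: contra_neq nz => ->.
by case: ifP; rewrite mulr0.
Qed.

Lemma node_restr N p f a E : `|a| <= 1 -> nat_interval E -> node N p f ->
  node N p (fun k => a * restr E f k).
Proof.
move=> a1 hE [N' [d [c [h [NN dn hc hw fE]]]]].
exists N', d, c, (fun i k => a * restr E (h i) k); split=> //.
- move=> i id; have [w [q hq]] := hw _ id.
  split; first exact: within_restr.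
  by exists q; apply: Kw_restr.
- move=> k; rewrite restrE.
  under [in RHS]eq_bigr do rewrite restrE.
  case: ifP => kE; last by rewrite big1 ?mulr0 // => i _; rewrite mulr0.
  by rewrite fE -big_distrr /= mulrCA.
Qed.

Lemma sum_pairs (V : nmodType) k (h : nat -> V) :
  \sum_(j < 2 * k) h j = \sum_(i < k) (h (2 * i)%N + h (2 * i).+1).
Proof.
elim: k => [|k IH]; first by rewrite muln0 !big_ord0.
have -> : (2 * k.+1 = (2 * k).+2)%N by lia.
by rewrite !big_ord_recr /= IH addrA.
Qed.

(** The [2 k] successors of a functional of odd weight as one sequence, in the
    order of their supports. *)
Definition odd_child psi (F : nat -> nat -> R) (lam : nat -> R) j : nat -> R :=
  if odd j then F j./2 else fun t => lam j./2 * fs psi j.+1 t.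

Lemma odd_childD psi (F : nat -> nat -> R) (lam : nat -> R) k t :
  \sum_(i < k) (lam i * fs psi (2 * i).+1 t + F i t) =
  \sum_(j < 2 * k) odd_child psi F lam j t.
Proof.
rewrite (sum_pairs k (fun j => odd_child psi F lam j t)).
apply: eq_bigr => i _; rewrite /odd_child /=.
rewrite mul2n odd_double /=.
by rewrite uphalf_double doubleK.
Qed.

(** The ranges of the entries of the special sequence separate the successors,
    as those at odd positions have the supports of entries. *)
Lemma odd_form_windows N p g k psi W E al F lam :
  odd_form N p g k psi W E al F lam ->
  exists c : nat -> nat, {homo c : i j / (i <= j)%N} /\ forall j, (j < 2 * k)%N ->
    within (c j) (c j.+1) (odd_child psi F lam j).
Proof.
move=> [[k0 nk sp] hW hE hal [hF gE]].
have [[[_ hQ hlt] sz] _ _ _] := sp.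
have hs j : (j < 2 * k)%N -> supp (odd_child psi F lam j) `<=` supp (fs psi j.+1).
  move=> jk t; rewrite /odd_child; case: ifP => oj /=.
    have [|_ sF _ _ _] := hF j./2; first by lia.
    have <- : ((2 * j./2).+2 = j.+1)%N by lia.
    by move=> h; have : supp (F j./2) t by []; rewrite sF.
  by rewrite /supp /=; apply: contra_neq => ->; rewrite mulr0.
apply: (@windows _ _ (fun j => rngs psi j.+1)).
- by move=> i ik; apply: hlt; rewrite sz /=; lia.
- by move=> i ik t /(hs _ ik) h; right; apply: supp_rng.
- apply: fin_bound; first by move=> i M M' MM h t Mk; apply: h; apply: leq_trans Mk.
  move=> j jk; have [_ [/finite_supp_bound[M hM] _ _ _]] := special_size sp (i := j.+1) ltac:(lia).
  exists M => t /hM f0; apply/eqP/negPn/negP => nz.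
  have : supp (fs psi j.+1) t by apply: hs => //.
  by rewrite /supp /= f0 eqxx.
Qed.

Lemma odd_form_child N p g k psi W E al F lam :
  odd_form N p g k psi W E al F lam -> forall j, (j < 2 * k)%N ->
  Kw N (W j.+1) (odd_child psi F lam j).
Proof.
move=> [[k0 nk sp] [Wev Wm Wc Wav] hE hal [hF gE]] j jk.
have N1 : (1 <= N)%N.
  case: (posnP N) => // N0; have [|+ _ _ _ _] := hF 0%N; first by lia.
  have [w2 _] := Wev (2 * 0).+2 ltac:(lia).
  by rewrite N0 Klevel00 //; lia.
rewrite /odd_child; case: ifP => oj.
  have [|KF _ _ _ _] := hF j./2; first by lia.
  by apply: Kw_K; rewrite (_ : j.+1 = (2 * j./2).+2)%N //; lia.
have [|_ _ lam1 _ _] := hF j./2; first by lia.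
exists (lam j./2), setT, (fs psi j.+1); split=> //.
  have [W2 Wo] := Wev j.+1 ltac:(lia).
  apply: (@Klevel_mono R m n sigma 1 N) => //.
  apply: (averages_K (x := xs psi j.+1)) => //; first by lia.
  have := Wav j./2 ltac:(lia).
  by have -> : ((2 * j./2).+1 = j.+1)%N by lia.
by move=> t; rewrite restrE in_setT.
Qed.

Lemma within_windows d (c : nat -> nat) (h : nat -> nat -> R) :
  {homo c : i j / (i <= j)%N} ->
  (forall i, (i < d)%N -> within (c i) (c i.+1) (h i)) ->
  forall k, (c d <= k)%N -> \sum_(i < d) h i k = 0.
Proof.
move=> hc hw k ck; rewrite big1 // => i _; apply: (within_out (hw _ (ltn_ord i))).
by apply/negP; have := hc i.+1 d (ltn_ord i); lia.
Qed.

Definition ord_ext d (f : 'I_d -> nat -> R) i : nat -> R :=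
  if insub i is Some j then f j else fun=> 0.

Lemma ord_extE d (f : 'I_d -> nat -> R) (i : 'I_d) : ord_ext f i = f i.
Proof. by rewrite /ord_ext valK. Qed.

Lemma Klevel_fin N p g : Kl N p g -> exists M, forall k, (M <= k)%N -> g k = 0.
Proof.
elim/ltn_ind: N p g => N IH p g.
case: (posnP p) => [->|p0].
  rewrite Klevel0 => -[k0 hk]; exists k0.+1 => k kk.
  have bk : Defs.basis R k0 k = 0 by rewrite /Defs.basis gtn_eqF.
  by case: hk => ->; rewrite ?fctE bk ?oppr0.
move=> /(Klevel_cases p0)[N' NN].
case: ifP => op.
  move=> [d [f [_ _ hf ->]]].
  have [|i id|M hM] := @fin_bound d (fun i M => forall k, (M <= k)%N -> ord_ext f i k = 0).
  - by move=> i M M' MM h k Mk; apply: h; apply: leq_trans Mk.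
  - have [q _ hq] := hf (Ordinal id); have [M hM] := IH _ NN _ _ hq.
    by exists M => k /hM; rewrite (ord_extE f (Ordinal id)).
  exists M => k Mk; rewrite fctE fct_sumE big1 ?scaler0 // => i _.
  by rewrite -ord_extE; apply: hM.
move=> /odd_dataP[k [psi [W [E [al [F [lam hg]]]]]]].
have [c [hc hw]] := odd_form_windows hg; have [_ _ _ _ [_ gE]] := hg.
exists (c (2 * k)%N) => j cj; rewrite gE odd_childD (within_windows hc hw) //.
by case: ifP; rewrite mulr0.
Qed.

Lemma even_windows N p g : (0 < p)%N -> even_step m n (Kl N) p g ->
  exists d (c : nat -> nat) (h : nat -> nat -> R),
  [/\ (0 < d <= n p)%N, {homo c : i j / (i <= j)%N},
      forall i, (i < d)%N -> within (c i) (c i.+1) (h i) /\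
        exists q, Kl N q (h i) &
      forall k, g k = (m p)%:R^-1 * \sum_(i < d) h i k].
Proof.
move=> p0 [d [f [dn hlt hf ->]]].
have hK i : (i < d)%N -> exists q, Kl N q (ord_ext f i).
  by move=> id; rewrite (ord_extE f (Ordinal id)); have [q _ ?] := hf (Ordinal id); exists q.
have [|||c [hc hw]] := @windows R d (fun i => supp (ord_ext f i)) (ord_ext f).
- move=> i id; have id' := ltnW id.
  by rewrite (ord_extE f (Ordinal id)) (ord_extE f (Ordinal id')); apply: hlt.
- by move=> i _ k.
- apply: fin_bound; first by move=> i M M' MM h k Mk; apply: h; apply: leq_trans Mk.
  by move=> i /hK[q] /Klevel_fin.
exists d, c, (ord_ext f); split=> //; first by move=> i id; split; [apply: hw|apply: hK].
move=> k; rewrite fctE fct_sumE; congr (_ * _); apply: eq_bigr => i _.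
by rewrite ord_extE.
Qed.

(** For odd weights the sign and the interval are passed on to the successors;
    here the closure of [Kw] under both is used. *)
Lemma Klevel_node N p g : (0 < p)%N -> Kl N p g -> node N p g.
Proof.
move=> p0 /(Klevel_cases p0)[N' NN].
case: ifP => op.
  move=> /(even_windows p0)[d [c [h [/andP[_ dn] hc hw gE]]]].
  exists N', d, c, h; split=> // i /hw[hi [q hq]]; split=> //.
  by exists q; apply: Kw_K.
move=> /odd_dataP[k [psi [W [E [al [F [lam hg]]]]]]].
have [c [hc hw]] := odd_form_windows hg.
have hK := odd_form_child hg.
have [[k0 nk sp] _ hE hal [_ gE]] := hg.
have mp : 0 < (m p)%:R :> R by rewrite ltr0n (param_m_gt0 hparam).
pose b := (m p)%:R * al.
have b1 : `|b| <= 1.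
  by rewrite normrM hal gtr0_norm // mulfV // gt_eqF.
exists N', (2 * k)%N, c, (fun i t => b * restr E (odd_child psi F lam i) t).
split=> //; first by rewrite nk.
  move=> i ik; split; first by apply: within_restr; apply: hw.
  by exists (W i.+1); apply: Kw_restr => //; apply: hK.
move=> t; rewrite gE odd_childD.
under [in RHS]eq_bigr do rewrite restrE.
have -> : al = (m p)%:R^-1 * b by rewrite /b mulKf // gt_eqF.
rewrite -mulrA; congr (_ * _); rewrite -big_distrr /=; congr (_ * _).
by case: ifP => // _; rewrite big1.
Qed.

Lemma Kw_node N p f : (0 < p)%N -> Kw N p f -> node N p f.
Proof.
move=> p0 [a [E [g [a1 hE /(Klevel_node p0) hg fE]]]].
by rewrite (funext fE); apply: node_restr.
Qed.

(** The successors have disjoint supports, and by induction coordinates of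
    modulus at most 1. *)
Lemma Kw_bound N p f k : Kw N p f ->
  `|f k| <= if p == 0%N then 1 else (m p)%:R^-1.
Proof.
elim/ltn_ind: N p f => N IH p f; case: (posnP p) => [->|p0].
  move=> [a [E [g [a1 hE]]]]; rewrite Klevel0 => -[k0 hk] ->.
  rewrite restrE normrM mulr_ile1 //; case: ifP => _; last by rewrite normr0.
  have : `|Defs.basis R k0 k| <= 1.
    by rewrite /Defs.basis; case: eqP; rewrite ?normr0 ?normr1.
  by case: hk => ->; rewrite ?fctE ?normrN.
move=> /(Kw_node p0)[N' [d [c [h [NN dn hc hw ->]]]]].
have mi : 0 <= (m p)%:R^-1 :> R by rewrite invr_ge0.
rewrite normrM ger0_norm // -[leRHS]mulr1 ler_wpM2l //.
apply: (windows_sum_le hc) => // i id; first exact: (hw _ id).1.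
have [_ [q hq]] := hw _ id; apply: le_trans (IH _ NN _ _ hq) _.
case: ifPn => // q0; rewrite invf_le1 ?ler1n ?ltr0n (param_m_gt0 hparam) //; lia.
Qed.

Lemma Kw_le1 N p f k : Kw N p f -> `|f k| <= 1.
Proof.
move=> h; apply: le_trans (Kw_bound k h) _; case: ifPn => // p0.
by rewrite invf_le1 ?ler1n ?ltr0n (param_m_gt0 hparam) //; lia.
Qed.

(** The zero functional is an exception: an interval may miss all successors,
    and a sum of several successors must not contain a zero summand. *)
Lemma Klevel_restr N p g E : Kl N p g -> nat_interval E ->
  (forall k, restr E g k = 0) \/ Kl N p (restr E g).
Proof.
move=> + hE; elim/ltn_ind: N p g => N IH p g; case: (posnP p) => [->|p0].
  rewrite !Klevel0 => -[k0 hk]; have [k0E|k0E] := boolP (k0 \in E).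
    right; have -> : restr E g = g; last by exists k0.
    apply/funext => k; rewrite restrE; case: ifPn => // kE.
    have bk : Defs.basis R k0 k = 0.
      by rewrite /Defs.basis; case: eqP => // kk; rewrite kk k0E in kE.
    by case: hk => ->; rewrite ?fctE bk ?oppr0.
  left => k; rewrite restrE; case: ifP => // kE.
  have bk : Defs.basis R k0 k = 0.
    by rewrite /Defs.basis; case: eqP => // kk; rewrite -kk kE in k0E.
  by case: hk => ->; rewrite ?fctE bk ?oppr0.
move=> /(Klevel_cases p0)[N' NN].
case: ifP => op.
  move=> /(even_windows p0)[d [c [h [/andP[_ dn] hc hw gE]]]].
  have rE : restr E g = fun k => (m p)%:R^-1 * \sum_(i < d) restr E (h i) k.
    apply/funext => k; rewrite restrE.
    under eq_bigr do rewrite restrE.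
    by case: ifP => // _; rewrite ?gE // big1 ?mulr0.
  have [[i id [k hk]]|none] :=
      pselect (exists2 i, (i < d)%N & exists k, restr E (h i) k != 0).
    right; rewrite rE; apply: (@Klevel_mono _ _ _ _ N'.+1) => //.
    apply: (@even_build R m n sigma N' p d c (fun i => restr E (h i)) p0 op dn hc).
    - move=> j jd t; rewrite restrE => nz; apply: (hw _ jd).1.
      by apply: contra_neq nz => ->; case: ifP.
    - move=> j jd; have [_ [q hq]] := hw _ jd.
      by have [z|K] := IH _ NN _ _ hq; [left|right; exists q].
    - by exists i => //; exists k.
  left => k; rewrite rE big1 ?mulr0 // => i _.
  by apply/eqP/negPn/negP => nz; apply: none; exists i => //; exists k.
move=> [k [phi [p3 nk sp hf [E' [eps [F [lam [hE' heps hF gE]]]]]]]].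
right; apply: (@Klevel_mono _ _ _ _ N'.+1) => //; rewrite KlevelS // op; right.
exists k, phi; split=> //; exists (E `&` E'), eps, F, lam; split=> //.
  exact: nat_intervalI.
rewrite gE; apply/funext => t; rewrite restrE.
change ((if t \in E then (eps / (m p)%:R) * restr E' (\sum_(1 <= i < k.+1)
              (lam i *: fs phi (2 * i).-1 + F i)) t else 0) =
  (eps / (m p)%:R) * restr (E `&` E') (\sum_(1 <= i < k.+1)
              (lam i *: fs phi (2 * i).-1 + F i)) t).
by rewrite !restrE in_setI; case: (t \in E); case: (t \in E'); rewrite ?mulr0.
Qed.

Lemma Klevel_opp N p g : Kl N p g -> Kl N p (fun k => - g k).
Proof.
elim/ltn_ind: N p g => N IH p g; case: (posnP p) => [->|p0].
  rewrite !Klevel0 => -[k0 hk]; exists k0.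
  by case: hk => ->; [right|left]; apply/funext => k //; rewrite fctE opprK.
move=> /(Klevel_cases p0)[N' NN] h.
apply: (@Klevel_mono _ _ _ _ N'.+1) => //; rewrite KlevelS //; right.
move: h; case: ifP => op.
  move=> [d [f [dn hlt hf ->]]]; exists d, (fun i k => - f i k); split=> //.
  - move=> i j ij; have := hlt _ _ ij.
    have sE l : supp (fun k => - f l k) = supp (f l).
      by apply/funext => k; rewrite /supp /= oppr_eq0.
    by rewrite !sE.
  - by move=> i; have [q _ hq] := hf i; exists q => //; apply: IH.
  - apply/funext => k; rewrite !fctE !fct_sumE -scalerN; congr (_ *: _).
    by rewrite -sumrN.
move=> [k [phi [p3 nk sp hf [E' [eps [F [lam [hE' heps hF gE]]]]]]]].
exists k, phi; split=> //; exists E', (- eps), F, lam; split=> //.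
  by case: heps => ->; rewrite ?opprK; [right|left].
by rewrite gE; apply/funext => t; rewrite mulNr scaleNr.
Qed.

(** The entries of special sequences are rational, so only rational
    functionals can occur in them. *)
Definition israt (a : R) := exists q : rat, a = ratr q.

Lemma israt0 : israt 0. Proof. by exists 0; rewrite rmorph0. Qed.
Lemma isratD a b : israt a -> israt b -> israt (a + b).
Proof. by move=> [p ->] [q ->]; exists (p + q); rewrite rmorphD. Qed.
Lemma isratM a b : israt a -> israt b -> israt (a * b).
Proof. by move=> [p ->] [q ->]; exists (p * q); rewrite rmorphM. Qed.
Lemma isratN a : israt a -> israt (- a).
Proof. by move=> [p ->]; exists (- p); rewrite rmorphN. Qed.
Lemma isratV a : israt a -> israt a^-1.
Proof. by move=> [p ->]; exists p^-1; rewrite fmorphV. Qed.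
Lemma israt_nat k : israt k%:R.
Proof. by exists k%:R; rewrite ratr_nat. Qed.
Lemma israt_sum I (r : seq I) (P : pred I) (F : I -> R) :
  (forall i, P i -> israt (F i)) -> israt (\sum_(i <- r | P i) F i).
Proof.
by move=> h; apply: big_ind => //; [exact: israt0|exact: isratD].
Qed.
Lemma israt_norm a b : `|a| = b -> israt b -> israt a.
Proof.
move=> <-; case: (ger0P a) => _ // /isratN; by rewrite opprK.
Qed.

Lemma Klevel_rat N p g k : Kl N p g -> israt (g k).
Proof.
elim/ltn_ind: N p g k => N IH p g k; case: (posnP p) => [->|p0].
  rewrite !Klevel0 => -[k0 hk].
  have bk : israt (Defs.basis R k0 k) by apply: israt_nat.
  by case: hk => -> //; apply: isratN.
move=> /(Klevel_cases p0)[N' NN].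
case: ifP => op.
  move=> /(even_windows p0)[d [c [h [/andP[_ dn] hc hw ->]]]].
  apply: isratM; first exact/isratV/israt_nat.
  by apply: israt_sum => i _; have [_ [q]] := hw _ (ltn_ord i); apply: IH.
move=> /odd_dataP[l [psi [W [E [al [F [lam hg]]]]]]].
have [[l0 nl sp] _ _ hal [hF ->]] := hg.
apply: isratM; first by apply: (israt_norm hal); exact/isratV/israt_nat.
case: ifP => _; last exact: israt0.
apply: israt_sum => i _; have [KF _ _ lam1 lam0] := hF _ (ltn_ord i).
have Frat t : israt (F i t) by apply: IH KF.
apply: isratD => //.
have il := ltn_ord i.
have [[xfin _ xrat _] _] := special_size sp (i := (2 * i).+2) ltac:(lia).
have [_ [_ _ frat _]] := special_size sp (i := (2 * i).+1) ltac:(lia).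
apply: isratM; last exact: frat.
have [d0|d0] := eqVneq (dual_pair (F i) (xs psi (2 * i).+2)) 0.
  apply: (israt_norm (lam0 d0)); apply: isratV; rewrite -natrX; exact: israt_nat.
rewrite lam1 //; apply: isratM; first exact: israt_nat.
have [M hM] := finite_supp_bound xfin; rewrite (dual_pair_fin _ hM).
by apply: israt_sum => t _; apply: isratM; [exact: Frat | exact: xrat].
Qed.

End Nodes.

(** * The norm *)

Section Norm.
Context {R : realType}.
Variables (m n s : nat -> nat) (sigma : vecs R -> nat).
Hypothesis hparam : parameters m n s.
Hypothesis hsigma : coding m sigma.
Implicit Types (f g h : nat -> R) (u v : c00 R).

Local Notation Kl := (Klevel m n sigma).
Local Notation Kw := (Kw m n sigma).
Local Coercion c00_val : c00 >-> Funclass.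
Local Arguments c00_val : simpl never.

Definition nrm u := normK m n sigma u.

Lemma normK_has_sup u : has_sup [set dual_pair f u | f in Kset m n sigma].
Proof.
split.
  exists (dual_pair (Defs.basis R 0) u), (Defs.basis R 0) => //.
  by exists 0%N => //; exists 0%N => //; exists 0%N; left.
have [M h] := c00_bound u; exists (1 * \sum_(k < M) `|u k|) => _ [f [N _ [p _ hf]] <-].
apply: le_trans (ler_norm _) _; apply: (@ev_abs_le _ f u) => // k.
exact: (Kw_le1 hparam hsigma k (Kw_K hf)).
Qed.

Lemma Klevel_nrm N p g u : Kl N p g -> `|ev g u| <= nrm u.
Proof.
move=> hg; have hsup := normK_has_sup u.
rewrite ler_norml; apply/andP; split; last first.
  apply: sup_ubound; first by case: hsup.
  by exists g => //; exists N => //; exists p.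
rewrite lerNl; apply: sup_ubound; first by case: hsup.
exists (fun k => - g k); first by exists N => //; exists p => //; apply: Klevel_opp.
have := @evZl R g (-1) u; rewrite mulN1r => <-.
by congr dual_pair; apply/funext => k; rewrite mulN1r.
Qed.

Lemma nrm_ge0 u : 0 <= nrm u.
Proof.
apply: le_trans (normr_ge0 (ev (Defs.basis R 0) u)) _.
by apply: (@Klevel_nrm 0 0); exists 0%N; left.
Qed.

Lemma Kw_nrm N p f u : Kw N p f -> `|ev f u| <= nrm u.
Proof.
move=> [a [E [g [a1 hE hg fE]]]].
have -> : ev f u = a * ev (restr E g) u by rewrite -evZl; congr dual_pair; apply/funext.
rewrite normrM; have [z|K] := Klevel_restr hparam hsigma hg hE.
  rewrite (_ : ev (restr E g) u = 0) ?normr0 ?mulr0 ?nrm_ge0 //.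
  by apply: ev_disj => k; left; rewrite z.
apply: le_trans (Klevel_nrm u K); rewrite -[leRHS]mul1r.
by apply: ler_wpM2r.
Qed.

Lemma nrm_le u c : (forall N p g, Kl N p g -> `|ev g u| <= c) -> nrm u <= c.
Proof.
move=> h; apply: ge_sup; first by case: (normK_has_sup u).
move=> _ [f [N _ [p _ hf]] <-]; apply: le_trans (ler_norm _) _.
exact: h hf.
Qed.

Lemma nrm_adherent u e : 0 < e -> exists N p g, Kl N p g /\ nrm u - e < ev g u.
Proof.
move=> e0; have [_ [f [N _ [p _ hf]] <-] h] := sup_adherent e0 (normK_has_sup u).
by exists N, p, f.
Qed.

End Norm.

(** * Splitting a block sequence by successive functionals *)

Section Splitting.
Context {R : realType}.
Local Coercion c00_val : c00 >-> Funclass.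
Local Arguments c00_val : simpl never.
Variables (x : nat -> c00 R) (r : nat -> nat).
Hypothesis hr : {homo r : i j / (i <= j)%N}.
Hypothesis hx : forall k, within (r k) (r k.+1) (x k).

(** [b'] is the only entry that a boundary at [e] between two windows may
    cut. *)
Lemma split_point (a b e : nat) : (a <= b)%N -> exists b',
  [/\ (a <= b' <= b)%N, forall k, (a <= k < b')%N -> (r k.+1 <= e)%N &
      forall k, (b' < k)%N -> (b' < b)%N -> (e <= r k)%N].
Proof.
move=> ab; pose P k := (a <= k)%N && ((b <= k)%N || (e < r k.+1)%N).
have exP : exists k, P k by exists b; rewrite /P ab leqnn.
case: (ex_minnP exP) => b' /andP[ab' hb'] bmin; exists b'; split.
- by rewrite ab' bmin // /P ab leqnn.
- move=> k /andP[ak kb']; rewrite leqNgt; apply/negP => ek.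
  have : P k by rewrite /P ak ek orbT.
  by move=> /bmin; lia.
- move=> k b'k b'b; case/orP: hb'; first by lia.
  by have := hr b'k; lia.
Qed.

Lemma sum_nat_split3 (F : nat -> c00 R) a b c : (a <= b < c)%N ->
  \sum_(a <= k < c) F k =
  \sum_(a <= k < b) F k + F b + \sum_(b.+1 <= k < c) F k.
Proof.
move=> /andP[ab bc]; rewrite (@big_cat_nat _ _ _ b) //=; last exact: ltnW.
by rewrite -addrA; congr (_ + _); rewrite big_ltn.
Qed.

Lemma within_block_sum a b : within (r a) (r b) (\sum_(a <= k < b) x k).
Proof.
rewrite big_seq_cond; apply: within_sum => k; rewrite mem_index_iota andbT => akb.
by apply: within_sub (@hx k) _ _; apply: hr; lia.
Qed.

Variables (d : nat) (c : nat -> nat) (f : nat -> nat -> R).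
Hypothesis hc : {homo c : i j / (i <= j)%N}.
Hypothesis hf : forall i, (i < d)%N -> within (c i) (c i.+1) (f i).

(** An entry of the block sequence is either seen by one functional only, or
    it is cut by one of the windows; there are at most as many cut entries as
    functionals. Each functional thus sees an interval of entries, and the cut
    entries are estimated separately. The induction adds the functionals one
    by one: the new one sees what lies beyond the entry cut by the boundary.
    The bound has to be affine, so that the estimates on the intervals add
    up. *)
Lemma split_affine (A B : R) : 0 <= A -> 0 <= B ->
  (forall i a b, (i < d)%N -> (a < b)%N ->
     `|ev (f i) (\sum_(a <= k < b) x k)| <= A + B * (b - a)%:R) ->
  (forall d' k, (d' <= d)%N -> `|\sum_(i < d') ev (f i) (x k)| <= A + B) ->
  forall a b, (a <= b)%N ->
  `|\sum_(i < d) ev (f i) (\sum_(a <= k < b) x k)|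
     <= (2 * d)%:R * A + B * (b - a)%:R.
Proof.
move=> A0 B0 h1 h2.
suff H d' : (d' <= d)%N -> forall a b, (a <= b)%N ->
    `|\sum_(i < d') ev (f i) (\sum_(a <= k < b) x k)|
     <= (2 * d')%:R * A + B * (b - a)%:R by exact: H.
elim: d' => [_ a b ab|d' IH dd a b ab].
  by rewrite big_ord0 normr0 muln0 mul0r add0r mulr_ge0.
have dd' := ltnW dd.
have [b' [/andP[ab' b'b] hlow hhigh]] := split_point (c d') ab.
have low0 a1 b1 : (a <= a1)%N -> (b1 <= b')%N -> ev (f d') (\sum_(a1 <= k < b1) x k) = 0.
  move=> aa bb; rewrite ev_sum big_seq big1 // => k; rewrite mem_index_iota => kk.
  by apply: within_ev0 (hf dd) (hx (k := k)) _; right; apply: hlow; lia.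
have [b'E|b'lt] := leqP b b'.
  have bb : b = b' by lia.
  rewrite big_ord_recr /= low0 ?bb ?leqnn // addr0 -bb.
  apply: le_trans (IH dd' _ _ ab) _; rewrite lerD2r ler_wpM2r // ler_nat; lia.
have high0 (i : 'I_d') : ev (f i) (\sum_(b'.+1 <= k < b) x k) = 0.
  have id : (i < d)%N by apply: leq_trans (ltn_ord i) dd'.
  rewrite ev_sum big_seq big1 // => k; rewrite mem_index_iota => /andP[kk _].
  apply: within_ev0 (hf id) (hx (k := k)) _; left.
  by apply: leq_trans (hc (ltn_ord i)) (hhigh _ kk b'lt).
have -> : \sum_(i < d'.+1) ev (f i) (\sum_(a <= k < b) x k) =
    \sum_(i < d') ev (f i) (\sum_(a <= k < b') x k)
    + \sum_(i < d'.+1) ev (f i) (x b') + ev (f d') (\sum_(b'.+1 <= k < b) x k).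
  rewrite [in LHS]big_ord_recr /= (@sum_nat_split3 x a b' b) ?ab' //.
  under eq_bigr do rewrite !evD high0 addr0.
  rewrite big_split /= !evD low0 // [in RHS]big_ord_recr /=; ring.
have e1 := IH dd' _ _ ab'.
have e2 := h2 d'.+1 b' dd.
have e3 : `|ev (f d') (\sum_(b'.+1 <= k < b) x k)| <= A + B * (b - b'.+1)%:R.
  have [lt|ge] := ltnP b'.+1 b; first exact: h1.
  by rewrite big_geq // ev0 normr0 addr_ge0 // mulr_ge0.
apply: le_trans (ler_normD _ _) _.
apply: le_trans (lerD (ler_normD _ _) (lexx _)) _.
have -> : (b - a = (b' - a) + 1 + (b - b'.+1))%N by lia.
have -> : (2 * d'.+1 = 2 * d' + 2)%N by lia.
rewrite !natrD; lra.
Qed.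

(** When each functional is only controlled on single entries, an entry counts
    once, and once more for each boundary that cuts it. *)
Lemma split_count (e : R) : 0 <= e ->
  (forall i k, (i < d)%N -> `|ev (f i) (x k)| <= e) ->
  forall a b, (a <= b)%N ->
  `|\sum_(i < d) ev (f i) (\sum_(a <= k < b) x k)| <= e * (b - a + d)%:R.
Proof.
move=> e0 h1.
suff H d' : (d' <= d)%N -> forall a b, (a <= b)%N ->
    `|\sum_(i < d') ev (f i) (\sum_(a <= k < b) x k)| <= e * (b - a + d')%:R.
  exact: H.
elim: d' => [_ a b ab|d' IH dd a b ab].
  by rewrite big_ord0 normr0 mulr_ge0.
have dd' := ltnW dd.
have [b' [/andP[ab' b'b] hlow hhigh]] := split_point (c d') ab.
have low0 : ev (f d') (\sum_(a <= k < b') x k) = 0.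
  rewrite ev_sum big_seq big1 // => k; rewrite mem_index_iota => kk.
  by apply: within_ev0 (hf dd) (hx (k := k)) _; right; apply: hlow; lia.
pose b2 := minn b'.+1 b.
have ab2 : (a <= b2)%N by rewrite /b2; lia.
have b2b : (b2 <= b)%N by rewrite /b2; lia.
have high0 (i : 'I_d') : ev (f i) (\sum_(b2 <= k < b) x k) = 0.
  have id : (i < d)%N by apply: leq_trans (ltn_ord i) dd'.
  rewrite ev_sum big_seq big1 // => k; rewrite mem_index_iota => /andP[kk kb].
  apply: within_ev0 (hf id) (hx (k := k)) _; left.
  by apply: leq_trans (hc (ltn_ord i)) (hhigh _ _ _); move: kk; rewrite /b2; lia.
rewrite big_ord_recr /=.
have -> : \sum_(i < d') ev (f i) (\sum_(a <= k < b) x k) =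
   \sum_(i < d') ev (f i) (\sum_(a <= k < b2) x k).
  apply: eq_bigr => i _; rewrite (@big_cat_nat _ _ _ b2) //= evD high0 addr0 //.
rewrite (@big_cat_nat _ _ _ b' a b) //= evD low0 add0r.
have e2 : `|ev (f d') (\sum_(b' <= k < b) x k)| <= e * (b - b')%:R.
  rewrite ev_sum; apply: le_trans (ler_norm_sum _ _ _) _.
  apply: (@le_trans _ _ (\sum_(b' <= k < b) e)); first by apply: ler_sum => k _; apply: h1.
  by rewrite big_const_nat iter_addr addr0 mulr_natr.
apply: le_trans (ler_normD _ _) _.
apply: le_trans (lerD (IH dd' _ _ ab2) e2) _.
rewrite -mulrDr -natrD ler_wpM2l // ler_nat /b2; lia.
Qed.

End Splitting.

(** * Upper estimates for block sequences *)

Section Estimates.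
Context {R : realType}.
Variables (m n s : nat -> nat) (sigma : vecs R -> nat).
Hypothesis hparam : parameters m n s.
Hypothesis hsigma : coding m sigma.
Implicit Types (f g h : nat -> R).

Local Notation Kl := (Klevel m n sigma).
Local Notation Kw := (Kw m n sigma).
Local Notation nrm := (nrm m n sigma).
Local Coercion c00_val : c00 >-> Funclass.
Local Arguments c00_val : simpl never.

Definition block_seq (x : nat -> c00 R) (r : nat -> nat) :=
  {homo r : i j / (i <= j)%N} /\ forall k, within (r k) (r k.+1) (x k).

Lemma Kw0_single N f : Kw N 0 f -> exists k0, forall k, k != k0 -> f k = 0.
Proof.
move=> [a [E [g [a1 hE]]]]; rewrite Klevel0 => -[k0 hk] fE; exists k0 => k kk.
have bk : Defs.basis R k0 k = 0 by rewrite /Defs.basis (negbTE kk).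
rewrite fE restrE; case: ifP => _; last by rewrite mulr0.
by case: hk => ->; rewrite ?fctE bk ?oppr0 mulr0.
Qed.

(** A multiple of a basis functional sees at most one entry. *)
Lemma Kw0_block N f (x : nat -> c00 R) r (C : R) : Kw N 0 f -> block_seq x r -> 0 <= C ->
  forall a b, (forall k, (a <= k < b)%N -> `|ev f (x k)| <= C) ->
  `|ev f (\sum_(a <= k < b) x k)| <= C.
Proof.
move=> /Kw0_single[k0 fk0] [hr hx] C0 a b hC.
pose h i t : R := if (a <= i)%N && (t == k0) then ev f (x i) else 0.
have -> : ev f (\sum_(a <= k < b) x k) = \sum_(i < b) h i k0.
  rewrite ev_sum -(big_mkord xpredT (fun i => h i k0)) /h eqxx.
  under [RHS]eq_bigr do rewrite andbT.
  have [ab|ba] := ltnP a b; last first.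
    rewrite (@big_geq _ _ _ a b) //.
    rewrite big_nat big1 // => i /andP[_ ib]; rewrite ifN //; lia.
  rewrite (@big_cat_nat _ _ _ a 0 b) //=; last exact: ltnW.
  rewrite [X in _ = X + _](_ : _ = 0) ?add0r.
    by apply: eq_big_nat => i /andP[-> _].
  by rewrite big_nat big1 // => i /andP[_ ia]; rewrite ifN // -ltnNge.
apply: (windows_sum_le hr) => // i ib.
  move=> t; rewrite /h; case: ifP; last by rewrite eqxx.
  move=> /andP[_ /eqP ->] nz; apply: hx; apply: contra_neq nz => xk.
  apply: ev_disj => k; have [->|kk] := eqVneq k k0; first by right.
  by left; apply: fk0.
rewrite /h eqxx andbT; case: ifP => ai; last by rewrite normr0.
by apply: hC; rewrite ai.
Qed.

Section Growth.
Variables (J : nat) (psi : nat -> R).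
Hypothesis J2 : (2 <= J)%N.
Hypothesis psi1 : forall t, (1 <= t)%N -> 1 <= psi t.
Hypothesis psi2 : forall d t, (1 <= d <= n J.-1)%N -> (1 <= t)%N ->
  exists A B : R, [/\ 0 <= A, 0 <= B,
            forall u, (1 <= u)%N -> psi u <= A + B * u%:R &
            (2 * d)%:R * A + B * t%:R <= 2 * psi t].
Variables (x : nat -> c00 R) (r : nat -> nat) (C tau : R).
Hypothesis hxr : block_seq x r.
Hypothesis C0 : 0 <= C.
Hypothesis tau0 : 0 <= tau.
Hypothesis hlow : forall N p f k, (1 <= p < J)%N -> Kw N p f ->
  `|ev f (x k)| <= C / (m p)%:R.
Hypothesis hhigh : forall N p f a b, p = 0%N \/ (J <= p)%N -> (a < b)%N ->
  Kw N p f -> `|ev f (\sum_(a <= k < b) x k)| <= C * (1 + (b - a)%:R * tau).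

(** The basic inequality.  A functional of weight [m_p] with [p < J] splits
    the sequence; its successors obey the same estimate, by induction on the
    level, and the concavity of [psi] loses at most a factor 2, which is
    compensated by [m_p >= 2].  The gain in the linear term is kept. *)
Lemma basic_inequality N p f a b : (a < b)%N -> Kw N p f ->
  `|ev f (\sum_(a <= k < b) x k)| <=
    C * (psi (b - a) + (b - a)%:R * tau / (if (1 <= p < J)%N then (m p)%:R else 1)).
Proof.
elim/ltn_ind: N p f a b => N IH p f a b ab hf.
set t := (b - a)%N; have t1 : (1 <= t)%N by rewrite /t; lia.
case: ifPn => hp; last first.
  have hp' : p = 0%N \/ (J <= p)%N by move: hp; lia.
  apply: le_trans (hhigh hp' ab hf) _; rewrite divr1 ler_wpM2l // lerD2r.
  exact: psi1.
have [p1 pJ] := andP hp.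
have [N' [d [c [h [NN dn hc hw fE]]]]] := Kw_node hparam hsigma p1 hf.
have mp : 2 <= (m p)%:R :> R by rewrite ler_nat (param_m_ge2 hparam).
have mp0 : 0 < (m p)%:R :> R by lra.
have evE (u : c00 R) : ev f u = (m p)%:R^-1 * \sum_(i < d) ev (h i) u.
  rewrite -ev_suml -evZl; congr dual_pair; exact/funext.
rewrite evE normrM ger0_norm; last by rewrite invr_ge0 ltW.
have [d0|d0] := posnP d.
  rewrite d0 big_ord0 normr0 mulr0 mulr_ge0 // addr_ge0 //.
    by apply: le_trans (psi1 t1).
  by rewrite divr_ge0 ?mulr_ge0 // ltW.
have dJ : (1 <= d <= n J.-1)%N.
  by rewrite d0 (leq_trans dn) // (param_n_mono hparam) //; lia.
have [A [B [A0 B0 hAB hABt]]] := psi2 dJ t1.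
have [hr hx] := hxr.
have key := @split_affine R x r hr hx d c h hc (fun i id => (hw i id).1)
  (C * A) (C * (B + tau)).
have {key} : `|\sum_(i < d) ev (h i) (\sum_(a <= k < b) x k)|
   <= (2 * d)%:R * (C * A) + C * (B + tau) * t%:R.
  apply: key; rewrite ?mulr_ge0 ?addr_ge0 //; last exact: ltnW.
  - move=> i a' b' id ab'; have [_ [q hq]] := hw _ id.
    apply: le_trans (IH _ NN _ _ _ _ ab' hq) _.
    have -> : C * A + C * (B + tau) * (b' - a')%:R =
      C * (A + B * (b' - a')%:R + (b' - a')%:R * tau) by ring.
    rewrite ler_wpM2l // lerD //.
      by apply: hAB; lia.
    rewrite ler_piMr ?mulr_ge0 //.
    case: ifP => [/andP[q1 _]|]; last by rewrite invr1.
    by rewrite invf_le1 ?ler1n ?ltr0n (param_m_gt0 hparam).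
  - move=> d' k dd.
    (* the first [d'] successors form a restriction of [f], to which [hlow]
       applies *)
    have le1 : `|1 : R| <= 1 by rewrite normr1.
    have hE := Kw_restr le1 (@nat_interval_itv (0%N) (c d')) hf.
    have := hlow k hp hE.
    have -> : ev (fun i => 1 * restr [set k | (0 <= k < c d')%N] f i) (x k) =
       (m p)%:R^-1 * \sum_(i < d') ev (h i) (x k).
      rewrite -ev_suml -evZl; congr dual_pair; apply/funext => i.
      rewrite mul1r restrE in_itv_set /=; case: ltnP => ic.
        rewrite fE; congr (_ * _).
        rewrite -(big_mkord xpredT (fun j => h j i)) (@big_cat_nat _ _ _ d') //=.
        rewrite big_mkord [X in _ + X]big_nat [X in _ + X]big1 ?addr0 //.
        move=> j /andP[jd' jd]; apply: (within_out (hw _ jd).1).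
        by have hh := hc _ _ jd'; apply/negP; lia.
      rewrite (within_windows hc (d := d')) ?mulr0 //.
      by move=> j jd; apply: (hw _ _).1; lia.
    rewrite normrM ger0_norm; last by rewrite invr_ge0 ltW.
    rewrite mulrC ler_pM2r ?invr_gt0 // => /le_trans; apply.
    have AB : 1 <= A + B.
      by apply: le_trans (psi1 (leqnn 1)) _; have := hAB 1%N (leqnn _); rewrite mulr1.
    have := mulr_ge0 C0 tau0; have := ler_wpM2l C0 AB; lra.
move=> key; rewrite mulrC ler_pdivrMr //; apply: le_trans key _.
have -> : (2 * d)%:R * (C * A) + C * (B + tau) * t%:R =
  C * ((2 * d)%:R * A + B * t%:R + t%:R * tau) by ring.
have -> : C * (psi t + t%:R * tau / (m p)%:R) * (m p)%:R =
  C * (psi t * (m p)%:R + t%:R * tau) by field; rewrite gt_eqF.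
rewrite ler_wpM2l // lerD2r.
apply: le_trans hABt _; rewrite mulrC ler_wpM2l //.
by apply: le_trans (psi1 t1).
Qed.

End Growth.

(** The sequence is continued by zero. *)
Lemma basic_inequality_fin T J (psi : nat -> R) (x : nat -> c00 R) r (C tau : R) :
  (2 <= J)%N -> (forall t, (1 <= t)%N -> 1 <= psi t) ->
  (forall d t, (1 <= d <= n J.-1)%N -> (1 <= t)%N ->
  exists A B : R, [/\ 0 <= A, 0 <= B,
            forall u, (1 <= u)%N -> psi u <= A + B * u%:R &
            (2 * d)%:R * A + B * t%:R <= 2 * psi t]) ->
  {homo r : i j / (i <= j)%N} ->
  (forall k, (k < T)%N -> within (r k) (r k.+1) (x k)) ->
  0 <= C -> 0 <= tau ->
  (forall N p f k, (k < T)%N -> (1 <= p < J)%N -> Kw N p f ->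
     `|ev f (x k)| <= C / (m p)%:R) ->
  (forall N p f a b, p = 0%N \/ (J <= p)%N -> (a < b <= T)%N ->
    Kw N p f -> `|ev f (\sum_(a <= k < b) x k)| <= C * (1 + (b - a)%:R * tau)) ->
  forall N p f a b, (a < b <= T)%N -> Kw N p f ->
  `|ev f (\sum_(a <= k < b) x k)| <=
    C * (psi (b - a)%N + (b - a)%:R * tau / (if (1 <= p < J)%N then (m p)%:R else 1)).
Proof.
move=> J2 psi1 psi2 hr hx C0 tau0 hlow hhigh N p f a b /andP[ab bT] hf.
pose y k := if (k < T)%N then x k else 0.
have yE a' b' : (b' <= T)%N -> \sum_(a' <= k < b') x k = \sum_(a' <= k < b') y k.
  by move=> bb; apply: eq_big_nat => k kk; rewrite /y ifT //; lia.
rewrite yE //; apply: (@basic_inequality J psi J2 psi1 psi2 y r C tau _ C0 tau0 _ _ N p f) => //.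
- split=> // k; rewrite /y; case: ifP => kT; first exact: hx.
  by move=> i; rewrite c000 eqxx.
- move=> N' p' f' k hp' hf'; rewrite /y; case: ifP => kT; first exact: hlow hf'.
  by rewrite ev0 normr0 divr_ge0.
- move=> N' p' f' a' b' hp' ab' hf'.
  pose b2 := minn b' T.
  have [Ta|aT] := leqP T a'.
    rewrite big_nat big1 ?ev0 ?normr0 ?mulr_ge0 ?addr_ge0 ?mulr_ge0 // => k kk.
    by rewrite /y ifF //; lia.
  have -> : \sum_(a' <= k < b') y k = \sum_(a' <= k < b2) x k.
    rewrite yE; last by rewrite /b2; lia.
    rewrite (@big_cat_nat _ _ _ b2) //=; [|by rewrite /b2; lia..].
    rewrite [X in _ + X]big_nat [X in _ + X]big1 ?addr0 // => k; rewrite /b2 => kk.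
    by rewrite /y ifF //; lia.
  apply: le_trans (hhigh _ _ _ _ _ hp' _ hf') _; first by rewrite /b2; lia.
  rewrite ler_wpM2l // lerD2l ler_wpM2r // ler_nat /b2; lia.
Qed.

(** * Rapidly increasing sequences and exact vectors *)

(** Rapidly increasing sequences. Usually the entries are required to be
    controlled by weights that increase fast with the position; a functional
    of weight above [m_P] is then large on at most one entry, which is all
    that the last clause retains. *)
Definition ris (C : R) P (x : nat -> c00 R) r := block_seq x r /\
  [/\ forall N p f k, Kw N p f -> `|ev f (x k)| <= C,
      forall N p f k, (1 <= p <= P)%N -> Kw N p f -> `|ev f (x k)| <= C / (m p)%:R &
      forall N p f a b, (P < p)%N -> (a < b)%N -> Kw N p f ->
        `|ev f (\sum_(a <= k < b) x k)| <= C * (1 + (b - a)%:R / (m P)%:R ^+ 5)].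

(** What attaches a vector to the weight [m_P]: functionals of other weights
    are small on it. *)
Definition exact_vec P (z : c00 R) := forall N p f, Kw N p f ->
  [/\ `|ev f z| <= 2, p = P -> `|ev f z| <= 1 &
      (1 <= p)%N -> p != P -> `|ev f z| <= 2 / (m (minn p P))%:R].

(** Weights below [m_P] are the substance: here the basic inequality applies,
    and the gain is the small value of [psi] at [n_P]. Above [m_P] the last
    clause of the definition of rapidly increasing sequences suffices, and at
    [m_P] the triangle inequality. *)
Lemma ris_exact C P (x : nat -> c00 R) r : (2 <= P)%N -> 0 < C -> ris C P x r ->
  exact_vec P (((m P)%:R / (C * (n P)%:R)) *: \sum_(0 <= k < n P) x k).
Proof.
move=> P2 C0 [hb [hC hlow hhigh]] N p f hf.
have P1 : (1 <= P)%N by lia.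
set M : R := (m P)%:R; set D : R := (n P)%:R.
have M2 : 2 <= M by rewrite ler_nat (param_m_ge2 hparam).
have M0 : 0 < M by lra.
have DM : M ^+ 6 <= D by rewrite -natrX ler_nat (param_m_le_n hparam).
have n0 : (0 < n P)%N by apply: (param_n_gt0 hparam).
have D0 : 0 < D by rewrite ltr0n.
rewrite evZ normrM gtr0_norm; last by rewrite divr_gt0 // mulr_gt0.
set S := `|ev f _|.
have red c : S <= C * (D / M * c) -> M / (C * D) * S <= c.
  move=> h; rewrite mulrAC ler_pdivrMr ?mulr_gt0 //.
  have -> : c * (C * D) = M * (C * (D / M * c)) by field; rewrite gt_eqF.
  by rewrite ler_pM2l.
have eq_case : p = P -> M / (C * D) * S <= 1.
  move=> pP; apply: red; rewrite /S ev_sum; apply: le_trans (ler_norm_sum _ _ _) _.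
  apply: (@le_trans _ _ (\sum_(0 <= k < n P) C / M)).
    by apply: ler_sum => k _; rewrite /M -pP; apply: hlow hf; lia.
  rewrite sumr_const_nat subn0 -mulr_natr -/D le_eqVlt; apply/orP; left.
  by apply/eqP; ring.
have high_case : (P < p)%N -> M / (C * D) * S <= 2 / M.
  move=> Pp; apply: red; apply: le_trans (hhigh _ _ _ _ _ Pp n0 hf) _.
  rewrite subn0 ler_pM2l // -/D -/M.
  have -> : D / M * (2 / M) = D / M ^+ 2 + D / M ^+ 2 by field; rewrite gt_eqF.
  apply: lerD; last first.
    by rewrite ler_pM2l // lef_pV2 ?posrE ?exprn_gt0 // ler_eXn2l //; lra.
  rewrite ler_pdivlMr ?exprn_gt0 // mul1r; apply: le_trans DM.
  by rewrite ler_eXn2l //; lra.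
have low_case : (1 <= p)%N -> (p < P)%N -> M / (C * D) * S <= 2 / (m p)%:R.
  move=> p1 pP; apply: red.
  have [psi [psi1 psi2 psiN]] := @concave_growth R m n s hparam P P2.
  have := @basic_inequality P psi P2 psi1 psi2 x r C M^-1 hb (ltW C0) _ _ _ N p f 0%N (n P) n0 hf.
  rewrite p1 pP subn0 /= -/S -/D; move=> /(_ _ _ _) h; apply: le_trans (h _ _ _) _.
  - by rewrite invr_ge0 ltW.
  - by move=> N' p' f' k hp' hf'; apply: hlow hf'; lia.
  - move=> N' p' f' a b [p0|Pp'] ab hf'.
      rewrite p0 in hf'; apply: (@le_trans _ _ C); first last.
        by rewrite ler_peMr ?(ltW C0) // lerDl divr_ge0 // ltW.
      by apply: (Kw0_block hf' hb (ltW C0)) => k _; apply: hC hf'.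
    move: Pp'; rewrite leq_eqVlt => /predU1P[PE|Pp'].
      rewrite ev_sum; apply: le_trans (ler_norm_sum _ _ _) _.
      apply: (@le_trans _ _ (\sum_(a <= k < b) C / M)).
        by apply: ler_sum => k _; rewrite /M PE; apply: hlow hf'; lia.
      rewrite sumr_const_nat -[leLHS]mulr_natr.
      have -> : C / M * (b - a)%:R = C * ((b - a)%:R * M^-1) by ring.
      by rewrite ler_pM2l // lerDr.
    apply: le_trans (hhigh _ _ _ _ _ Pp' ab hf') _.
    rewrite ler_pM2l // lerD2l ler_wpM2l // lef_pV2 ?posrE ?exprn_gt0 //.
    by rewrite -/M -[leLHS]expr1 ler_eXn2l //; lra.
  - rewrite ler_pM2l //.
    have q0 : 0 < (m p)%:R :> R by rewrite ltr0n (param_m_gt0 hparam).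
    have qM : (m p)%:R <= M by rewrite ler_nat (param_m_mono hparam) // ltnW.
    have -> : D / M * (2 / (m p)%:R) = D / M / (m p)%:R + D / M / (m p)%:R.
      by field; rewrite !gt_eqF.
    apply: lerD => //; apply: le_trans psiN _; rewrite -/D -/M -mulrA ler_pM2l //.
    rewrite -invfM lef_pV2 ?posrE ?mulr_gt0 ?exprn_gt0 //.
    rewrite exprS ler_pM2l //; apply: le_trans qM _.
    by rewrite -[leLHS]expr1 ler_eXn2l //; lra.
have two : 2 / M <= 2 by rewrite ler_pdivrMr //; lra.
split=> //.
- case: (ltngtP p P) => pP; last by apply: le_trans (eq_case pP) _; lra.
    have [p0|p1] := posnP p.
      apply: red; rewrite p0 in hf.
      apply: (@le_trans _ _ C).
        by apply: (Kw0_block hf hb (ltW C0)) => k _; apply: hC hf.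
      rewrite ler_peMr ?(ltW C0) // mulrAC ler_pdivlMr // mul1r.
      have : M <= M ^+ 6 by rewrite -[leLHS]expr1 ler_eXn2l //; lra.
      lra.
    apply: le_trans (low_case p1 pP) _; rewrite ler_pdivrMr ?ltr0n ?(param_m_gt0 hparam) //.
    have : 2 <= (m p)%:R :> R by rewrite ler_nat (param_m_ge2 hparam).
    lra.
  exact: le_trans (high_case pP) two.
- move=> p1 pP; move: pP; rewrite neq_ltn => /orP[pP|Pp].
    by rewrite (minn_idPl (ltnW pP)); apply: low_case.
  by rewrite (minn_idPr (ltnW Pp)); apply: high_case.
Qed.

End Estimates.

(** * Dependent sequences *)

Section Dependent.
Context {R : realType}.
Variables (m n s : nat -> nat) (sigma : vecs R -> nat).
Hypothesis hparam : parameters m n s.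
Hypothesis hsigma : coding m sigma.
Implicit Types (f g h : nat -> R) (phi psi : vecs R).

Local Notation Kl := (Klevel m n sigma).
Local Notation Kw := (Kw m n sigma).
Local Notation nrm := (nrm m n sigma).
Local Notation exact_vec := (exact_vec m n sigma).
Local Coercion c00_val : c00 >-> Funclass.
Local Arguments c00_val : simpl never.

Lemma sum_atmost1 (P : nat -> bool) N :
  (forall i j, (i < N)%N -> (j < N)%N -> P i -> P j -> i = j) ->
  \sum_(i < N) (P i)%:R <= 1 :> R.
Proof.
move=> h; have [[i iN Pi]|none] := pselect (exists2 i, (i < N)%N & P i).
  rewrite (bigD1 (Ordinal iN)) //= Pi big1 ?addr0 // => j ji.
  case: (boolP (P j)) => // Pj; move: ji.
  by rewrite -val_eqE /= (h j i (ltn_ord j) iN Pj Pi) eqxx.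
rewrite big1 ?ler01 // => j _; case: (boolP (P j)) => // Pj.
by case: none; exists j.
Qed.

Section OneSequence.
(** The entries [z l] are the exact vectors [m_(W l) x_l] of a special sequence,
    numbered from 0, so that the functionals [f_(2 i - 1)] act on the entries
    with even index.  In the alternating sum of the [y l], consecutive entries
    cancel on functionals of weight [m_J].  With [a = 0] only every other entry
    remains; then the cancellation is replaced by the assumption that the even
    functionals do not see their own entries. *)
Variables (J k : nat) (phi : vecs R) (W : nat -> nat).
Hypotheses (J3 : (3 <= J)%N) (oJ : odd J) (nJ : n J = (2 * k)%N).
Hypotheses (k0 : (0 < k)%N) (hphi : special m n sigma k phi).
Hypothesis hW : special_weight m n sigma k phi W.
Variables (z : nat -> c00 R) (r : nat -> nat) (a : R).
Hypothesis hz : block_seq z r.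
Hypothesis zE : forall l, (l < 2 * k)%N ->
  forall t, z l t = (m (W l.+1))%:R * xs phi l.+1 t.
Hypothesis zexact : forall l, (l < 2 * k)%N -> exact_vec (W l.+1) (z l).
Hypothesis zodd : forall i, (i < k)%N -> ev (fs phi (2 * i).+1) (z (2 * i)%N) = 1.
Hypothesis ha : a = 1 \/ a = 0.
Hypothesis zeven : a = 1 \/ forall i h, (i < k)%N ->
  supp h = supp (fs phi (2 * i).+2) -> ev h (z (2 * i).+1) = 0.

Let y l := (if odd l then -1 else a) *: z l.

Let y_abs f l : `|ev f (y l)| <= `|ev f (z l)|.
Proof.
rewrite evZ normrM -[leRHS]mul1r ler_wpM2r //.
by case: (odd l); [rewrite normrN1|case: ha => ->; rewrite ?normr1 ?normr0].
Qed.

Let block_y : block_seq y r.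
Proof. by case: hz => h1 h2; split=> // l; apply: withinZ. Qed.

Let W_gt l : (l < 2 * k)%N -> ((2 * k) ^ 2 < m (W l.+1))%N.
Proof. by case: hW => _ h _ _ lk; apply: h; nlia. Qed.

Let W_ge2 l : (l < 2 * k)%N -> (2 <= W l.+1)%N.
Proof. by case: hW => h _ _ _ lk; have [] := h l.+1; nlia. Qed.

Let JW l : (l < 2 * k)%N -> (J < W l.+1)%N.
Proof.
move=> lk; apply: (param_m_inj_lt hparam); [nlia|by have := W_ge2 lk; nlia|].
apply: leq_ltn_trans (W_gt lk); rewrite -nJ.
apply: leq_trans (leq_pexp _ _) => //.
apply: leq_trans (param_m_le_n hparam (j := J) _); last by nlia.
exact: leq_pexp.
Qed.

Let Qphi : Qs phi. Proof. by case: hphi => -[]. Qed.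
Let sphi : size phi = (2 * k)%N. Proof. by case: hphi => -[]. Qed.

Let WE l : (0 < l < 2 * k)%N -> W l.+1 = Defs.code sigma phi l.
Proof. by case: hW => _ _ h _ lk; rewrite h //; nlia. Qed.

Let W_inj l l' : (0 < l < 2 * k)%N -> (0 < l' < 2 * k)%N ->
  W l.+1 = W l'.+1 -> l = l'.
Proof.
move=> h1 h2; rewrite !WE // => e.
by have [] := code_inj hsigma Qphi Qphi _ _ e; rewrite ?sphi; try nlia.
Qed.

(** Small enough to be summed over all pairs of entries. *)
Let e : R := 2 / (2 * k)%:R ^+ 2.

Let N0 : 0 < (2 * k)%:R :> R. Proof. by rewrite ltr0n; nlia. Qed.

Let e0 : 0 <= e. Proof. by rewrite divr_ge0 // exprn_ge0. Qed.

(** The weights of a special sequence exceed the square of its length. *)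
Let off_weight N f q l : (l < 2 * k)%N -> (2 <= q)%N -> ((2 * k) ^ 2 < m q)%N ->
  Kw N q f -> `|ev f (y l)| <= e + 2 * (q == W l.+1)%:R.
Proof.
move=> lk q2 mq hf; apply: le_trans (y_abs _ _) _.
have [h2 _ hne] := zexact lk hf.
have [_|qW] := eqVneq q (W l.+1); first by rewrite mulr1; move: h2 e0; lra.
rewrite mulr0 addr0; apply: le_trans (hne _ qW) _; first by nlia.
rewrite ler_pM2l // lef_pV2 ?posrE ?exprn_gt0 //; last first.
  by rewrite ltr0n (param_m_gt0 hparam) // leq_min; have := W_ge2 lk; nlia.
by rewrite -natrX ler_nat; case: (leqP q (W l.+1)) => _; apply: ltnW => //; apply: W_gt.
Qed.

Section OtherSequence.
Variables (psi : vecs R) (W' : nat -> nat) (N : nat) (E : set nat).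
Variables (F : nat -> nat -> R) (lam : nat -> R).
Hypothesis hpsi : special m n sigma k psi.
Hypothesis hW' : special_weight m n sigma k psi W'.
Hypothesis hE : nat_interval E.
Hypothesis hchild : forall j, (j < 2 * k)%N ->
  Kw N (W' j.+1) (odd_child psi F lam j).
Hypothesis hF : forall i, (i < k)%N ->
  [/\ supp (F i) = supp (fs psi (2 * i).+2), `|lam i| <= 1,
      dual_pair (F i) (xs psi (2 * i).+2) != 0 ->
        lam i = (m (W' (2 * i).+2))%:R * dual_pair (F i) (xs psi (2 * i).+2) &
      dual_pair (F i) (xs psi (2 * i).+2) = 0 ->
        `|lam i| = ((2 * k)%:R ^+ 2)^-1].

Let h j := fun t => 1 * restr E (odd_child psi F lam j) t.

Let hK j : (j < 2 * k)%N -> Kw N (W' j.+1) (h j).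
Proof. by move=> jk; apply: Kw_restr => //; rewrite ?normr1 //; apply: hchild. Qed.

Let W'_ge2 l : (l < 2 * k)%N -> (2 <= W' l.+1)%N.
Proof. by case: hW' => hh _ _ _ lk; have [] := hh l.+1; nlia. Qed.

Let W'_gt l : (l < 2 * k)%N -> ((2 * k) ^ 2 < m (W' l.+1))%N.
Proof. by case: hW' => _ hh _ _ lk; apply: hh; nlia. Qed.

Let Qpsi : Qs psi. Proof. by case: hpsi => -[]. Qed.
Let spsi : size psi = (2 * k)%N. Proof. by case: hpsi => -[]. Qed.

Let WE' l : (0 < l < 2 * k)%N -> W' l.+1 = Defs.code sigma psi l.
Proof. by case: hW' => _ _ hh _ lk; rewrite hh //; nlia. Qed.

Let T_le j l : (j < 2 * k)%N -> (l < 2 * k)%N ->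
  `|ev (h j) (y l)| <= e + 2 * (W' j.+1 == W l.+1)%:R.
Proof.
by move=> jk lk; apply: off_weight (hK jk) => //; [apply: W'_ge2|apply: W'_gt].
Qed.

Let same_code j l : (0 < j < 2 * k)%N -> (0 < l < 2 * k)%N ->
  W' j.+1 = W l.+1 -> j = l /\ take j psi = take j phi.
Proof.
move=> jk lk; rewrite WE // WE' // => ee.
by apply: (code_inj hsigma Qpsi Qphi _ _ ee); rewrite ?spsi ?sphi; nlia.
Qed.

(** A successor of weight equal to that of an entry at another position occurs
    at most twice: codes of different length differ, so one of the two
    positions is the first one, whose weight is not a code, and by injectivity
    at most one position matches it. *)
Let off_diagonal :
  \sum_(j < 2 * k) \sum_(l < 2 * k | l != j :> nat) `|ev (h j) (y l)| <= 6.
Proof.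
pose c1 l := (l != 0%N) && (W' 1%N == W l.+1).
pose c2 j := (j != 0%N) && (W' j.+1 == W 1%N).
apply: (@le_trans _ _ (\sum_(j < 2 * k) \sum_(l < 2 * k)
   (e + (2 * (j == 0%N :> nat)%:R * (c1 l)%:R + 2 * (l == 0%N :> nat)%:R * (c2 j)%:R)))).
  apply: ler_sum => j _; rewrite big_mkcond; apply: ler_sum => l _.
  have p1 : 0 <= 2 * (j == 0%N :> nat)%:R * (c1 l)%:R :> R by rewrite !mulr_ge0.
  have p2 : 0 <= 2 * (l == 0%N :> nat)%:R * (c2 j)%:R :> R by rewrite !mulr_ge0.
  case: ifP => [lj|_]; last by move: e0 p1 p2; lra.
  apply: le_trans (T_le (ltn_ord j) (ltn_ord l)) _; rewrite lerD2l.
  case: (W' j.+1 =P W l.+1) => ee; last by rewrite mulr0 addr_ge0.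
  have [j0|j0] := eqVneq (j : nat) 0%N.
    have -> : c1 l by rewrite j0 in lj ee; rewrite /c1 lj ee eqxx.
    by rewrite !mulr1 lerDl.
  have [l0|l0] := eqVneq (l : nat) 0%N.
    have -> : c2 j by rewrite l0 in ee; rewrite /c2 j0 ee eqxx.
    by rewrite !mulr1 lerDr.
  have jk := ltn_ord j; have lk := ltn_ord l.
  have [jl _] := same_code (j := j) (l := l) ltac:(nlia) ltac:(nlia) ee.
  by rewrite jl eqxx in lj.
have c1s : \sum_(l < 2 * k) (c1 l)%:R <= 1 :> R.
  apply: sum_atmost1 => i j ik jk /andP[i0 /eqP ee] /andP[j0 /eqP ee'].
  by apply: W_inj; [nlia|nlia|rewrite -ee -ee'].
have c2s : \sum_(l < 2 * k) (c2 l)%:R <= 1 :> R.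
  apply: sum_atmost1 => i j ik jk /andP[i0 /eqP ee] /andP[j0 /eqP ee'].
  have : W' i.+1 = W' j.+1 by rewrite ee ee'.
  rewrite !WE'; [|nlia|nlia] => e3.
  by have [] := code_inj hsigma Qpsi Qpsi _ _ e3; rewrite ?spsi; try nlia.
have d0 : \sum_(l < 2 * k) ((l : nat) == 0%N)%:R <= 1 :> R.
  by apply: (@sum_atmost1 (fun l => l == 0%N)) => i j _ _ /eqP -> /eqP ->.
have nn (P : nat -> bool) : 0 <= \sum_(l < 2 * k) (P l)%:R :> R by apply: sumr_ge0.
set A1 : R := \sum_(l < 2 * k) (c1 l)%:R; set A2 : R := \sum_(l < 2 * k) (c2 l)%:R.
set A0 : R := \sum_(l < 2 * k) ((l : nat) == 0%N)%:R.
have -> : \sum_(j < 2 * k) \sum_(l < 2 * k)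
   (e + (2 * (j == 0%N :> nat)%:R * (c1 l)%:R + 2 * (l == 0%N :> nat)%:R * (c2 j)%:R))
   = e * (2 * k)%:R ^+ 2 + (2 * A0 * A1 + 2 * A0 * A2).
  under eq_bigr do rewrite big_split /= sumr_const card_ord big_split /=
    -big_distrr -big_distrl -big_distrr /= -/A1 -/A0.
  rewrite big_split /= sumr_const card_ord big_split /= -!big_distrl -!big_distrr /=.
  rewrite -/A0 -/A2 -[e *+ _ *+ _]mulr_natr -[e *+ _]mulr_natr; ring.
have -> : e * (2 * k)%:R ^+ 2 = 2 by rewrite /e mulfVK // expf_neq0 // gt_eqF.
have n0 : 0 <= A0 by exact: (nn (fun l => l == 0%N)).
have b1 : A0 * A1 <= 1 by apply: mulr_ile1 => //; apply: nn.
have b2 : A0 * A2 <= 1 by apply: mulr_ile1 => //; apply: nn.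
by lra.
Qed.

(** The interval [E] cuts the region of a pair of consecutive entries at most
    twice, once at each of its ends, and there is at most one pair at which
    [psi] branches off from [phi]. All other pairs lie outside [E], on the
    common part, or on the branched part. *)
Let region i : set nat := [set t | (r (2 * i)%N <= t < r (2 * i).+2)%N].
Let left_cut i := `[< exists t t', [/\ region i t, region i t', E t, ~ E t' & (t' < t)%N] >].
Let right_cut i := `[< exists t t', [/\ region i t, region i t', E t, ~ E t' & (t < t')%N] >].
Let prefix i := take (2 * i) psi = take (2 * i) phi.
Let branch i := `[< prefix i /\ ~ prefix i.+1 >].

Let region_lt i j t t' : (i < j)%N -> region i t -> region j t' -> (t < t')%N.
Proof.
move=> ij /andP[_ h1] /andP[h2 _]; apply: leq_trans h1 (leq_trans _ h2).
by case: hz => hr _; apply: hr; nlia.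
Qed.

Let prefix_le i j : (i <= j)%N -> prefix j -> prefix i.
Proof.
move=> ij pj; rewrite /prefix.
have ij2 : (2 * i <= 2 * j)%N by nlia.
by rewrite -(take_takel psi ij2) pj take_takel.
Qed.

Let left_cut1 i j : left_cut i -> left_cut j -> i = j.
Proof.
have aux i' j' : (i' < j')%N -> left_cut i' -> left_cut j' -> False.
  move=> ij /asboolP[t [t1 [rt rt1 Et nEt1 lt]]] /asboolP[u [u1 [ru ru1 Eu nEu1 ltu]]].
  apply: nEu1; apply: (hE Et Eu).
  by rewrite (ltnW ltu) andbT ltnW //; apply: region_lt ij rt ru1.
move=> hi hj; case: (ltngtP i j) => // ij; first by case: (aux _ _ ij hi hj).
by case: (aux _ _ ij hj hi).
Qed.

Let right_cut1 i j : right_cut i -> right_cut j -> i = j.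
Proof.
have aux i' j' : (i' < j')%N -> right_cut i' -> right_cut j' -> False.
  move=> ij /asboolP[t [t1 [rt rt1 Et nEt1 lt]]] /asboolP[u [u1 [ru ru1 Eu nEu1 ltu]]].
  apply: nEt1; apply: (hE Et Eu).
  by rewrite (ltnW lt) ltnW //; apply: region_lt ij rt1 ru.
move=> hi hj; case: (ltngtP i j) => // ij; first by case: (aux _ _ ij hi hj).
by case: (aux _ _ ij hj hi).
Qed.

Let branch1 i j : branch i -> branch j -> i = j.
Proof.
have aux i' j' : (i' < j')%N -> branch i' -> branch j' -> False.
  by move=> ij /asboolP[_ np] /asboolP[pj _]; apply: np; apply: prefix_le pj.
move=> hi hj; case: (ltngtP i j) => // ij; first by case: (aux _ _ ij hi hj).
by case: (aux _ _ ij hj hi).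
Qed.

Let D i := ev (h (2 * i)%N) (y (2 * i)%N) + ev (h (2 * i).+1) (y (2 * i).+1).

Let h_outside i j : (i < k)%N -> (j = 2 * i \/ j = (2 * i).+1)%N ->
  (forall t, region i t -> ~ E t) -> ev (h j) (y j) = 0.
Proof.
move=> ik hj out; apply: ev_disj => t; rewrite /h restrE.
case: ifPn => [|_]; last by left; rewrite mulr0.
rewrite inE => Et; right; apply: contrapT => yt; apply: (out t) => //.
have [hr hy] := block_y.
have /hy /andP[y1 y2] : y j t != 0 by apply/eqP.
rewrite /region /=; case: hj y1 y2 => -> y1 y2.
  by rewrite y1 /=; apply: leq_trans y2 _; apply: hr; nlia.
by rewrite y2 andbT; apply: leq_trans y1; apply: hr; nlia.
Qed.

Let h_inside i j : (i < k)%N -> (j = 2 * i \/ j = (2 * i).+1)%N ->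
  (forall t, region i t -> E t) -> ev (h j) (y j) = ev (odd_child psi F lam j) (y j).
Proof.
move=> ik hj ins; apply: eq_ev => t; rewrite /h restrE.
have [yt|yt] := eqVneq (y j t) 0; first by rewrite yt !mulr0.
have [hr hy] := block_y.
have /andP[y1 y2] := hy _ _ yt.
suff -> : t \in E by rewrite mul1r.
rewrite inE; apply: ins; rewrite /region /=; case: hj y1 y2 => -> y1 y2.
  by rewrite y1 /=; apply: leq_trans y2 _; apply: hr; nlia.
by rewrite y2 andbT; apply: leq_trans y1; apply: hr; nlia.
Qed.

(** On the common part the coefficient [lam i] is the value of the even
    functional at the even entry, and the two contributions cancel. If this
    value is 0, then [lam i] is negligible by its definition. With [a = 0] the
    value is always 0, since the functional has the same support as that of
    [phi], which does not see the entry. *)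
Let D_good i : (i < k)%N -> prefix i.+1 -> (forall t, region i t -> E t) ->
  `|D i| <= e.
Proof.
move=> ik pi1 ins; rewrite /D (h_inside ik (or_introl erefl) ins).
rewrite (h_inside ik (or_intror erefl) ins).
have e2 : (2 * i.+1 = (2 * i).+2)%N by nlia.
rewrite /prefix e2 in pi1.
have xfE j : (0 < j <= (2 * i).+2)%N -> xs psi j = xs phi j /\ fs psi j = fs phi j.
  by move=> hj; rewrite -(xs_take psi hj) -(fs_take psi hj) pi1 xs_take // fs_take.
have [_ f1] := xfE (2 * i).+1 ltac:(nlia).
have [x2 f2] := xfE (2 * i).+2 ltac:(nlia).
have W2 : W' (2 * i).+2 = W (2 * i).+2.
  rewrite WE' ?WE; [|nlia|nlia].
  rewrite /Defs.code; congr (sigma _).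
  have lt : ((2 * i).+1 <= (2 * i).+2)%N by [].
  by rewrite -(take_takel psi lt) pi1 take_takel.
have [sF lam1 lamn lam0] := hF ik.
have i2 : ((2 * i)./2 = i)%N by rewrite mul2n doubleK.
have i3 : (uphalf (2 * i) = i)%N by rewrite mul2n uphalf_double.
have o2 : odd (2 * i) = false by rewrite oddM.
have c1 : ev (odd_child psi F lam (2 * i)) (y (2 * i)%N) = a * lam i.
  rewrite /odd_child /y o2 i2 evZ evZl f1 zodd // mulr1 //.
have c2 : ev (odd_child psi F lam (2 * i).+1) (y (2 * i).+1) =
    - ((m (W' (2 * i).+2))%:R * dual_pair (F i) (xs psi (2 * i).+2)).
  have -> : odd_child psi F lam (2 * i).+1 = F i by rewrite /odd_child /= o2 /= i3.
  rewrite /y /= o2 /= evZ mulN1r; congr (- _).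
  have [[xfin _ _ _] _] := special_size hphi (i := (2 * i).+2) ltac:(nlia).
  rewrite -dual_pairZr x2 // W2; congr dual_pair; apply/funext => t.
  by rewrite zE //; nlia.
rewrite c1 c2.
have [d0|d0] := eqVneq (dual_pair (F i) (xs psi (2 * i).+2)) 0.
  rewrite d0 mulr0 subr0 normrM lam0 //.
  have i0 : 0 <= ((2 * k)%:R ^+ 2)^-1 :> R by rewrite invr_ge0 exprn_ge0.
  by case: ha => ->; rewrite ?normr1 ?normr0 /e; move: i0; lra.
have a1 : a = 1.
  case: zeven => // zz; move: c2; rewrite /y /= o2 /= evZ.
  have -> : odd_child psi F lam (2 * i).+1 = F i by rewrite /odd_child /= o2 /= i3.
  rewrite zz //; last by rewrite sF f2.
  rewrite mulr0 => /esym/eqP; rewrite oppr_eq0 mulf_eq0 (negbTE d0) orbF.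
  have := W'_ge2 (l := (2 * i).+1) ltac:(nlia) => w2.
  by rewrite pnatr_eq0 gtn_eqF // (param_m_gt0 hparam) //; nlia.
by rewrite a1 mul1r lamn // subrr normr0.
Qed.

Let D_le4 i : (i < k)%N -> `|D i| <= 2 * e + 4.
Proof.
move=> ik; apply: le_trans (ler_normD _ _) _.
have b (P : bool) : P%:R <= 1 :> R by case: P.
have b1 := b (W' (2 * i).+1 == W (2 * i).+1).
have b2 := b (W' (2 * i).+2 == W (2 * i).+2).
have t1 := T_le (j := (2 * i)%N) (l := (2 * i)%N) ltac:(nlia) ltac:(nlia).
have t2 := T_le (j := (2 * i).+1) (l := (2 * i).+1) ltac:(nlia) ltac:(nlia).
by lra.
Qed.

(** After the branching all codes differ from those of [phi]. *)
Let D_off i : (i < k)%N -> ~ prefix i -> `|D i| <= 2 * e.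
Proof.
move=> ik np; apply: le_trans (ler_normD _ _) _.
have t1 := T_le (j := (2 * i)%N) (l := (2 * i)%N) ltac:(nlia) ltac:(nlia).
have t2 := T_le (j := (2 * i).+1) (l := (2 * i).+1) ltac:(nlia) ltac:(nlia).
have i0 : (0 < i)%N by case: (posnP i) => // i0; case: np; rewrite i0 /prefix !take0.
move: t1 t2; case: eqP => [ee|_].
  by have [_] := same_code (j := (2 * i)%N) (l := (2 * i)%N) ltac:(nlia) ltac:(nlia) ee.
case: eqP => [ee|_]; last by rewrite !mulr0; lra.
have [_ ee'] := same_code (j := (2 * i).+1) (l := (2 * i).+1) ltac:(nlia) ltac:(nlia) ee.
case: np; rewrite /prefix.
have lt : (2 * i <= (2 * i).+1)%N by [].
by rewrite -(take_takel psi lt) ee' take_takel.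
Qed.

Let D_le i : (i < k)%N ->
  `|D i| <= 2 * e + 4 * ((left_cut i)%:R + (right_cut i)%:R + (branch i)%:R).
Proof.
move=> ik; have four := D_le4 ik.
have bb (P : bool) : 0 <= P%:R :> R by [].
have l0 := bb (left_cut i); have r0 := bb (right_cut i); have b0 := bb (branch i).
have [pi|npi] := pselect (prefix i); last first.
  by have := D_off ik npi; lra.
have [pi1|npi1] := pselect (prefix i.+1); last first.
  rewrite (_ : branch i = true) ?mulr1n; last by apply/asboolP.
  by move: l0 r0; lra.
have [ins|nins] := pselect (forall t, region i t -> E t).
  by have := D_good ik pi1 ins; move: e0; lra.
have [out|nout] := pselect (forall t, region i t -> ~ E t).
  rewrite /D (h_outside ik (or_introl erefl) out) (h_outside ik (or_intror erefl) out).
  by rewrite addr0 normr0; move: e0; lra.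
have [t' [rt' nEt']] : exists t, region i t /\ ~ E t.
  by apply: contrapT => hn; apply: nins => t rt; apply: contrapT => nE; apply: hn; exists t.
have [t [rt Et]] : exists t, region i t /\ E t.
  by apply: contrapT => hn; apply: nout => t rt Et; apply: hn; exists t.
case: (ltngtP t t') => tt.
- rewrite (_ : right_cut i = true) ?mulr1n; last by apply/asboolP; exists t, t'.
  by move: l0 b0; lra.
- rewrite (_ : left_cut i = true) ?mulr1n; last by apply/asboolP; exists t, t'.
  by move: r0 b0; lra.
- by case: nEt'; rewrite -tt.
Qed.

(** All pairs contribute at most [2 e], except the two pairs that are cut and
    the branching one, which contribute at most 4 more each. *)
Lemma dependent_functional :
  `|\sum_(j < 2 * k) ev (h j) (\sum_(0 <= l < 2 * k) y l)| <= 20.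
Proof.
have -> : \sum_(j < 2 * k) ev (h j) (\sum_(0 <= l < 2 * k) y l) =
    \sum_(i < k) D i + \sum_(j < 2 * k) \sum_(l < 2 * k | l != j :> nat) ev (h j) (y l).
  rewrite -(sum_pairs k (fun j => ev (h j) (y j))) -big_split /=.
  apply: eq_bigr => j _; rewrite big_mkord ev_sum (bigD1 j) //=.
apply: le_trans (ler_normD _ _) _.
have -> : 20 = 14 + 6 :> R by ring.
apply: lerD; last first.
  apply: le_trans off_diagonal; apply: le_trans (ler_norm_sum _ _ _) _.
  by apply: ler_sum => j _; apply: ler_norm_sum.
apply: le_trans (ler_norm_sum _ _ _) _.
apply: (@le_trans _ _ (\sum_(i < k) (2 * e + 4 * ((left_cut i)%:R + (right_cut i)%:R + (branch i)%:R)))).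
  by apply: ler_sum => i _; apply: D_le.
rewrite big_split /= sumr_const card_ord -big_distrr /= !big_split /=.
have s1 : \sum_(i < k) (left_cut i)%:R <= 1 :> R.
  by apply: sum_atmost1 => i j _ _; apply: left_cut1.
have s2 : \sum_(i < k) (right_cut i)%:R <= 1 :> R.
  by apply: sum_atmost1 => i j _ _; apply: right_cut1.
have s3 : \sum_(i < k) (branch i)%:R <= 1 :> R.
  by apply: sum_atmost1 => i j _ _; apply: branch1.
have s4 : 2 * e *+ k <= 2.
  rewrite -mulr_natr /e natrM.
  have k1 : 1 <= k%:R :> R by rewrite ler1n.
  have -> : 2 * (2 / (2 * k%:R) ^+ 2) * k%:R = k%:R^-1 :> R by field; lra.
  have : k%:R^-1 <= 1 :> R by rewrite invf_le1; lra.
  by lra.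
by move: s1 s2 s3 s4; lra.
Qed.

End OtherSequence.

(** This reduces intervals of entries to the whole sequence. *)
Let block_sum_restr (N : nat) g a' b' : (b' <= 2 * k)%N ->
  ev g (\sum_(a' <= l < b') y l) =
  ev (fun t => 1 * restr [set t | (r a' <= t < r b')%N] g t) (\sum_(0 <= l < 2 * k) y l).
Proof.
move=> bk; have [hr hy] := block_y; rewrite evZl mul1r ev_restr.
congr (ev g _); apply: c00_eqP => t; rewrite cutE in_itv_set.
have [ab|ba] := leqP a' b'; last first.
  rewrite big_geq; last exact: ltnW.
  by rewrite c000 ifF //; have := hr _ _ (ltnW ba); nlia.
rewrite (@big_cat_nat _ _ _ a' 0 (2 * k)) //=; last by nlia.
rewrite (@big_cat_nat _ _ _ b' a' (2 * k)) //= !c00D.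
have p1 := @within_block_sum _ y r hr hy 0%N a'.
have p2 := @within_block_sum _ y r hr hy a' b'.
have p3 := @within_block_sum _ y r hr hy b' (2 * k)%N.
case: ifPn => ht.
  rewrite (within_out p1) ?add0r; last by nlia.
  by rewrite (within_out p3) ?addr0 //; nlia.
by rewrite (within_out p2).
Qed.

Lemma Kw_dependent N g a' b' : Kw N J g -> (b' <= 2 * k)%N ->
  `|ev g (\sum_(a' <= l < b') y l)| <= 20.
Proof.
move=> hg bk; rewrite (block_sum_restr N) //.
have le1 : `|1 : R| <= 1 by rewrite normr1.
have := Kw_restr le1 (@nat_interval_itv (r a') (r b')) hg.
move: (fun t => 1 * restr _ g t) => g' [al [E [g0 [al1 hE hg0 gE]]]].
have J1 : (0 < J)%N by nlia.
have [N' NN] := Klevel_cases J1 hg0; rewrite oJ /=.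
move=> /(odd_dataP hparam hsigma)[k' [psi [W' [E' [al' [F [lam hform]]]]]]].
have hch := odd_form_child hparam hform.
have [[k0' nk' sp] hW' hE' hal' [hF g0E]] := hform.
have kk : k' = k by move: nk'; rewrite nJ; nlia.
rewrite {}kk in hch k0' nk' sp hW' hF g0E hform.
have hF' i : (i < k)%N ->
  [/\ supp (F i) = supp (fs psi (2 * i).+2), `|lam i| <= 1,
      dual_pair (F i) (xs psi (2 * i).+2) != 0 ->
        lam i = (m (W' (2 * i).+2))%:R * dual_pair (F i) (xs psi (2 * i).+2) &
      dual_pair (F i) (xs psi (2 * i).+2) = 0 ->
        `|lam i| = ((2 * k)%:R ^+ 2)^-1].
  by move=> /hF[_ h1 h2 h3 h4]; split=> //; rewrite -nJ.
have key := dependent_functional sp hW' (nat_intervalI hE hE') hch hF'.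
set Z := \sum_(0 <= l < 2 * k) y l in key *.
have -> : ev g' Z = al * al' * \sum_(j < 2 * k)
    ev (fun t => 1 * restr (E `&` E') (odd_child psi F lam j) t) Z.
  rewrite -ev_suml -evZl; congr dual_pair; apply/funext => t.
  rewrite gE restrE g0E odd_childD.
  under [in RHS]eq_bigr do rewrite mul1r restrE in_setI.
  case: (t \in E); case: (t \in E') => //=; rewrite ?mulr0 ?mulrA //.
  - by rewrite big1 ?mulr0.
  - by rewrite big1 ?mulr0.
  - by rewrite big1 ?mulr0.
rewrite normrM -[leRHS]mul1r ler_pM //.
rewrite normrM mulr_ile1 // hal' invf_le1 ?ler1n ?ltr0n (param_m_gt0 hparam) //.
Qed.

(** Functionals of weight [m_J] are bounded by a constant, and those of larger
    weight are small on all but at most two entries. The basic inequality then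
    applies with weights below [m_J] only, and gives a norm of the order of
    [n_J / m_J ^ 3], whereas [n_J / m_J] would be expected without the
    cancellation. *)
Lemma dependent_norm :
  nrm (\sum_(0 <= l < 2 * k) y l) <= 40 * (n J)%:R / (m J)%:R ^+ 3.
Proof.
have J2 : (2 <= J)%N by nlia.
have [psi [psi1 psi2 psiN]] := @concave_growth R m n s hparam J J2.
have [hr hy] := block_y.
set M : R := (m J)%:R.
have M2 : 2 <= M by rewrite ler_nat (param_m_ge2 hparam) //; nlia.
have M5 : 0 < M ^+ 5 by rewrite exprn_gt0; lra.
have M3 : 0 < M ^+ 3 by rewrite exprn_gt0; lra.
have low N p f l : (l < 2 * k)%N -> (1 <= p < J)%N -> Kw N p f ->
    `|ev f (y l)| <= 20 / (m p)%:R.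
  move=> lk hp hf; apply: le_trans (y_abs _ _) _.
  have [_ _ hne] := zexact lk hf; have JWl := JW lk.
  apply: le_trans (hne _ _) _; [by nlia|by rewrite neq_ltn; apply/orP; left; nlia|].
  have -> : minn p (W l.+1) = p by apply/minn_idPl; nlia.
  by rewrite ler_wpM2r ?invr_ge0 //; lra.
have high N p f a' b' : p = 0%N \/ (J <= p)%N -> (a' < b' <= 2 * k)%N ->
    Kw N p f -> `|ev f (\sum_(a' <= l < b') y l)| <= 20 * (1 + (b' - a')%:R * (M ^+ 5)^-1).
  move=> hp /andP[ab bk] hf.
  have t0 : 0 <= (b' - a')%:R * (M ^+ 5)^-1 by rewrite mulr_ge0 // invr_ge0 ltW.
  have [p0|Jp] := hp.
    rewrite p0 in hf; apply: (@le_trans _ _ 20); last by move: t0; lra.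
    apply: (Kw0_block hf block_y) => // l lab; apply: le_trans (y_abs _ _) _.
    have [h2 _ _] := zexact (l := l) ltac:(nlia) hf.
    by apply: le_trans h2 _; lra.
  move: Jp; rewrite leq_eqVlt => /predU1P[pJ|Jp].
    rewrite -pJ in hf; apply: le_trans (Kw_dependent a' hf bk) _; move: t0; lra.
  pose c l := (l != 0%N) && (l < 2 * k)%N && (p == W l.+1).
  have cs : \sum_(l < 2 * k) (c l)%:R <= 1 :> R.
    apply: sum_atmost1 => i j ik jk /andP[/andP[i0 _] /eqP ee] /andP[/andP[j0 _] /eqP ee'].
    by apply: W_inj; [nlia|nlia|rewrite -ee -ee'].
  have d0 : \sum_(l < 2 * k) ((l : nat) == 0%N)%:R <= 1 :> R.
    by apply: (@sum_atmost1 (fun l => l == 0%N)) => i j _ _ /eqP -> /eqP ->.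
  pose b l : R := (l == 0%N)%:R + (c l)%:R.
  have bs : \sum_(a' <= l < b') b l <= 2.
    apply: (@le_trans _ _ (\sum_(0 <= l < 2 * k) b l)).
      rewrite (@big_cat_nat _ _ _ a' 0 (2 * k)) //=; last by nlia.
      rewrite (@big_cat_nat _ _ _ b' a' (2 * k)) //=; last by nlia.
      have nn c1 c2 : 0 <= \sum_(c1 <= l < c2) b l by apply: sumr_ge0 => l _; rewrite addr_ge0.
      by have := nn 0%N a'; have := nn b' (2 * k)%N; lra.
    by rewrite big_mkord big_split /=; move: cs d0; lra.
  rewrite ev_sum; apply: le_trans (ler_norm_sum _ _ _) _.
  apply: (@le_trans _ _ (\sum_(a' <= l < b') (2 * (M ^+ 5)^-1 + 2 * b l))).
    rewrite big_nat [leRHS]big_nat; apply: ler_sum => l lab.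
    have lk : (l < 2 * k)%N by nlia.
    apply: le_trans (y_abs _ _) _; have [h2 _ hne] := zexact lk hf.
    have i0 : 0 <= (M ^+ 5)^-1 by rewrite invr_ge0 ltW.
    have [pW|pW] := eqVneq p (W l.+1).
      apply: le_trans h2 _; have : 1 <= b l.
        rewrite /b /c lk pW eqxx; case: eqP => _ /=; lra.
      move: i0; lra.
    apply: le_trans (hne _ pW) _; first by nlia.
    have b0 : 0 <= b l by rewrite addr_ge0.
    suff : ((m (minn p (W l.+1)))%:R)^-1 <= (M ^+ 5)^-1 by move: b0; lra.
    rewrite lef_pV2 ?posrE //; last first.
      by rewrite ltr0n (param_m_gt0 hparam) //; have := W_ge2 lk; nlia.
    rewrite -natrX ler_nat (param_m_lt hparam) //; first by nlia.
    by have := JW lk; nlia.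
  rewrite big_split /= sumr_const_nat -big_distrr /= -[X in X + _]mulr_natr.
  have -> : 2 * (M ^+ 5)^-1 * (b' - a')%:R = 2 * ((b' - a')%:R * (M ^+ 5)^-1) by ring.
  by move: t0 bs; lra.
have twok : (0 < 2 * k <= 2 * k)%N by nlia.
have i5 : 0 <= (M ^+ 5)^-1 by rewrite invr_ge0 ltW.
apply: (nrm_le hparam hsigma) => N p f /Kw_K hf.
apply: le_trans (basic_inequality_fin hparam hsigma J2 psi1 psi2 hr
   (fun l _ => hy l) _ i5 low high twok hf) _ => //.
rewrite subn0 -nJ.
have -> : 40 * (n J)%:R / M ^+ 3 = 20 * ((n J)%:R / M ^+ 3 + (n J)%:R / M ^+ 3) by ring.
rewrite ler_pM2l //; apply: lerD => //.
have h1 : (n J)%:R * (M ^+ 5)^-1 <= (n J)%:R / M ^+ 3.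
  rewrite ler_wpM2l // lef_pV2 ?posrE // ler_eXn2l //; lra.
apply: le_trans h1; rewrite ler_piMr ?mulr_ge0 //.
case: ifP => [/andP[q1 _]|]; last by rewrite invr1.
by rewrite invf_le1 ?ler1n ?ltr0n (param_m_gt0 hparam).
Qed.

End OneSequence.
End Dependent.

(** * Steps of the construction of special sequences *)

Section Steps.
Context {R : realType}.
Variables (m n s : nat -> nat) (sigma : vecs R -> nat).
Hypothesis hparam : parameters m n s.
Hypothesis hsigma : coding m sigma.
Implicit Types (f g h : nat -> R) (phi psi : vecs R).

Local Notation Kl := (Klevel m n sigma).
Local Notation Kw := (Kw m n sigma).
Local Notation nrm := (nrm m n sigma).
Local Notation exact_vec := (exact_vec m n sigma).
Local Notation ris := (ris m n sigma).
Local Coercion c00_val : c00 >-> Funclass.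
Local Arguments c00_val : simpl never.

Lemma recurrent_seq (Q : nat -> Prop) r0 :
  (forall r, exists2 i, (r <= i)%N & Q i) -> exists i : nat -> nat,
  [/\ (r0 <= i 0)%N, forall l, (i l < i l.+1)%N & forall l, Q (i l)].
Proof.
move=> h; have h' r : exists i, (r <= i)%N /\ Q i by have [i ri Qi] := h r; exists i.
have [g hg] := choice h'.
exists (fun l => iter l (fun t => g t.+1) (g r0)); split.
- exact: (hg r0).1.
- by move=> l; rewrite iterS; have [] := hg (iter l (fun t => g t.+1) (g r0)).+1.
- case=> [|l]; first exact: (hg r0).2.
  by rewrite iterS; have [] := hg (iter l (fun t => g t.+1) (g r0)).+1.
Qed.

Lemma increasing_lt (i : nat -> nat) : (forall l, (i l < i l.+1)%N) ->
  {homo i : a b / (a < b)%N}.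
Proof. by move=> h; apply: homo_ltn => //; apply: ltn_trans. Qed.

Lemma increasing_le (i : nat -> nat) : (forall l, (i l < i l.+1)%N) ->
  {homo i : a b / (a <= b)%N}.
Proof.
by move=> h; apply: homo_leq => // [x y z|l]; [apply: leq_trans|apply: ltnW].
Qed.

(** The coordinates of functionals of weight [m_p] are at most [1 / m_p]. *)
Lemma ris_basis P (i : nat -> nat) (sg : nat -> R) : (1 <= P)%N ->
  (forall l, (i l < i l.+1)%N) -> (forall l, `|sg l| <= 1) ->
  ris 1 P (fun l => sg l *: eb (i l)) i.
Proof.
move=> P1 hi hsg.
have evb f l : `|ev f (sg l *: eb (i l))| <= `|f (i l)|.
  by rewrite evZ ev_eb normrM -[leRHS]mul1r ler_wpM2r.
split.
  split; first exact: increasing_le.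
  move=> l; apply: withinZ; apply: within_sub (@within_eb R (i l)) _ _ => //.
split.
- by move=> N p f l hf; apply: le_trans (evb _ _) _; apply: (Kw_le1 hparam hsigma) hf.
- move=> N p f l hp hf; apply: le_trans (evb _ _) _; rewrite mul1r.
  have := Kw_bound hparam hsigma (i l) hf; rewrite ifF //; lia.
- move=> N p f a b Pp ab hf; rewrite mul1r ev_sum.
  apply: le_trans (ler_norm_sum _ _ _) _.
  have mP : 0 < (m P)%:R :> R by rewrite ltr0n (param_m_gt0 hparam).
  apply: (@le_trans _ _ (\sum_(a <= l < b) ((m P)%:R ^+ 5)^-1)).
    apply: ler_sum => l _; apply: le_trans (evb _ _) _.
    have := Kw_bound hparam hsigma (i l) hf; rewrite ifF; last by lia.
    move=> /le_trans; apply.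
    rewrite lef_pV2 ?posrE ?exprn_gt0 ?ltr0n ?(param_m_gt0 hparam) //; last by lia.
    by rewrite -natrX ler_nat (param_m_lt hparam).
  by rewrite sumr_const_nat -[leLHS]mulr_natl lerDr.
Qed.

Lemma ev_basis (u : c00 R) k : ev (Defs.basis R k) u = u k.
Proof.
by rewrite -(ev_eb u k); apply: eq_ev => t; rewrite ebE /Defs.basis mulrC.
Qed.

Lemma Klevel_basis k : Kl 0 0 (Defs.basis R k).
Proof. by exists k; left. Qed.

Lemma coord_le_nrm (u : c00 R) k : `|u k| <= nrm u.
Proof. by rewrite -ev_basis; apply: (Klevel_nrm hparam hsigma _ (Klevel_basis k)). Qed.

Lemma ris_coord C P (y : nat -> c00 R) r l t : ris C P y r -> `|y l t| <= C.
Proof.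
move=> [_ [hC _ _]]; rewrite -ev_basis.
exact: hC (Kw_K (Klevel_basis t)).
Qed.

Lemma Klevel_Qvec N p f : (0 < p)%N -> Kl N p f -> (exists k, f k != 0) -> Qvec f.
Proof.
move=> p0 hf [k fk]; split.
- by have [M /supp_bound_finite] := Klevel_fin hparam hsigma hf.
- by exists k.
- by move=> t; have [q] := Klevel_rat hparam hsigma t hf; exists q.
- by move=> t; apply: (Kw_le1 hparam hsigma) (Kw_K hf).
Qed.

Variables (X : completeNormedModType R) (iota : {linear c00 R -> X}).
Hypothesis hiota : forall u, `|iota u| = nrm u.
Variables (T : {linear X -> X}) (a : R).
Hypothesis ha : a = 1 \/ a = 0.

Let a0 : 0 <= a. Proof. by case: ha => ->. Qed.

(** An average of basis vectors at an odd position of a special sequence,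
    almost annihilated by [a T]; the normalization is that of the exact
    vectors. *)
Definition odd_entry P r e r' (x : c00 R) f :=
  [/\ [/\ within r r' x, within r r' f, Qvec x & Qvec f],
      exact_vec P ((m P)%:R *: x), averages m n P x f,
      ev f ((m P)%:R *: x) = 1 & a * `|T (iota ((m P)%:R *: x))| <= e].

(** The average is taken over basis vectors that are almost annihilated
    themselves. *)
Lemma odd_entry_exists P r e : (2 <= P)%N -> ~~ odd P -> 0 < e ->
  (forall r e, 0 < e -> exists2 i, (r <= i)%N & a * `|T (iota (eb i))| <= e) ->
  exists r' x f, (r <= r')%N /\ odd_entry P r e r' x f.
Proof.
move=> P2 oP e0 hodd.
have P1 : (1 <= P)%N by lia.
set M : R := (m P)%:R; set D : R := (n P)%:R.
have M2 : 2 <= M by rewrite ler_nat (param_m_ge2 hparam).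
have M0 : 0 < M by lra.
have n0 : (0 < n P)%N by apply: (param_n_gt0 hparam).
have D0 : 0 < D by rewrite ltr0n.
have [i [i0 hi hT]] := recurrent_seq r (fun r' => hodd r' (e / M) (divr_gt0 e0 M0)).
have ilt := increasing_lt hi; have ile := increasing_le hi.
pose y l : c00 R := 1 *: eb (i l).
have hris : ris 1 P y i by apply: ris_basis => // l; rewrite normr1.
pose x : c00 R := D^-1 *: \sum_(0 <= l < n P) y l.
pose f := M^-1 *: \sum_(l < n P) Defs.basis R (i l).
have hav : averages m n P x f.
  exists (fun l : 'I_(n P) => i l); split=> //.
    move=> l l' ll; apply/val_inj; case: (ltngtP l l') => //= lt.
      by have := ilt _ _ lt; rewrite ll ltnn.
    by have := ilt _ _ lt; rewrite ll ltnn.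
  apply/funext => t; rewrite /x c00Z fctE fct_sumE c00_sum big_mkord.
  by congr (_ * _); apply: eq_bigr => l _; rewrite /y c00Z mul1r.
have hf : Kl 1 P f by exact: (averages_K sigma hparam P1 oP hav).
have hx : exact_vec P (M *: x).
  have := ris_exact hparam hsigma P2 ltr01 hris.
  by rewrite mul1r scalerA.
have evfx : ev f (M *: x) = 1.
  have fE l : (l < n P)%N -> f (i l) = M^-1.
    move=> lP; rewrite /f fctE fct_sumE (bigD1 (Ordinal lP)) //= big1 => [|l' ll'].
      rewrite addr0 /Defs.basis eqxx; exact: mulr1.
    rewrite /Defs.basis; case: eqP => // ee; move: ll'; rewrite -val_eqE /=.
    by case: (ltngtP l l') => // /ilt; rewrite ee ltnn.
  rewrite !evZ ev_sum big_mkord (eq_bigr (fun=> M^-1)) => [|l _]; last first.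
    by rewrite /y evZ mul1r ev_eb fE.
  rewrite sumr_const card_ord -[_ *+ _]mulr_natl -/D.
  by field; rewrite !gt_eqF.
have wx : within r (i (n P)) x.
  apply: withinZ; apply: within_sub (@within_block_sum _ y i hris.1.1 hris.1.2 0%N (n P)) _ _ => //.
have wf : within r (i (n P)) f.
  move=> t ft; have : exists2 l, (l < n P)%N & t = i l.
    apply: contrapT => hn; move/eqP: ft; apply.
    rewrite /f fctE fct_sumE big1 ?scaler0 // => l _; rewrite /Defs.basis.
    by case: eqP => // tl; case: hn; exists l.
  move=> [l lP ->]; rewrite (leq_trans i0) ?ile //=; exact: ilt.
have xE t : x t = D^-1 * (\sum_(l < n P) (t == i l)%:R).
  rewrite /x c00Z c00_sum big_mkord; congr (_ * _); apply: eq_bigr => l _.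
  by rewrite /y c00Z mul1r ebE.
have [|t0 [ft0 Mxt0]] := @ev_neq0 R f (M *: x); first by rewrite evfx oner_neq0.
exists (i (n P)), x, f; split.
  by rewrite (leq_trans i0) // ile.
split=> //.
- split=> //.
  + split.
    * by have [B /supp_bound_finite] := c00_bound x.
    * by exists t0; apply: contra_neq Mxt0 => xt0; rewrite c00Z xt0 mulr0.
    * move=> t; suff [q ->] : israt (x t) by exists q.
      rewrite xE; apply: isratM; first exact/isratV/israt_nat.
      by apply: israt_sum => l _; apply: israt_nat.
    * move=> t; rewrite /x c00Z c00_sum normrM gtr0_norm ?invr_gt0 // ler_pdivrMl // mulr1.
      apply: le_trans (ler_norm_sum _ _ _) _.
      apply: (@le_trans _ _ (\sum_(0 <= l < n P) 1)).
        by apply: ler_sum => l _; apply: ris_coord hris.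
      by rewrite sumr_const_nat subn0.
  + by apply: (Klevel_Qvec P1 hf); exists t0.
- rewrite -/M /x scalerA !linearZ /= normrZ gtr0_norm ?divr_gt0 // mulrCA.
  rewrite mulrAC ler_pdivrMr // -ler_pdivlMl //.
  rewrite !linear_sum /=.
  apply: (@le_trans _ _ (a * \sum_(0 <= l < n P) `|T (iota (y l))|)).
    by rewrite ler_wpM2l // ler_norm_sum.
  rewrite big_distrr /=.
  apply: (@le_trans _ _ (\sum_(0 <= l < n P) e / M)).
    by apply: ler_sum => l _; rewrite /y scale1r; apply: hT.
  by rewrite sumr_const_nat subn0 -[leLHS]mulr_natr mulrCA mulrA mulrC.
Qed.

End Steps.

Section EvenEntry.
Context {R : realType}.
Variables (m n s : nat -> nat) (sigma : vecs R -> nat).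
Hypothesis hparam : parameters m n s.
Hypothesis hsigma : coding m sigma.
Implicit Types (f g h : nat -> R) (phi psi : vecs R).

Local Notation Kl := (Klevel m n sigma).
Local Notation Kw := (Kw m n sigma).
Local Notation nrm := (nrm m n sigma).
Local Notation exact_vec := (exact_vec m n sigma).
Local Notation ris := (ris m n sigma).
Local Coercion c00_val : c00 >-> Funclass.
Local Arguments c00_val : simpl never.

Variables (X : completeNormedModType R) (iota : {linear c00 R -> X}).
Variables (T : {linear X -> X}) (a : R).

(** The material for the entries at even positions: a rapidly increasing
    sequence together with functionals that are large on (approximations of)
    its image under the operator. The functionals may see the sequence itself
    only if [a = 1], when the entries at odd positions compensate for it. *)
Definition seed (C : nat) (c : R) P r e := exists (y : nat -> c00 R) rr
    (f : nat -> nat -> R) (v : nat -> c00 R),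
  [/\ (r <= rr 0)%N /\ ris C%:R P y rr,
      forall l, [/\ within (rr l) (rr l.+1) (f l), within (rr l) (rr l.+1) (v l) &
                 exists N q, Kl N q (f l)],
      forall l, c <= ev (f l) (v l) /\ `|T (iota (y l)) - iota (v l)| <= e,
      (forall l t, israt (y l t)) /\ exists t, y 0%N t != 0 &
      a = 1 \/ forall l t, f l t = 0 \/ y l t = 0].

(** [V] stands for the image of the entry under [T]; being supported in the
    same window, it is not seen by the functionals of the other entries. *)
Definition even_entry P r e c r' (x : c00 R) f (V : c00 R) N :=
  [/\ [/\ within r r' x, within r r' f, Qvec x & Qvec f],
      exact_vec P ((m P)%:R *: x), within r r' V /\ Kl N P f,
      c <= ev f V /\ `|T (iota ((m P)%:R *: x)) - iota V| <= e &
      a = 1 \/ forall t, f t = 0 \/ x t = 0].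

(** The entry is an average of the sequence, and its functional has the
    corresponding functionals as successors. The factor [m_P] in the
    normalization of exact vectors makes up for the weight of the
    functional. *)
Lemma even_entry_exists C c P r e : (0 < C)%N -> 0 < c ->
  (2 <= P)%N -> ~~ odd P -> 0 < e ->
  (forall r e, 0 < e -> seed C c P r e) ->
  exists r' x f V N, (r <= r')%N /\ even_entry P r e (c / C%:R) r' x f V N.
Proof.
move=> C0 c0 P2 oP e0 hseed.
have P1 : (1 <= P)%N by lia.
set M : R := (m P)%:R; set D : R := (n P)%:R; set K : R := C%:R.
have M2 : 2 <= M by rewrite ler_nat (param_m_ge2 hparam).
have M0 : 0 < M by lra.
have n0 : (0 < n P)%N by apply: (param_n_gt0 hparam).
have D0 : 0 < D by rewrite ltr0n.
have K0 : 0 < K by rewrite ltr0n.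
have [y [rr [f [v [[r0 hris] hw hv [yrat [t0 yt0]] hd]]]]] :=
  hseed r (e * K / M) (divr_gt0 (mulr_gt0 e0 K0) M0).
have [[hr hy] _] := hris.
pose x : c00 R := (K * D)^-1 *: \sum_(0 <= l < n P) y l.
pose F t := M^-1 * \sum_(l < n P) f l t.
pose V : c00 R := (M / (K * D)) *: \sum_(0 <= l < n P) v l.
have [|l lP|N hN] := @fin_bound (n P) (fun l N => exists q, Kl N q (f l)).
- by move=> i N N' NN [q hq]; exists q; apply: Klevel_mono hq.
- by have [_ _ [N hN]] := hw l; exists N.
have hwf i : (i < n P)%N -> within (rr i) (rr i.+1) (f i) by have [] := hw i.
have hwv : forall i, within (rr i) (rr i.+1) (v i) by move=> i; have [] := hw i.
have evFV : ev F V = (K * D)^-1 * \sum_(l < n P) ev (f l) (v l).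
  rewrite /F /V evZ evZl ev_suml.
  have -> : \sum_(l < n P) ev (f l) (\sum_(0 <= l0 < n P) v l0) =
     \sum_(l < n P) ev (f l) (v l).
    apply: eq_bigr => l _; rewrite big_mkord ev_sum (bigD1 l) //= big1 ?addr0 // => l' ll.
    apply: within_ev0 (hwf _ (ltn_ord l)) (hwv l') _.
    have : (l' : nat) != l by [].
    by rewrite neq_ltn => /orP[lt|lt]; [right|left]; apply: hr.
  by field; rewrite !gt_eqF.
have evFV_ge : c / K <= ev F V.
  rewrite evFV [leRHS]mulrC ler_pdivlMr ?mulr_gt0 //.
  have -> : c / K * (K * D) = \sum_(l < n P) c.
    by rewrite sumr_const card_ord -[RHS]mulr_natr; field; rewrite gt_eqF.
  by apply: ler_sum => l _; have [] := hv l.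
have Fnz : exists t, F t != 0.
  have [|t [Ft _]] := @ev_neq0 R F V; last by exists t.
  by rewrite gt_eqF // (lt_le_trans _ evFV_ge) // divr_gt0.
have Fex t : F t != 0 -> exists2 l, (l < n P)%N & f l t != 0.
  by rewrite mulf_eq0 negb_or => /andP[_ /(@sum_neq0 R _ (fun l => f l t))].
have hF : Kl N.+1 P F.
  apply: (even_build P1 oP (leqnn _) hr hwf); first by move=> i ip; right; apply: hN.
  by have [t /Fex[l lP nz]] := Fnz; exists l => //; exists t.
have wsum (u : nat -> c00 R) : (forall i, within (rr i) (rr i.+1) (u i)) ->
    within r (rr (n P)) (\sum_(0 <= l < n P) u l).
  by move=> hu; apply: within_sub (@within_block_sum _ u rr hr hu 0%N (n P)) _ _ => //.
have xM : M *: x = (M / (K * D)) *: \sum_(0 <= l < n P) y l by rewrite /x scalerA.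
exists (rr (n P)), x, F, V, N.+1; split.
  by rewrite (leq_trans r0) // hr.
split.
- split.
  + exact/withinZ/wsum.
  + move=> t /Fex[l lP ft].
    have /andP[h1 h2] := hwf _ lP _ ft.
    rewrite (leq_trans r0) ?(leq_trans _ h1) ?hr //=.
    by apply: leq_trans h2 _; apply: hr.
  + split.
    * by have [B /supp_bound_finite] := c00_bound x.
    * exists t0; rewrite /supp /= /x c00Z c00_sum big_mkord (bigD1 (Ordinal n0)) //=.
      rewrite big1 ?addr0 => [|l ll].
        by rewrite mulf_neq0 // invr_eq0 mulf_neq0 // gt_eqF.
      apply: (within_out (hy l)); apply/negP.
      have /andP[_ h1] := hy _ _ yt0.
      have l1 : (1 <= l)%N.
        by rewrite lt0n; apply: contra_neq ll => l0; apply/val_inj.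
      by have := hr _ _ l1; lia.
    * move=> t; suff [q ->] : israt (x t) by exists q.
      rewrite /x c00Z c00_sum; apply: isratM.
        by apply: isratV; apply: isratM; apply: israt_nat.
      by apply: israt_sum => l _; apply: yrat.
    * move=> t; rewrite /x c00Z c00_sum normrM gtr0_norm ?invr_gt0 ?mulr_gt0 //.
      rewrite ler_pdivrMl ?mulr_gt0 // mulr1.
      apply: le_trans (ler_norm_sum _ _ _) _.
      apply: (@le_trans _ _ (\sum_(0 <= l < n P) K)).
        by apply: ler_sum => l _; apply: ris_coord hris.
      by rewrite sumr_const_nat subn0 -[leLHS]mulr_natr.
  + exact: (Klevel_Qvec hparam hsigma P1 hF).
- rewrite xM; exact: (ris_exact hparam hsigma P2 K0 hris).
- by split=> //; apply/withinZ/wsum.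
- split=> //; rewrite xM /V !linearZ /= -scalerDr normrZ gtr0_norm ?divr_gt0 ?mulr_gt0 //.
  rewrite !(linear_sum iota) (linear_sum T) -sumrB mulrAC ler_pdivrMr ?mulr_gt0 // [leLHS]mulrC.
  rewrite -ler_pdivlMr //.
  apply: le_trans (ler_norm_sum _ _ _) _.
  apply: (@le_trans _ _ (\sum_(0 <= l < n P) e * K / M)).
    by apply: ler_sum => l _; have [] := hv l.
  rewrite sumr_const_nat subn0 -[leLHS]mulr_natr -/D le_eqVlt; apply/orP; left.
  by apply/eqP; ring.
- case: hd => [->|hd]; [by left|right => t].
  have [|nz] := eqVneq (F t) 0; first by left.
  right; rewrite /x c00Z c00_sum big_nat big1 ?mulr0 // => l /andP[_ lP].
  apply: contrapT => /eqP yt; move/eqP: nz; apply.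
  rewrite /F big1 ?mulr0 // => l' _.
  have [->|ll] := eqVneq (l' : nat) l.
    by case: (hd l t) => // yt'; rewrite yt' eqxx in yt.
  apply: (within_out (hwf _ (ltn_ord l'))); apply/negP.
  have h1 := hy _ _ yt; move: ll; rewrite neq_ltn => /orP[lt|lt].
    by have := hr _ _ lt; lia.
  by have := hr _ _ lt; lia.
Qed.

End EvenEntry.

(** * Bounded operators and special sequences *)

Section Link.
Context {R : realType}.
Variables (m n s : nat -> nat) (sigma : vecs R -> nat).
Hypothesis hparam : parameters m n s.
Hypothesis hsigma : coding m sigma.
Implicit Types (f g : nat -> R) (phi psi : vecs R).

Local Notation Kl := (Klevel m n sigma).
Local Notation Kw := (Kw m n sigma).
Local Notation nrm := (nrm m n sigma).
Local Notation exact_vec := (exact_vec m n sigma).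
Local Notation ris := (ris m n sigma).
Local Coercion c00_val : c00 >-> Funclass.
Local Arguments c00_val : simpl never.

Variables (X : completeNormedModType R) (iota : {linear c00 R -> X}).
Hypothesis hiota : forall u, `|iota u| = nrm u.
Variables (T : {linear X -> X}) (M a c : R) (C : nat).
Hypothesis M0 : 0 <= M.
Hypothesis hT : forall x, `|T x| <= M * `|x|.
Hypothesis ha : a = 1 \/ a = 0.
Hypothesis c0 : 0 < c.
Hypothesis C0 : (0 < C)%N.
Hypothesis hodd : forall r e, 0 < e ->
  exists2 i, (r <= i)%N & a * `|T (iota (eb i))| <= e.
Hypothesis hseed : forall P r e, (2 <= P)%N -> ~~ odd P -> 0 < e ->
  seed m n sigma iota T a C c P r e.

Lemma rng_within b d (x : nat -> R) : within b d x ->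
  rng x `<=` [set k | (b <= k < d)%N].
Proof.
move=> h; apply: smallest_sub; first exact: nat_interval_itv.
by move=> k /h.
Qed.

Section FixedLength.
Variables (J k P1 : nat).
Hypotheses (J3 : (3 <= J)%N) (oJ : odd J) (nJ : n J = (2 * k)%N) (k0 : (0 < k)%N).
Hypotheses (P1_1 : (1 <= P1)%N) (P1m : ((2 * k) ^ 2 < m (2 * P1))%N).

Let tol : R := (2 * k)%:R^-1.
Let tol0 : 0 < tol. Proof. by rewrite invr_gt0 ltr0n; lia. Qed.
Let c' := c / C%:R.

Lemma P1_sqrt : (2 * k)%:R < Num.sqrt (m (2 * P1)%N)%:R :> R.
Proof.
rewrite -[ltLHS](ger0_norm (ler0n R _)) -sqrtr_sqr ltr_sqrt.
  by rewrite -natrX ltr_nat.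
by rewrite ltr0n; apply: leq_ltn_trans P1m.
Qed.

(** A pair of a vector and a functional, with the approximate image [eV], the
    end [er] of the window and a level [eN] of the norming set that contains
    the functional. *)
Record entry := Entry { ex : c00 R; ef : nat -> R; eV : c00 R; er : nat; eN : nat }.

Definition phi_of (h : seq entry) : vecs R := [seq (c00_val (ex e), ef e) | e <- h].
Definition rend (h : seq entry) : nat := last 0%N (map er h).
Definition wt (h : seq entry) : nat :=
  if h is [::] then (2 * P1)%N else sigma (phi_of h).

(** The weight of a new entry is the code of its predecessors [h]; an odd
    number of predecessors puts it at an even position, counted from 1. *)
Definition step h e := (rend h <= er e)%N /\
  if odd (size h) then
    even_entry m n sigma iota T a (wt h) (rend h) tol c' (er e) (ex e) (ef e) (eV e) (eN e)
  else odd_entry m n sigma iota T a (wt h) (rend h) tol (er e) (ex e) (ef e).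

Lemma step_exists h : exists e, (2 <= wt h)%N -> ~~ odd (wt h) -> step h e.
Proof.
have [w2|] := leqP 2 (wt h); last first.
  by exists (Entry 0 (fun=> 0) 0 0 0) => ?; lia.
have [ow|ow] := boolP (odd (wt h)); first by exists (Entry 0 (fun=> 0) 0 0 0).
rewrite /step; case: (odd (size h)).
  have [r' [x [f [V [N [rr hE]]]]]] := even_entry_exists hparam hsigma (rend h) C0 c0 w2 ow
     tol0 (fun r e => hseed r w2 ow (e := e)).
  by exists (Entry x f V r' N).
have [r' [x [f [rr hE]]]] := odd_entry_exists hparam hsigma (iota := iota) (T := T) ha (rend h) w2 ow tol0 hodd.
by exists (Entry x f 0 r' 0).
Qed.

Lemma step_common h e : step h e ->
  [/\ (rend h <= er e)%N, within (rend h) (er e) (ex e),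
      within (rend h) (er e) (ef e), Qvec (ex e) & Qvec (ef e)].
Proof. by move=> [h1]; case: ifP => _ [[? ? ? ?] _ _ _ _]. Qed.

Lemma step_exact h e : step h e -> exact_vec (wt h) ((m (wt h))%:R *: ex e).
Proof. by move=> [h1]; case: ifP => _ []. Qed.

Section Chain.
Variable next : seq entry -> entry.
Hypothesis hnext : forall h, (2 <= wt h)%N -> ~~ odd (wt h) -> step h (next h).

Let hist l := iter l (fun h => rcons h (next h)) [::].
Let E l := next (hist l).
Let rr l := rend (hist l).
Let W l := wt (hist l).

Lemma histE l : hist l = mkseq E l.
Proof. by elim: l => // l IH; rewrite mkseqS -IH. Qed.

Lemma rrS l : rr l.+1 = er (E l).
Proof. by rewrite /rr /rend /hist iterS map_rcons last_rcons. Qed.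

Let phi l := phi_of (hist l).

Lemma size_phi l : size (phi l) = l.
Proof. by rewrite size_map histE size_mkseq. Qed.

Lemma phi_nth l i : (i < l)%N ->
  nth (0, 0) (phi l) i = (c00_val (ex (E i)), ef (E i) : rseq R).
Proof.
move=> il; rewrite (nth_map (E 0%N)) ?histE ?size_mkseq //.
by rewrite nth_mkseq.
Qed.

Lemma xs_phi l i : (i < l)%N -> xs (phi l) i.+1 = ex (E i).
Proof. by move=> il; rewrite /xs /= phi_nth. Qed.

Lemma fs_phi l i : (i < l)%N -> fs (phi l) i.+1 = ef (E i).
Proof. by move=> il; rewrite /fs /= phi_nth. Qed.

Lemma take_phi l i : (i <= l)%N -> take i (phi l) = phi i.
Proof.
by move=> il; rewrite /phi /phi_of !histE /mkseq -!map_take take_iota (minn_idPl il).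
Qed.

Lemma Qs_phi l : (0 < l)%N -> (forall i, (i < l)%N -> step (hist i) (E i)) ->
  Qs (phi l).
Proof.
move=> l0 hs; split; first by rewrite size_phi.
  move=> [|i]; rewrite size_phi // => il.
  by rewrite xs_phi // fs_phi //; have [] := step_common (hs i il).
move=> [|i]; rewrite size_phi // => /andP[_ il].
have sub j : (j < l)%N -> rngs (phi l) j.+1 `<=` [set t | (rr j <= t < rr j.+1)%N].
  move=> jl; have [_ w1 w2 _ _] := step_common (hs j jl).
  rewrite /rngs xs_phi // fs_phi // => t; rewrite rrS.
  by case=> ht; [apply: (rng_within w1)|apply: (rng_within w2)].
have ne j : (j < l)%N -> rngs (phi l) j.+1 !=set0.
  move=> jl; have [_ _ _ [_ [t xt] _ _] _] := step_common (hs j jl).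
  by exists t; left; rewrite xs_phi //; apply: supp_rng.
have il' := ltnW il; split; [exact: ne|exact: ne|].
move=> t t' /(sub _ il') /= h1 /(sub _ il) /= h2; lia.
Qed.

Lemma WE l : (0 < l)%N -> W l = sigma (phi l).
Proof.
case: l => // l _; rewrite /W /phi /wt; case hl : (hist l.+1) => //.
by have := size_phi l.+1; rewrite /phi hl.
Qed.

Lemma chain_step l : step (hist l) (E l).
Proof.
elim/ltn_ind: l => l IH.
have [w2 ow] : (2 <= W l)%N /\ ~~ odd (W l).
  have [->|l0] := posnP l; first by split; [rewrite /W /=; lia|rewrite /W /= oddM].
  rewrite WE //; have hQ := Qs_phi l0 IH.
  case: hsigma => /(_ _ hQ)[j j1 ->] _ _ _; split; [lia|by rewrite oddM].
exact: hnext.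
Qed.

Let phi' := phi (2 * k).
Let z l := (m (W l))%:R *: ex (E l).

Lemma rr_mono : {homo rr : i j / (i <= j)%N}.
Proof.
apply: homo_leq => // [x y t|l]; first exact: leq_trans.
by rewrite rrS; have [] := step_common (chain_step l).
Qed.

Lemma size_hist l : size (hist l) = l.
Proof. by rewrite histE size_mkseq. Qed.

Lemma odd_step_chain i :
  odd_entry m n sigma iota T a (W (2 * i)) (rr (2 * i)) tol (rr (2 * i).+1)
    (ex (E (2 * i))) (ef (E (2 * i))).
Proof.
have := (chain_step (2 * i)).2; rewrite size_hist oddM /= rrS; exact.
Qed.

Lemma even_step_chain i :
  even_entry m n sigma iota T a (W (2 * i).+1) (rr (2 * i).+1) tol c' (rr (2 * i).+2)
    (ex (E (2 * i).+1)) (ef (E (2 * i).+1)) (eV (E (2 * i).+1)) (eN (E (2 * i).+1)).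
Proof.
have := (chain_step (2 * i).+1).2; rewrite size_hist /= oddM /= -rrS; exact.
Qed.

Lemma code_phi i : (0 < i <= 2 * k)%N -> Defs.code sigma phi' i = W i.
Proof. by move=> /andP[i0 ik]; rewrite /Defs.code take_phi // WE. Qed.

Lemma m_gt0 l : 0 < (m (W l))%:R :> R.
Proof.
rewrite ltr0n (param_m_gt0 hparam) //.
have [->|l0] := posnP l; first by rewrite /W /=; lia.
rewrite WE //; have hQ := Qs_phi l0 (fun i _ => chain_step i).
by case: hsigma => /(_ _ hQ)[j j1 ->] _ _ _; lia.
Qed.

Lemma chain_special : special m n sigma k phi'.
Proof.
have hQ : Qs phi' by apply: Qs_phi => [|i _]; [lia|exact: chain_step].
split.
- by split=> //; rewrite size_phi.
- exists P1; split=> //.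
    exact: P1_sqrt.
  have [_ _ hav _ _] := odd_step_chain 0.
  by rewrite xs_phi ?fs_phi //; lia.
- move=> [|i] // /andP[_ ik].
  have e2 : (2 * i.+1 = (2 * i).+2)%N by lia.
  rewrite e2 /= code_phi; last by lia.
  rewrite xs_phi ?fs_phi; [|lia|lia].
  have [_ hx [_ hf] _ _] := even_step_chain i.
  have mW := m_gt0 (2 * i).+1.
  have W0 : (0 < W (2 * i).+1)%N.
    rewrite lt0n; apply/eqP => w0.
    rewrite WE // in w0; have hQ' := Qs_phi (ltn0Sn (2 * i)) (fun i _ => chain_step i).
    by case: hsigma => /(_ _ hQ')[j j1 jE] _ _ _; move: w0; rewrite jE; lia.
  split.
    apply: ge_sup; first by exists `|ef (E (2 * i).+1) 0%N|; exists 0%N.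
    move=> _ [t _ <-]; have := Kw_bound hparam hsigma t (Kw_K hf).
    by rewrite ifF //; lia.
  have [_ h1 _] := hx _ _ _ (Kw_K hf).
  have := h1 erefl; rewrite evZ normrM gtr0_norm // -ler_pdivlMl // mulr1.
  exact.
- move=> i ik; rewrite code_phi; last by lia.
  rewrite xs_phi ?fs_phi; [|lia|lia].
  by have [_ _ hav _ _] := odd_step_chain i.
Qed.

Lemma chain_weight : special_weight m n sigma k phi' (weight_from sigma (2 * P1) phi').
Proof.
apply: (special_weight_from hparam hsigma k0 chain_special P1_1 P1_sqrt).
have [_ _ hav _ _] := odd_step_chain 0.
by rewrite xs_phi ?fs_phi //; lia.
Qed.

Lemma weight_W l : (l < 2 * k)%N -> weight_from sigma (2 * P1) phi' l.+1 = W l.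
Proof. by case: l => // l lk; rewrite /weight_from code_phi //; lia. Qed.

Let y l := (if odd l then -1 else a) *: z l.

Lemma chain_upper : nrm (\sum_(0 <= l < 2 * k) y l) <= 40 * (n J)%:R / (m J)%:R ^+ 3.
Proof.
apply: (dependent_norm hparam hsigma J3 oJ nJ k0 chain_special chain_weight
  (z := z) (r := rr) (a := a)); try exact: ha.
- split; first exact: rr_mono.
  move=> l; apply: withinZ; have [_ + _ _ _] := step_common (chain_step l).
  by rewrite -rrS.
- by move=> l lk t; rewrite weight_W // xs_phi // /z c00Z.
- by move=> l lk; rewrite weight_W //; apply: step_exact (chain_step l).
- move=> i ik; rewrite fs_phi; last by lia.
  by have [] := odd_step_chain i.
- have [a1|na1] := pselect (a = 1); [by left|right => i g ik].
  have [_ _ _ _ [//|hd]] := even_step_chain i.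
  rewrite fs_phi; last by lia.
  move=> sg; apply: ev_disj => t; have [g0|g0] := eqVneq (g t) 0; first by left.
  right; rewrite /z c00Z; have : supp g t by [].
  rewrite sg /supp /= => ft; case: (hd t) => [f0|->]; last by rewrite mulr0.
  by rewrite f0 eqxx in ft.
Qed.

Let V i := eV (E (2 * i).+1).

(** The functional of weight [m_J] that is carried by the special sequence
    itself coincides with [f_(2 i) / m_J] on the window of the approximate
    image of [x_(2 i)]. *)
Lemma chain_lower : c' * k%:R / (m J)%:R <= nrm (\sum_(i < k) V i).
Proof.
pose F i := ef (E (2 * i.-1).+1).
pose q i := (m (W (2 * i.-1).+1))%:R * dual_pair (F i) (ex (E (2 * i.-1).+1)).
pose lam i : R := if dual_pair (F i) (ex (E (2 * i.-1).+1)) == 0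
  then ((n J)%:R ^+ 2)^-1 else q i.
pose G : rseq R := (1 / (m J)%:R) *: restr setT (\sum_(1 <= i < k.+1)
  (lam i *: (fs phi' (2 * i).-1 : rseq R) + (F i : rseq R))).
have [|i il|N hN] := @fin_bound (2 * k) (fun i N => odd i -> Kl N (W i) (ef (E i))).
- by move=> i N N' NN h oi; apply: Klevel_mono (h oi).
- exists (eN (E i)) => oi; have := even_step_chain i./2.
  have -> : ((2 * i./2).+1 = i)%N by lia.
  by move=> [_ _ [_ ?] _ _].
have hN' i : (i < k)%N -> Kl N (W (2 * i).+1) (ef (E (2 * i).+1)).
  by move=> ik; apply: hN; [lia|rewrite /= oddM].
have GK : Kl N.+1 J G.
  rewrite KlevelS; last by lia.
  rewrite oJ; right; exists k, phi'; split=> //.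
    exact: chain_special.
    move=> [|i] // ik; have e2 : (2 * i.+1 = (2 * i).+2)%N by lia.
    by rewrite e2 /= code_phi ?fs_phi; [apply: hN'; lia|lia|lia].
  exists setT, 1, F, lam; split=> //; first by left.
  move=> [|i] // ik; have e2 : (2 * i.+1 = (2 * i).+2)%N by lia.
  rewrite e2 /= code_phi ?fs_phi ?xs_phi; [|lia|lia|lia].
  have [[_ _ [xfin _ _ _] _] hx [_ hf] _ _] := even_step_chain i.
  split=> //; first by apply: hN'; lia.
  + move=> g /Kw_K hg; have [_ h1 _] := hx _ _ _ hg; have mW := m_gt0 (2 * i).+1.
    have := h1 erefl; rewrite evZ normrM gtr0_norm // -ler_pdivlMl // mulr1.
    exact.
  + move=> d0; rewrite /lam /= (negbTE d0) /q /=.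
    by rewrite -(@dual_pairZr R (F i.+1) _ _ xfin).
  + by move=> d0; left; rewrite /lam /= d0 eqxx.
have mJ : 0 < (m J)%:R :> R by rewrite ltr0n (param_m_gt0 hparam); lia.
have GV i : (i < k)%N -> ev G (V i) = (m J)%:R^-1 * ev (ef (E (2 * i).+1)) (V i).
  move=> ik; rewrite -evZl; apply: eq_ev => t.
  have [_ _ [wV _] _ _] := even_step_chain i.
  have [V0|Vt] := eqVneq (V i t) 0; first by rewrite V0 !mulr0.
  congr (_ * _); rewrite /G.
  change (1 / (m J)%:R * restr setT (\sum_(1 <= i < k.+1)
    (lam i *: (fs phi' (2 * i).-1 : rseq R) + (F i : rseq R))) t =
    (m J)%:R^-1 * ef (E (2 * i).+1) t).
  rewrite div1r restrE in_setT; congr (_ * _).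
  rewrite big_add1 big_mkord fct_sumE /= (bigD1 (Ordinal ik)) //= big1 => [|j ji].
    have -> : ((i + 1 * i.+1)%coq_nat = (2 * i).+1)%N by lia.
    rewrite addr0; change (lam i.+1 * fs phi' (2 * i).+1 t + F i.+1 t = ef (E (2 * i).+1) t).
    rewrite fs_phi; last by lia.
    rewrite (_ : ef (E (2 * i)) t = 0) ?mulr0 ?add0r //.
    have [[_ wf _ _] _ _ _ _] := odd_step_chain i.
    by apply: (within_out wf); apply/negP; have := wV _ Vt; lia.
  have -> : ((j + 1 * j.+1)%coq_nat = (2 * j).+1)%N by lia.
  change (lam j.+1 * fs phi' (2 * j).+1 t + F j.+1 t = 0).
  have jk := ltn_ord j; rewrite fs_phi; last by lia.
  have ji' : (j : nat) != i by [].
  have Vw := wV _ Vt.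
  rewrite (_ : ef (E (2 * j)) t = 0) ?mulr0 ?add0r.
    have [[_ wf _ _] _ _ _ _] := even_step_chain j.
    apply: (within_out wf); apply/negP; move: ji'; rewrite neq_ltn => /orP[lt|lt].
      have lt2 : ((2 * j).+2 <= (2 * i).+1)%N by lia.
      by have := rr_mono lt2; lia.
    have lt2 : ((2 * i).+2 <= (2 * j).+1)%N by lia.
    by have := rr_mono lt2; lia.
  have [[_ wf _ _] _ _ _ _] := odd_step_chain j.
  apply: (within_out wf); apply/negP; move: ji'; rewrite neq_ltn => /orP[lt|lt].
    have lt2 : ((2 * j).+1 <= (2 * i).+1)%N by lia.
    by have := rr_mono lt2; lia.
  have lt2 : ((2 * i).+2 <= (2 * j))%N by lia.
  by have := rr_mono lt2; lia.
apply: le_trans (Klevel_nrm hparam hsigma _ GK).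
apply: le_trans (ler_norm _); rewrite ev_sum.
rewrite (eq_bigr (fun i : 'I_k => (m J)%:R^-1 * ev (ef (E (2 * i).+1)) (V i)));
  last by move=> i _; apply: GV.
rewrite -big_distrr /= [leRHS]mulrC ler_wpM2r //.
have -> : c' * k%:R = \sum_(i < k) c' by rewrite sumr_const card_ord mulr_natr.
by apply: ler_sum => i _; have [_ _ _ []] := even_step_chain i.
Qed.

(** Up to errors that sum to at most 1, the sum of the approximate images is
    minus the image of the alternating sum: the contribution of the entries at
    odd positions is negligible. *)
Lemma chain_link : c' * k%:R / (m J)%:R <= 1 + M * (40 * (n J)%:R / (m J)%:R ^+ 3).
Proof.
apply: le_trans chain_lower _; rewrite -hiota.
have -> : iota (\sum_(i < k) V i) =
   - T (iota (\sum_(0 <= l < 2 * k) y l)) +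
   (\sum_(i < k) (a *: T (iota (z (2 * i)%N)) - (T (iota (z (2 * i).+1)) - iota (V i)))).
  rewrite big_mkord (sum_pairs k y) !(linear_sum iota) (linear_sum T) -sumrN -big_split /=.
  apply: eq_bigr => i _; rewrite /y oddM /= oddM /=.
  have -> : T (iota (a *: z (2 * i)%N + -1 *: z (2 * i).+1)) =
    a *: T (iota (z (2 * i)%N)) - T (iota (z (2 * i).+1)).
    rewrite scaleN1r (raddfB iota) (raddfB T); congr (_ - _).
    transitivity (T (a *: iota (z (2 * i)%N))); last exact: linearZ.
    by congr (T _); exact: linearZ.
  by rewrite !opprB addrA subrK addrC subrK.
have k2 : (2 * k)%:R * tol = 1 by rewrite mulfV // pnatr_eq0; lia.
rewrite addrC; apply: le_trans (ler_normD _ _) _; apply: lerD.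
  rewrite -[leRHS]k2.
  apply: le_trans (ler_norm_sum _ _ _) _.
  apply: (@le_trans _ _ (\sum_(i < k) (tol + tol))); last first.
    by rewrite sumr_const card_ord -[leLHS]mulr_natr natrM; lra.
  apply: ler_sum => i _; apply: le_trans (ler_normB _ _) _; apply: lerD.
    have [_ _ _ _ h] := odd_step_chain i.
    by apply: le_trans h; rewrite normrZ; case: ha => ->; rewrite ?normr1 ?normr0.
  by have [_ _ _ [_ h] _] := even_step_chain i.
rewrite normrN; apply: le_trans (hT _) _; rewrite ler_wpM2l // hiota.
exact: chain_upper.
Qed.
End Chain.

Lemma link_bound : c' * k%:R / (m J)%:R <= 1 + M * (40 * (n J)%:R / (m J)%:R ^+ 3).
Proof.
have [next hnext] := choice step_exists.
exact: chain_link hnext.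
Qed.

End FixedLength.

(** The vectors [x_(2 i - 1)] and [x_(2 i)] of a long special sequence are
    tied together by the coding: the norm of the sum of their differences, or
    of the [x_(2 i)] alone if [a = 0], is small, while the functional of
    weight [m_J] that the sequence carries is of order [1 / m_J] on each
    approximate image. For a bounded operator the two estimates are
    incompatible when [J] is large. *)
Theorem link_contradiction : False.
Proof.
have c'0 : 0 < c / C%:R by rewrite divr_gt0 // ltr0n.
(* the final comparison reduces to [m_J <= B] *)
set B : R := 2 * (1 + 40 * M) / (c / C%:R).
pose J := (2 * (Num.truncn B).+1).+1.
have J3 : (3 <= J)%N by rewrite /J; lia.
have J1 : (1 <= J)%N by lia.
have oJ : odd J by rewrite /J oddS oddM.
have [k k0 nJ] := param_n_even hparam (ltnW J3).
have P11 : (1 <= (2 * k) ^ 2)%N by rewrite expn_gt0; lia.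
have P1m : ((2 * k) ^ 2 < m (2 * (2 * k) ^ 2))%N.
  apply: (@leq_trans (2 * (2 * k) ^ 2)); first by lia.
  by apply: ltnW; apply: (param_m_ge hparam); lia.
have := link_bound J3 oJ nJ k0 P11 P1m.
set D : R := (m J)%:R; set c' := c / C%:R.
have BD : B < D.
  apply: (@lt_trans _ _ (Num.truncn B).+1%:R); first exact: truncnS_gt.
  by rewrite ltr_nat; apply: ltn_trans (param_m_ge hparam J1); rewrite /J; lia.
have D2 : 2 <= D by rewrite ler_nat (param_m_ge2 hparam).
have D0 : 0 < D by lra.
have nD : D ^+ 6 <= (n J)%:R by rewrite -natrX ler_nat (param_m_le_n hparam) //; lia.
have kE : k%:R = (n J)%:R / 2 :> R by rewrite nJ natrM; field.
set Nn : R := (n J)%:R in nD kE *.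
have N0 : 0 < Nn by apply: lt_le_trans nD; rewrite exprn_gt0.
rewrite kE => h.
have {h} : c' / 2 <= D / Nn + 40 * M / D ^+ 2.
  rewrite -(ler_pM2r (_ : 0 < Nn / D)) ?divr_gt0 //.
  have -> : c' / 2 * (Nn / D) = c' * (Nn / 2) / D by field; rewrite gt_eqF.
  apply: le_trans h _; rewrite le_eqVlt; apply/orP; left; apply/eqP.
  by field; rewrite !gt_eqF.
have h1 : D / Nn <= D^-1.
  rewrite ler_pdivrMr // -ler_pdivrMl ?invr_gt0 // invrK; apply: le_trans nD.
  by rewrite -expr2 ler_eXn2l //; lra.
have h2 : 40 * M / D ^+ 2 <= 40 * M / D.
  rewrite ler_wpM2l ?mulr_ge0 // lef_pV2 ?posrE ?exprn_gt0 //.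
  by rewrite -[leLHS]expr1 ler_eXn2l //; lra.
move=> h3; have : c' / 2 <= (1 + 40 * M) / D.
  by rewrite mulrDl mul1r; apply: le_trans h3 _; apply: lerD.
rewrite ler_pdivlMr // => h4.
have : B * (c' / 2) < D * (c' / 2) by rewrite ltr_pM2r // divr_gt0.
have -> : B * (c' / 2) = 1 + 40 * M by rewrite /B -/c'; field; rewrite gt_eqF.
by move: h4; rewrite mulrC; lra.
Qed.

End Link.

(** * Operators are almost diagonal on the basis *)

Section Diagonal.
Context {R : realType}.
Variables (m n s : nat -> nat) (sigma : vecs R -> nat).
Hypothesis hparam : parameters m n s.
Hypothesis hsigma : coding m sigma.
Implicit Types (f g : nat -> R).

Local Notation Kl := (Klevel m n sigma).
Local Notation Kw := (Kw m n sigma).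
Local Notation nrm := (nrm m n sigma).
Local Notation exact_vec := (exact_vec m n sigma).
Local Notation ris := (ris m n sigma).
Local Coercion c00_val : c00 >-> Funclass.
Local Arguments c00_val : simpl never.

Variables (X : completeNormedModType R) (iota : {linear c00 R -> X}).
Hypothesis hX : is_Xius m n sigma iota.

Lemma iota_norm u : `|iota u| = nrm u. Proof. by case: hX. Qed.

Lemma iota_dense (x : X) (e : R) : 0 < e -> exists u, `|x - iota u| < e.
Proof.
move=> e0; case: hX => _ hd.
have [||y [xy [u _ uy]]] := hd (ball x e).
- by exists x; apply: ballxx.
- exact: ball_open.
exists u; rewrite uy; move: xy; by rewrite -ball_normE.
Qed.

Lemma small_eq0 (d K : R) : (forall e, 0 < e -> `|d| <= K * e) -> d = 0.
Proof.
move=> h; apply/eqP; rewrite -normr_le0; apply/ler_addgt0Pr => e e0; rewrite add0r.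
have K1 : 0 < `|K| + 1 by rewrite ltr_wpDl.
apply: le_trans (h (e / (`|K| + 1)) (divr_gt0 e0 K1)) _.
rewrite mulrCA ger_pMr // ler_pdivrMr // mul1r.
by apply: le_trans (ler_norm K) _; rewrite lerDl.
Qed.

(** Coordinates are Lipschitz on the dense subspace, so they extend; the
    supremum of the lower bounds that a limit must satisfy is an explicit
    choice. *)
Lemma coord_limit : exists coo : nat -> X -> R,
  forall k x (u : c00 R), `|u k - coo k x| <= `|iota u - x|.
Proof.
suff h k x : exists c : R, forall u : c00 R, `|u k - c| <= `|iota u - x|.
  have hk k : exists g : X -> R, forall x (u : c00 R), `|u k - g x| <= `|iota u - x|.
    by have [g hg] := choice (h k); exists g.
  by have [g hg] := choice hk; exists g.
pose S := [set u k - `|iota u - x| | u in [set: c00 R]].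
have key (u v : c00 R) : u k - `|iota u - x| <= v k + `|iota v - x|.
  have h1 : `|u k - v k| <= `|iota u - iota v|.
    rewrite -raddfB iota_norm; have := coord_le_nrm hparam hsigma (u - v) k.
    by rewrite c00D c00N.
  have h2 : `|iota u - iota v| <= `|iota u - x| + `|iota v - x|.
    by rewrite (distrC (iota v)); apply: ler_distD.
  have := ler_norm (u k - v k); lra.
have S0 : S !=set0 by exists ((0 : c00 R) k - `|iota 0 - x|), 0.
exists (sup S) => u; rewrite ler_distl; apply/andP; split.
  rewrite lerBlDr; apply: ge_sup => // _ [v _ <-].
  exact: key.
rewrite -lerBlDr; apply: sup_ubound; last by exists u.
by exists (u k + `|iota u - x|) => _ [v _ <-]; apply: key.
Qed.

Lemma coord_linear coo : (forall k x (u : c00 R), `|u k - coo k x| <= `|iota u - x|) ->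
  forall k, linear_for *%R (coo k).
Proof.
move=> hcoo k b x y; apply/eqP; rewrite -subr_eq0; apply/eqP.
apply: (small_eq0 (K := 2 * (`|b| + 1))) => e e0.
have [u xu] := iota_dense x e0; have [v yv] := iota_dense y e0.
have h1 := hcoo k x u; have h2 := hcoo k y v.
have h3 := hcoo k (b *: x + y) (b *: u + v).
rewrite distrC in xu; rewrite distrC in yv.
have h4 : `|iota (b *: u + v) - (b *: x + y)| <= `|b| * e + e.
  rewrite linearP opprD addrACA -scalerBr.
  apply: le_trans (ler_normD _ _) _; rewrite normrZ.
  by apply: lerD; [apply: ler_wpM2l => //|]; apply: ltW.
have h5 : `|b * (u k - coo k x)| <= `|b| * e.
  by rewrite normrM ler_wpM2l // (le_trans h1) // ltW.
have h6 : `|v k - coo k y| <= e by rewrite (le_trans h2) // ltW.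
have -> : coo k (b *: x + y) - (b * coo k x + coo k y) =
  b * (u k - coo k x) + (v k - coo k y) - ((b *: u + v) k - coo k (b *: x + y)).
  by rewrite c00D c00Z; ring.
apply: le_trans (ler_normB _ _) _; apply: le_trans (lerD (ler_normD _ _) (lexx _)) _.
have := le_trans h3 h4; lra.
Qed.

Lemma coord_exists : exists coo : nat -> {scalar X},
  forall k x (u : c00 R), `|u k - coo k x| <= `|iota u - x|.
Proof.
have [coo hcoo] := coord_limit; have lin := coord_linear hcoo.
pose pk k : {scalar X} := HB.pack (coo k) (GRing.isLinear.Build R X R *%R (coo k) (lin k)).
by exists pk.
Qed.

Lemma nrm_eb k : nrm (eb k) <= 1.
Proof.
apply: (nrm_le hparam hsigma) => N p g /Kw_K hg; rewrite ev_eb.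
exact: (Kw_le1 hparam hsigma) hg.
Qed.

Lemma nrm_head r (u : c00 R) : nrm (cut (fun k => (k < r)%N) u) <= \sum_(k < r) `|u k|.
Proof.
apply: (nrm_le hparam hsigma) => N p g /Kw_K hg.
apply: le_trans (@ev_abs_le R g _ r 1 _ _) _.
- by move=> k rk; rewrite cutE ltnNge rk.
- by move=> k; apply: (Kw_le1 hparam hsigma) hg.
- by rewrite mul1r; apply: ler_sum => k _; rewrite cutE ltn_ord.
Qed.

Variables (T : {linear X -> X}) (M : R).
Hypothesis M0 : 0 <= M.
Hypothesis hT : forall x, `|T x| <= M * `|x|.

Section Coordinates.
Variable coo : nat -> {scalar X}.
Hypothesis hcoo : forall k x (u : c00 R), `|u k - coo k x| <= `|iota u - x|.

Lemma coord_le k x : `|coo k x| <= `|x|.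
Proof. by have := hcoo k x 0; rewrite c000 raddf0 !sub0r !normrN. Qed.

(** The part of [u] below [r] has norm at most the sum of the moduli of its
    coordinates, and these are as small as those of [x]. *)
Lemma tail_approx r (x : X) (u : c00 R) t : (forall k, (k < r)%N -> `|coo k x| <= t) ->
  `|x - iota u| <= t -> `|x - iota (cut (fun k => (r <= k)%N) u)| <= (2 * r + 1)%:R * t.
Proof.
move=> hx hu; set v := cut _ _.
have uk k : (k < r)%N -> `|u k| <= 2 * t.
  move=> kr; have h1 := hcoo k x u; have h2 := hx _ kr.
  rewrite distrC in hu.
  have -> : u k = (u k - coo k x) + coo k x by ring.
  apply: le_trans (ler_normD _ _) _; lra.
have uv : u = v + cut (fun k => (k < r)%N) u.
  apply: c00_eqP => k; rewrite c00D !cutE; case: ltnP => _; by rewrite ?add0r ?addr0.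
have -> : x - iota v = (x - iota u) + iota (cut (fun k => (k < r)%N) u).
  by rewrite {1}uv raddfD opprD addrA subrK.
apply: le_trans (ler_normD _ _) _; rewrite (iota_norm (cut _ _)).
have h1 : nrm (cut (fun k => (k < r)%N) u) <= r%:R * (2 * t).
  apply: le_trans (nrm_head _ _) _.
  apply: (@le_trans _ _ (\sum_(k < r) (2 * t))).
    by apply: ler_sum => k _; apply: uk.
  by rewrite sumr_const card_ord -[leLHS]mulr_natl.
have -> : (2 * r + 1)%:R * t = t + r%:R * (2 * t) by rewrite natrD natrM; ring.
exact: lerD.
Qed.

(** The basis is weakly null, as its long averages, with arbitrary signs, are
    small in norm. If the coordinate of order [k] did not tend to 0 along the
    images, the signs could be chosen so that the average has a large
    image. *)
Lemma image_coord_null k e : 0 < e ->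
  exists n0, forall i, (n0 <= i)%N -> `|coo k (T (iota (eb i)))| <= e.
Proof.
move=> e0; apply: contrapT => hn.
have [|i [_ hi hlarge]] := @recurrent_seq (fun i => e < `|coo k (T (iota (eb i)))|) 0.
  move=> r; apply: contrapT => hr; apply: hn; exists r => i ri.
  by rewrite leNgt; apply/negP => h; apply: hr; exists i.
pose P := (Num.truncn (2 * M / e)).+2.
have P2 : (2 <= P)%N by [].
have P1 : (1 <= P)%N by [].
pose sg l : R := Num.sg (coo k (T (iota (eb (i l))))).
have hsg l : `|sg l| <= 1 by rewrite normr_sg; case: (_ == _).
have hris := ris_basis hparam hsigma P1 hi hsg.
have hex := ris_exact hparam hsigma P2 ltr01 hris.
set u := \sum_(0 <= l < n P) sg l *: eb (i l) in hex.
rewrite mul1r in hex; set b := _ / _ in hex.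
have mP : 0 < (m P)%:R :> R by rewrite ltr0n (param_m_gt0 hparam).
have nP : 0 < (n P)%:R :> R by rewrite ltr0n (param_n_gt0 hparam).
have hnrm : nrm (b *: u) <= 2.
  by apply: (nrm_le hparam hsigma) => N p g /Kw_K /hex[].
have h1 : `|coo k (T (iota (b *: u)))| <= M * 2.
  apply: le_trans (coord_le _ _) _; apply: le_trans (hT _) _.
  by rewrite ler_wpM2l // iota_norm.
have E : coo k (T (iota (b *: u))) = b * \sum_(0 <= l < n P) `|coo k (T (iota (eb (i l))))|.
  rewrite (_ : T (iota (b *: u)) = b *: \sum_(0 <= l < n P) sg l *: T (iota (eb (i l)))).
    rewrite linearZ linear_sum; congr (_ * _); apply: eq_bigr => l _; rewrite linearZ.
    by rewrite /sg [RHS]normrEsg.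
  transitivity (T (b *: iota u)); first by congr (T _); exact: linearZ.
  transitivity (b *: T (iota u)); first exact: linearZ.
  congr (_ *: _); rewrite /u (linear_sum iota) (linear_sum T); apply: eq_bigr => l _.
  transitivity (T (sg l *: iota (eb (i l)))); first by congr (T _); exact: linearZ.
  exact: linearZ.
have b0 : 0 < b by rewrite divr_gt0.
have : b * ((n P)%:R * e) <= M * 2.
  apply: le_trans h1; rewrite E; apply: le_trans (ler_norm _).
  rewrite (ler_wpM2l (ltW b0)) //.
  apply: (@le_trans _ _ (\sum_(0 <= l < n P) e)).
    by rewrite sumr_const_nat subn0 mulr_natl.
  by apply: ler_sum => l _; apply: ltW; apply: hlarge.
have -> : b * ((n P)%:R * e) = (m P)%:R * e by rewrite /b; field; rewrite gt_eqF.
rewrite -ler_pdivlMr // leNgt => /negP; apply.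
apply: (@lt_trans _ _ P%:R); last by rewrite ltr_nat (param_m_ge hparam).
by rewrite (mulrC M); apply: lt_le_trans (truncnS_gt _) _; rewrite ler_nat.
Qed.

(** If [T e_i] is far from the multiples of [e_i], then it has a large part
    before or after the position [i]; a functional that norms this part does
    not see [e_i]. *)
Lemma image_block delta r e : 0 < delta -> 0 < e ->
  (forall r, exists2 i, (r <= i)%N &
     forall lam, delta < `|T (iota (eb i)) - lam *: iota (eb i)|) ->
  exists i r' f (v : c00 R) N q,
  [/\ (r <= i < r')%N, within r r' f /\ within r r' v, Kl N q f /\ f i = 0,
      delta / 4 <= ev f v & `|T (iota (eb i)) - iota v| <= e].
Proof.
move=> d0 e0 hfar.
pose e' := Num.min e (delta / 4).
have e'0 : 0 < e' by rewrite lt_min e0 divr_gt0.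
have e'e : e' <= e by rewrite ge_min lexx.
have e'd : e' <= delta / 4 by rewrite ge_min lexx orbT.
have r1 : 0 < (2 * r + 1)%:R :> R by rewrite ltr0n; nlia.
pose t := e' / (2 * r + 1)%:R.
have t0 : 0 < t by rewrite divr_gt0.
have [|k kr|n0 hn0] := @fin_bound r (fun k n0 => forall i, (n0 <= i)%N ->
    `|coo k (T (iota (eb i)))| <= t).
- by move=> k A B AB h i Bi; apply: h; apply: leq_trans Bi.
- exact: image_coord_null.
have [i ri hi] := hfar (maxn r n0).
have [u hu] := iota_dense (T (iota (eb i))) t0.
pose v := cut (fun k => (r <= k)%N) u.
have hv : `|T (iota (eb i)) - iota v| <= e'.
  have -> : e' = (2 * r + 1)%:R * t by rewrite /t mulrCA mulfV ?mulr1 // gt_eqF.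
  apply: tail_approx (ltW hu) => k kr; apply: hn0 => //; nlia.
have vr k : v k != 0 -> (r <= k)%N.
  by rewrite /v cutE; case: ifP => // _; rewrite eqxx.
clearbody v; have [r1' hr1'] := c00_bound v; pose r' := maxn r1' i.+1.
have wv : within r r' v.
  move=> k vk; rewrite vr //= /r' leq_max; apply/orP; left.
  by rewrite ltnNge; apply: contra vk => /hr1' ->.
pose w1 := cut (fun k => (r <= k < i)%N) v.
pose w2 := cut (fun k => (i.+1 <= k < r')%N) v.
have vE : v = v i *: eb i + (w1 + w2).
  apply: c00_eqP => k; rewrite !c00D c00Z ebE !cutE.
  have [->|ki] := eqVneq k i; first by rewrite !ltnn andbF /= mulr1 !addr0.
  rewrite mulr0 add0r.
  have [->|vk] := eqVneq (v k) 0; first by case: ifP => _; case: ifP => _; rewrite addr0.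
  have := wv _ vk => /andP[h1 h2]; rewrite h1 h2 /= andbT.
  by move: ki; rewrite neq_ltn => /orP[lt|lt]; rewrite lt; [rewrite ltnNge ltnW ?addr0|rewrite ltnNge ltnW //= add0r].
have hw : 3 / 4 * delta <= nrm w1 + nrm w2.
  have h1 := ltW (hi (v i)).
  have h2 : `|T (iota (eb i)) - v i *: iota (eb i)| <= e' + nrm (w1 + w2).
    have -> : T (iota (eb i)) - v i *: iota (eb i) = (T (iota (eb i)) - iota v) + iota (w1 + w2).
      have -> : iota v = v i *: iota (eb i) + iota (w1 + w2).
        by rewrite [in LHS]vE raddfD; congr (_ + _); exact: linearZ.
      by rewrite opprD addrA subrK.
    apply: le_trans (ler_normD _ _) _; rewrite (iota_norm (w1 + w2)); exact: lerD.
  have h3 : nrm (w1 + w2) <= nrm w1 + nrm w2.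
    by rewrite -!iota_norm raddfD ler_normD.
  have := divr_gt0 d0 (ltr0n R 4); lra.
have pick (b d : nat) : ~~ (b <= i < d)%N -> (r <= b)%N -> (d <= r')%N ->
    3 / 8 * delta <= nrm (cut (fun k => (b <= k < d)%N) v) ->
    exists f N q, [/\ within r r' f, Kl N q f, f i = 0 & delta / 4 <= ev f v].
  move=> ibd rb dr' hw'; have d8 : 0 < delta / 8 by rewrite divr_gt0.
  have [N [q [g [hg hlt]]]] := nrm_adherent hparam hsigma (cut (fun k => (b <= k < d)%N) v) d8.
  have evE : ev (restr [set k | (b <= k < d)%N] g) v = ev g (cut (fun k => (b <= k < d)%N) v).
    rewrite ev_restr; congr (ev g _); apply: c00_eqP => k.
    by rewrite !cutE in_itv_set.
  have big : delta / 4 <= ev (restr [set k | (b <= k < d)%N] g) v.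
    rewrite evE; lra.
  case: (Klevel_restr hparam hsigma hg (@nat_interval_itv b d)) => [z|K].
    have : ev (restr [set k | (b <= k < d)%N] g) v = 0.
      by apply: ev_disj => k; left; apply: z.
    have := divr_gt0 d0 (ltr0n R 4); lra.
  exists (restr [set k | (b <= k < d)%N] g), N, q; split=> //.
    move=> k; rewrite restrE in_itv_set; case: ifP => [|_]; last by rewrite eqxx.
    by move=> bk _; nlia.
  by rewrite restrE in_itv_set (negbTE ibd).
have [h8|h8] := leP (3 / 8 * delta) (nrm w1).
  have [f [N [q [hf1 hf2 hf3 hf4]]]] := pick r i ltac:(nlia) (leqnn _) ltac:(nlia) h8.
  exists i, r', f, v, N, q; split=> //; first by nlia.
  exact: le_trans e'e.
have h8' : 3 / 8 * delta <= nrm w2 by lra.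
have [f [N [q [hf1 hf2 hf3 hf4]]]] := pick i.+1 r' ltac:(nlia) ltac:(nlia) (leqnn _) h8'.
exists i, r', f, v, N, q; split=> //; first by nlia.
exact: le_trans e'e.
Qed.

End Coordinates.

Lemma ris_windows C P (y : nat -> c00 R) r r' :
  ris C P y r -> block_seq y r' -> ris C P y r'.
Proof. by case. Qed.

(** Otherwise there would be functionals that are large on the images of the
    basis vectors, but do not see the basis vectors themselves: a seed for the
    case [a = 0]. *)
Lemma almost_diagonal delta : 0 < delta -> exists r, forall i, (r <= i)%N ->
  exists lam, `|T (iota (eb i)) - lam *: iota (eb i)| <= delta.
Proof.
move=> d0; apply: contrapT => hn.
have hfar r : exists2 i, (r <= i)%N &
     forall lam, delta < `|T (iota (eb i)) - lam *: iota (eb i)|.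
  apply: contrapT => hr; apply: hn; exists r => i ri; apply: contrapT => hi.
  apply: hr; exists i => // lam; rewrite ltNge; apply/negP => h.
  by apply: hi; exists lam.
have [coo hcoo] := coord_exists.
apply: (@link_contradiction R m n s sigma hparam hsigma X iota iota_norm T M 0 (delta / 4) 1 M0 hT
  (or_intror erefl) (divr_gt0 d0 (ltr0n R 4)) (ltn0Sn 0)).
  by move=> r e e0; exists r => //; rewrite mul0r ltW.
move=> P r e P2 oP e0.
pose good r (D : nat * nat * (nat -> R) * c00 R) := let: (i, r', f, v) := D in
  exists N q, [/\ (r <= i < r')%N, within r r' f /\ within r r' v, Kl N q f /\ f i = 0,
      delta / 4 <= ev f v & `|T (iota (eb i)) - iota v| <= e].
have hgood r1 : exists D, good r1 D.
  have [i [r' [f [v [N [q h]]]]]] := image_block hcoo r1 d0 e0 hfar.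
  by exists (i, r', f, v), N, q.
have [D hD] := choice hgood.
pose rr l := iter l (fun t => (D t).1.1.2) r.
pose i l := (D (rr l)).1.1.1; pose f l := (D (rr l)).1.2; pose v l := (D (rr l)).2.
have H l : exists N q, [/\ (rr l <= i l < rr l.+1)%N,
    within (rr l) (rr l.+1) (f l) /\ within (rr l) (rr l.+1) (v l), Kl N q (f l) /\ f l (i l) = 0,
      delta / 4 <= ev (f l) (v l) & `|T (iota (eb (i l))) - iota (v l)| <= e].
  have := hD (rr l); rewrite /i /f /v /=; case: (D (rr l)) => [[[i0 r0] f0] v0] /=.
  exact.
have hi l : (i l < i l.+1)%N.
  have [N [q [/andP[_ h1] _ _ _ _]]] := H l.
  have [N' [q' [/andP[h2 _] _ _ _ _]]] := H l.+1.
  exact: leq_trans h1 h2.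
have le1 : `|1 : R| <= 1 by rewrite normr1.
have hris := @ris_basis R m n s sigma hparam hsigma P i (fun=> 1) (ltnW P2) hi
  (fun=> le1).
exists (fun l => 1 *: eb (i l)), rr, f, v; split.
- split=> //; apply: ris_windows hris _; split.
    apply: homo_leq => // [x y z|l]; first exact: leq_trans.
    by have [N [q [/andP[h1 h2] _ _ _ _]]] := H l; apply: leq_trans h1 (ltnW h2).
  move=> l; apply: withinZ; have [N [q [/andP[h1 h2] _ _ _ _]]] := H l.
  exact: within_sub (@within_eb R (i l)) h1 h2.
- by move=> l; have [N [q [_ [w1 w2] [K _] _ _]]] := H l; split=> //; exists N, q.
- by move=> l; have [N [q [_ _ _ h1 h2]]] := H l; split=> //; rewrite scale1r.
- split; first by move=> l t; rewrite c00Z mul1r ebE; apply: israt_nat.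
  by exists (i 0%N); rewrite c00Z mul1r ebE eqxx oner_neq0.
- right=> l t; have [N [q [_ _ [_ fi] _ _]]] := H l.
  have [->|ti] := eqVneq t (i l); first by left.
  by right; rewrite c00Z ebE (negbTE ti) mulr0.
Qed.

End Diagonal.

(** * Averages of blocks *)

Section Averages.
Context {R : realType}.
Variables (m n s : nat -> nat) (sigma : vecs R -> nat).
Hypothesis hparam : parameters m n s.
Hypothesis hsigma : coding m sigma.
Implicit Types (f g : nat -> R).

Local Notation Kl := (Klevel m n sigma).
Local Notation Kw := (Kw m n sigma).
Local Notation nrm := (nrm m n sigma).
Local Notation ris := (ris m n sigma).
Local Coercion c00_val : c00 >-> Funclass.
Local Arguments c00_val : simpl never.

(** The numerator of a functional of even weight, kept apart from the weight
    as long as the number of summands grows. *)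
Definition fsum d r r' (F : nat -> R) := exists (c : nat -> nat) (h : nat -> nat -> R),
  [/\ {homo c : i j / (i <= j)%N}, (r <= c 0)%N, (c d <= r')%N,
      forall i, (i < d)%N -> within (c i) (c i.+1) (h i) /\ exists N q, Kl N q (h i) &
      forall k, F k = \sum_(i < d) h i k].

Lemma fsum_cat d1 d2 r1 r2 r3 F1 F2 : fsum d1 r1 r2 F1 -> fsum d2 r2 r3 F2 ->
  fsum (d1 + d2) r1 r3 (fun k => F1 k + F2 k).
Proof.
move=> [c1 [h1 [m1 b1 e1 w1 E1]]] [c2 [h2 [m2 b2 e2 w2 E2]]].
pose c i := if (i < d1)%N then c1 i else c2 (i - d1)%N.
pose h i := if (i < d1)%N then h1 i else h2 (i - d1)%N.
exists c, h; split.
- move=> i j ij; rewrite /c; case: ltnP => id; case: ltnP => jd.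
  + exact: m1.
  + have q1 := m1 _ _ (ltnW id); have q2 := m2 _ _ (leq0n (j - d1)%N).
    exact: leq_trans q1 (leq_trans e1 (leq_trans b2 q2)).
  + nlia.
  + by apply: m2; nlia.
- rewrite /c; case: ltnP => // d0; have -> : (0 - d1 = 0)%N by nlia.
  have d00 : d1 = 0%N by nlia.
  by apply: leq_trans b1 _; rewrite d00 in e1; apply: leq_trans e1 b2.
- by rewrite /c ifF; [rewrite addKn|nlia].
- move=> i id; rewrite /c /h; case: (ltnP i d1) => id1.
    have [w hk] := w1 _ id1; split=> //; case: (ltnP i.+1 d1) => // id1'.
    have -> : (i.+1 - d1 = 0)%N by nlia.
    have ie : i.+1 = d1 by nlia.
    apply: within_sub w _ _ => //; rewrite ie; exact: leq_trans e1 b2.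
  have [|w hk] := w2 (i - d1)%N; first by nlia.
  rewrite ifF; last by nlia.
  by have -> : (i.+1 - d1 = (i - d1).+1)%N by nlia.
- move=> k; rewrite E1 E2 big_split_ord /=; congr (_ + _); apply: eq_bigr => i _.
    by rewrite /h ltn_ord.
  by rewrite /h ifF ?addKn //; nlia.
Qed.

Lemma fsum_within d r r' F : fsum d r r' F -> within r r' F.
Proof.
move=> [c [h [mc b e w E]]] k; rewrite E => /(@sum_neq0 R d (fun i => h i k))[i id hik].
have /andP[q1 q2] := (w _ id).1 _ hik.
rewrite (leq_trans b) ?(leq_trans _ q1) ?mc //=.
by apply: leq_trans q2 (leq_trans _ e); apply: mc.
Qed.

Lemma fsum_K Q d r r' F : (0 < Q)%N -> ~~ odd Q -> (d <= n Q)%N -> fsum d r r' F ->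
  (exists k, F k != 0) -> exists N, Kl N Q (fun k => (m Q)%:R^-1 * F k).
Proof.
move=> Q0 oQ dn [c [h [mc b e w E]]] [k Fk].
have [|i id|N hN] := @fin_bound d (fun i N => exists q, Kl N q (h i)).
- by move=> i N N' NN [q hq]; exists q; apply: Klevel_mono hq.
- by have [_ [N [q hq]]] := w i id; exists N, q.
exists N.+1.
have -> : (fun k => (m Q)%:R^-1 * F k) = fun k => (m Q)%:R^-1 * \sum_(i < d) h i k.
  by apply/funext => j; rewrite E.
apply: (even_build Q0 oQ dn mc) => [i id|i id|].
- exact: (w i id).1.
- by right; apply: hN.
move: Fk; rewrite E => /(@sum_neq0 R d (fun i => h i k))[i id hik].
by exists i => //; exists k.
Qed.

Variables (X : completeNormedModType R) (iota : {linear c00 R -> X}).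
Hypothesis hX : is_Xius m n sigma iota.
Variables (T : {linear X -> X}).

Definition defect u := `|T (iota u) - iota u|.

Lemma iotaZ a u : iota (a *: u) = a *: iota u. Proof. exact: linearZ. Qed.
Lemma TZ a x : T (a *: x) = a *: T x. Proof. exact: linearZ. Qed.

Lemma defectZ a u : defect (a *: u) = `|a| * defect u.
Proof. by rewrite /defect iotaZ TZ -scalerBr normrZ. Qed.

Lemma defect_sum (u : nat -> c00 R) N e : (forall l, defect (u l) <= e) ->
  defect (\sum_(0 <= l < N) u l) <= N%:R * e.
Proof.
move=> h; rewrite /defect (linear_sum iota) (linear_sum T) -sumrB.
apply: le_trans (ler_norm_sum _ _ _) _.
apply: (@le_trans _ _ (\sum_(0 <= l < N) e)).
  by apply: ler_sum => l _; exact: h.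
by rewrite sumr_const_nat subn0 -[leLHS]mulr_natl.
Qed.

Lemma nrmZ a u : nrm (a *: u) = `|a| * nrm u.
Proof. by rewrite -!(iota_norm hX) iotaZ normrZ. Qed.

Lemma nrm_sum (u : nat -> c00 R) N e : (forall l, nrm (u l) <= e) ->
  nrm (\sum_(0 <= l < N) u l) <= N%:R * e.
Proof.
move=> h; rewrite -(iota_norm hX) (linear_sum iota).
apply: le_trans (ler_norm_sum _ _ _) _.
apply: (@le_trans _ _ (\sum_(0 <= l < N) e)).
  by apply: ler_sum => l _; rewrite (iota_norm hX).
by rewrite sumr_const_nat subn0 -[leLHS]mulr_natl.
Qed.

Definition ratvec (u : c00 R) := forall k, israt (u k).

Lemma ratvec_sum (u : nat -> c00 R) N : (forall l, ratvec (u l)) ->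
  ratvec (\sum_(0 <= l < N) u l).
Proof. by move=> h k; rewrite c00_sum; apply: israt_sum => l _; apply: h. Qed.

Lemma ratvecZ a u : israt a -> ratvec u -> ratvec (a *: u).
Proof. by move=> ha hu k; rewrite c00Z; apply: isratM. Qed.

Hypothesis blocks : forall (r : nat) (e : R), 0 < e ->
  exists u : c00 R, [/\ forall k, u k != 0 -> (r <= k)%N,
  ratvec u, 1 / 2 <= nrm u <= 1 & defect u <= e].

(** Averages of norm at least 1 are the ones of interest: the triangle
    inequality is then sharp for the pieces, up to a factor 2. *)
Definition l1_average N r r' (u : c00 R) := exists (w : nat -> c00 R) rr,
  [/\ block_seq w rr, (r <= rr 0)%N /\ (rr N <= r')%N, forall l, nrm (w l) <= 2 &
      u = N%:R^-1 *: \sum_(0 <= l < N) w l].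

Lemma norming_functional (u : c00 R) r r' : within r r' u -> 0 < nrm u ->
  exists N q f, [/\ within r r' f, Kl N q f & nrm u / 2 <= ev f u].
Proof.
move=> wu u0; have u2 : 0 < nrm u / 2 by rewrite divr_gt0.
have [N [q [g [hg hlt]]]] := nrm_adherent hparam hsigma u u2.
have evE : ev (restr [set k | (r <= k < r')%N] g) u = ev g u.
  rewrite ev_restr; congr (ev g _); apply: c00_eqP => k.
  rewrite cutE in_itv_set; case: ifPn => // h.
  by rewrite (within_out wu).
have big : nrm u / 2 <= ev (restr [set k | (r <= k < r')%N] g) u by rewrite evE; lra.
case: (Klevel_restr hparam hsigma hg (@nat_interval_itv r r')) => [z|K].
  have : ev (restr [set k | (r <= k < r')%N] g) u = 0.
    by apply: ev_disj => k; left; apply: z.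
  lra.
exists N, q, (restr [set k | (r <= k < r')%N] g); split=> // k.
by rewrite restrE in_itv_set; case: ifP => // _; rewrite eqxx.
Qed.

Section OneWeight.
Variables (Q N S : nat).
Hypotheses (Q2 : (2 <= Q)%N) (oQ : ~~ odd Q) (N0 : (0 < N)%N).
Hypotheses (NS : (N ^ S <= n Q)%N) (mS : (m Q ^ 3 <= 2 ^ S)%N).
Variables (r0 : nat) (e0 : R).
Hypothesis e00 : 0 < e0.
Hypothesis none : forall r r' u, (r0 <= r)%N -> l1_average N r r' u ->
  1 <= nrm u -> ratvec u -> defect u <= e0 -> False.

Let NR : 0 < N%:R :> R. Proof. by rewrite ltr0n. Qed.

(** Without averages of norm at least 1, each averaging step halves the norm.
    The sum of the functionals that norm the initial blocks remains large on
    the result. *)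
Lemma halving h r (e : R) : 0 < e -> exists (v : c00 R) r' F,
  [/\ (r <= r')%N /\ within r r' v, ratvec v /\ defect v <= e, nrm v <= 2^-1 ^+ h,
      fsum (N ^ h) r r' F & 1 / 4 <= ev F v].
Proof.
elim: h r e => [|h IH] r e e_gt0.
  have [u [ur urat /andP[u1 u2] ud]] := blocks r e_gt0.
  have [b hb] := c00_bound u; pose r' := maxn r b.
  have wu : within r r' u.
    move=> k uk; rewrite ur //= /r' leq_max; apply/orP; right.
    by rewrite ltnNge; apply: contra uk => /hb ->.
  have u0 : 0 < nrm u by lra.
  have [K [q [f [wf hf hev]]]] := norming_functional wu u0.
  exists u, r', f; split=> //; first by split=> //; rewrite /r'; nlia.
    exists (fun i => if i is 0%N then r else r'), (fun=> f); split=> //.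
    - by move=> [|i] [|j] //=; rewrite /r'; nlia.
    - by move=> [|i] //= _; split=> //; exists K, q.
    - by move=> k; rewrite big_ord_recl big_ord0 addr0.
  lra.
pose e' := Num.min e (e0 / 2 ^+ h.+1).
have p2 : 0 < 2 ^+ h.+1 :> R by rewrite exprn_gt0.
have e'0 : 0 < e' by rewrite lt_min e_gt0 divr_gt0.
have e'e : e' <= e by rewrite ge_min lexx.
have e'd : e' <= e0 / 2 ^+ h.+1 by rewrite ge_min lexx orbT.
pose good r (D : c00 R * nat * (nat -> R)) := let: (v, r', F) := D in
  [/\ (r <= r')%N /\ within r r' v, ratvec v /\ defect v <= e', nrm v <= 2^-1 ^+ h,
      fsum (N ^ h) r r' F & 1 / 4 <= ev F v].
have hgood t : exists D, good t D.
  have [v [r' [F H]]] := IH t e' e'0.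
  by exists (v, r', F).
have [D hD] := choice hgood.
pose rr l := iter l (fun t => (D t).1.2) (maxn r r0).
pose v l := (D (rr l)).1.1; pose F l := (D (rr l)).2.
have H l : [/\ (rr l <= rr l.+1)%N /\ within (rr l) (rr l.+1) (v l),
    ratvec (v l) /\ defect (v l) <= e', nrm (v l) <= 2^-1 ^+ h,
      fsum (N ^ h) (rr l) (rr l.+1) (F l) & 1 / 4 <= ev (F l) (v l)].
  have := hD (rr l); rewrite /v /F /=; case: (D (rr l)) => [[v0 r1] F0] /=.
  exact.
have hr : {homo rr : i j / (i <= j)%N}.
  by apply: homo_leq => // [x y z|l]; [apply: leq_trans|have [[]] := H l].
have hb : block_seq v rr by split=> // l; have [[]] := H l.
pose u := N%:R^-1 *: \sum_(0 <= l < N) v l.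
pose G k := \sum_(l < N) F l k.
have rr0 : rr 0%N = maxn r r0 by [].
have rrN := hr _ _ (leq0n N).
have wu : within (maxn r r0) (rr N) u.
  by apply: withinZ; have := @within_block_sum _ v rr hr hb.2 0%N N.
have urat : ratvec u.
  apply: ratvecZ; first exact/isratV/israt_nat.
  by apply: ratvec_sum => l; have [_ []] := H l.
have ud : defect u <= e'.
  rewrite defectZ gtr0_norm ?invr_gt0 // ler_pdivrMl //.
  by apply: defect_sum => l; have [_ []] := H l.
exists u, (rr N), G; split.
- split; first by apply: leq_trans rrN; rewrite rr0 leq_maxl.
  by apply: within_sub wu _ _ => //; rewrite leq_maxl.
- by split=> //; apply: le_trans e'e.
- rewrite leNgt; apply/negP => big.
  apply: (none (r := maxn r r0) (r' := rr N) (u := 2 ^+ h.+1 *: u)).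
  + exact: leq_maxr.
  + exists (fun l => 2 ^+ h.+1 *: v l), rr; split=> //.
      by split=> // l; apply: withinZ; have [[]] := H l.
    move=> l; rewrite nrmZ gtr0_norm //; have [_ _ hv _ _] := H l.
    rewrite exprS -mulrA -[leRHS]mulr1 ler_pM2l //.
    rewrite -ler_pdivlMl ?exprn_gt0 // mulr1 -exprVn; exact: hv.
    by rewrite /u scalerA mulrC -scalerA scaler_sumr.
  + rewrite nrmZ gtr0_norm // -ler_pdivrMl // mulr1 -exprVn; exact: ltW.
  + by apply: ratvecZ => //; rewrite -natrX; apply: israt_nat.
  + rewrite defectZ gtr0_norm // -ler_pdivlMl // mulrC; exact: le_trans e'd.
- have gen K : fsum (K * N ^ h) (rr 0%N) (rr K) (fun k => \sum_(l < K) F l k).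
    elim: K => [|K IHK].
      exists (fun=> rr 0%N), (fun _ _ => 0); split=> //.
      by move=> k; rewrite !big_ord0.
    have [_ _ _ hF _] := H K.
    have := fsum_cat IHK hF; rewrite -mulSnr.
    have -> : (fun k => \sum_(l < K) F l k + F K k) = (fun k => \sum_(l < K.+1) F l k).
      by apply/funext => k; rewrite big_ord_recr.
    exact.
  have [c [g [h1 h2 h3 h4 h5]]] := gen N.
  rewrite expnS; exists c, g; split=> //.
  by apply: leq_trans h2; rewrite rr0 leq_maxl.
- rewrite /u evZ ler_pdivlMl // ev_suml.
  have -> : \sum_(l < N) ev (F l) (\sum_(0 <= l < N) v l) = \sum_(l < N) ev (F l) (v l).
    apply: eq_bigr => l _; rewrite big_mkord ev_sum (bigD1 l) //= big1 ?addr0 // => l' ll.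
    have [_ _ _ /fsum_within wF _] := H l; have [[_ wv] _ _ _ _] := H l'.
    apply: within_ev0 wF wv _.
    have : (l' : nat) != l by [].
    by rewrite neq_ltn => /orP[lt|lt]; [right|left]; apply: hr.
  have -> : N%:R * (1 / 4) = \sum_(l < N) (1 / 4) :> R.
    by rewrite sumr_const card_ord -[RHS]mulr_natl.
  by apply: ler_sum => l _; have [] := H l.
Qed.

(** After [S] steps the norm is at most [2 ^ - S <= m_Q ^ -3], while the sum
    of the functionals has few enough terms for weight [m_Q] and gives the
    lower bound [1 / (4 m_Q)]. *)
Lemma halving_contradiction : False.
Proof.
have [v [r' [F [_ _ hv hF hev]]]] := halving S 0 (ltr01 : 0 < 1 :> R).
have Q0 : (0 < Q)%N by nlia.
have Fnz : exists k, F k != 0.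
  have [|k [Fk _]] := @ev_neq0 R F v; last by exists k.
  by rewrite gt_eqF //; lra.
have [K hK] := fsum_K Q0 oQ NS hF Fnz.
have := le_trans (ler_norm _) (Klevel_nrm hparam hsigma v hK).
rewrite evZl => h.
set M : R := (m Q)%:R in h.
have M32 : 32 <= M.
  rewrite ler_nat; apply: leq_trans (param_m_lt hparam (i := 1) _ Q2) => //.
  by have := param_m_ge2 hparam (j := 1) (leqnn _); case: (m 1%N) => [|[|t]] // _;
     rewrite (@leq_trans (2 ^ 5)) // leq_exp2r.
have M0 : 0 < M by lra.
have : 1 / 4 / M <= (M ^+ 3)^-1.
  rewrite mulrC; apply: le_trans (ler_wpM2l _ hev) _; first by rewrite invr_ge0 ltW.
  apply: le_trans h _; apply: le_trans hv _; rewrite exprVn.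
  by rewrite lef_pV2 ?posrE ?exprn_gt0 // -!natrX ler_nat.
rewrite -ler_pdivlMr ?invr_gt0 // invrK.
have -> : (M ^+ 3)^-1 * M = (M ^+ 2)^-1 by field; rewrite gt_eqF.
rewrite leNgt => /negP; apply.
have M2 : 32 <= M ^+ 2 by rewrite expr2; nra.
rewrite mul1r ltf_pV2 ?posrE ?exprn_gt0 //; lra.
Qed.

End OneWeight.

Lemma averages_exist Q r (e : R) : (2 <= Q)%N -> ~~ odd Q -> 0 < e ->
  exists r' (u : c00 R),
  [/\ (r <= r')%N /\ within r r' u, ratvec u /\ defect u <= e,
      l1_average (4 * n Q.-1) r r' u & 1 <= nrm u].
Proof.
move=> Q2 oQ e0; apply: contrapT => hn.
have Q1 : (1 <= Q.-1)%N by nlia.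
have n0 := param_n_gt0 hparam Q1.
apply: (@halving_contradiction Q (4 * n Q.-1) (s Q.-1) Q2 oQ _ _ _ r e e0).
- by nlia.
- by have := param_n_succ hparam Q1; rewrite prednK ?(ltnW Q2) // => ->.
- by have := param_m_s hparam Q1; rewrite prednK ?(ltnW Q2).
move=> r1 r' u rr1 hav u1 urat ud; apply: hn.
have [w [rr [[hr hw] [q1 q2] hn uE]]] := hav.
have q3 := hr _ _ (leq0n (4 * n Q.-1)).
have rr' : (r <= r')%N by exact: leq_trans rr1 (leq_trans q1 (leq_trans q3 q2)).
exists r', u; split=> //.
  split=> //; rewrite uE; apply: withinZ.
  apply: within_sub (@within_block_sum _ w rr hr hw 0%N _) _ _ => //.
  exact: leq_trans rr1 q1.
exists w, rr; split=> //; split=> //; exact: leq_trans rr1 q1.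
Qed.

Lemma l1_average_nrm N r r' u : (0 < N)%N -> l1_average N r r' u -> nrm u <= 2.
Proof.
move=> N0 [w [rr [_ _ hw ->]]]; have NR : 0 < N%:R :> R by rewrite ltr0n.
by rewrite nrmZ gtr0_norm ?invr_gt0 // ler_pdivrMl //; apply: nrm_sum.
Qed.

(** A functional of small weight sees an average as if it were a sum of few
    pieces of norm at most 2, since it has few successors. *)
Lemma l1_average_weight N r r' u L p f : (0 < N)%N -> l1_average N r r' u ->
  (1 <= p)%N -> (n p <= N)%N -> Kw L p f -> `|ev f u| <= 4 / (m p)%:R.
Proof.
move=> N0 [w [rr [[hr hw] _ hn ->]]] p1 nN hf.
have NR : 0 < N%:R :> R by rewrite ltr0n.
have mp : 0 < (m p)%:R :> R by rewrite ltr0n (param_m_gt0 hparam).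
have [L' [d [c [h [_ dn hc hh fE]]]]] := Kw_node hparam hsigma p1 hf.
have evE (x : c00 R) : ev f x = (m p)%:R^-1 * \sum_(i < d) ev (h i) x.
  rewrite -ev_suml -evZl; congr dual_pair; exact/funext.
rewrite evZ evE normrM gtr0_norm ?invr_gt0 // normrM gtr0_norm ?invr_gt0 //.
have hcount : `|\sum_(i < d) ev (h i) (\sum_(0 <= l < N) w l)| <= 2 * (N - 0 + d)%:R.
  apply: (split_count hr hw hc (fun i id => (hh i id).1)) => // i l id.
  have [_ [q hq]] := hh _ id; apply: le_trans (hn l).
  exact: (Kw_nrm hparam hsigma (w l) hq).
have dN : (N - 0 + d)%:R <= 2 * N%:R :> R.
  rewrite -natrM ler_nat subn0 mul2n -addnn leq_add2l; exact: leq_trans dn nN.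
rewrite mulrA -invfM [leLHS]mulrC ler_pdivrMr ?mulr_gt0 //.
have -> : 4 / (m p)%:R * (N%:R * (m p)%:R) = 4 * N%:R :> R by field; rewrite gt_eqF.
apply: le_trans hcount _; lra.
Qed.

(** Averages of rapidly increasing length form a rapidly increasing sequence:
    the weights for which an average is not controlled form an interval, and
    these intervals are disjoint. As the averages are almost fixed by [T],
    they are their own approximate images. *)
Lemma averages_seed P r (e : R) : (2 <= P)%N -> 0 < e ->
  seed m n sigma iota T 1 4 (1 / 2) P r e.
Proof.
move=> P2 e0.
have P1 : (1 <= P)%N by nlia.
have mP := param_m_gt0 hparam P1.
have mPR : 0 < (m P)%:R :> R by rewrite ltr0n.
(* large enough that [1 / m_p] outweighs the support of the preceding
   averages *)
pose Q t := (2 * (P + t * m P ^ 5 + 1))%N.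
have Q2 t : (2 <= Q t)%N by rewrite /Q; nlia.
have oQ t : ~~ odd (Q t) by rewrite /Q oddM.
have PQ t : (P < Q t)%N by rewrite /Q; nlia.
have Qmono t t' : (t <= t')%N -> (Q t <= Q t')%N.
  by move=> tt; rewrite /Q leq_mul2l /= leq_add2r leq_add2l leq_mul2r tt orbT.
have Qbig t p : (Q t <= p)%N -> (2 * t * m P ^ 5 <= m p)%N.
  move=> Qp; have p1 : (1 <= p)%N by have := Q2 t; nlia.
  apply: leq_trans (ltnW (param_m_ge hparam p1)); apply: leq_trans Qp.
  rewrite /Q -mulnA leq_mul2l /=; nlia.
pose good t (D : nat * c00 R) :=
  [/\ (t <= D.1)%N /\ within t D.1 D.2, ratvec D.2 /\ defect D.2 <= e,
      l1_average (4 * n (Q t).-1) t D.1 D.2 & 1 <= nrm D.2].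
have hgood t : exists D, good t D.
  have [r' [u H]] := averages_exist t (Q2 t) (oQ t) e0.
  by exists (r', u).
have [D hD] := choice hgood.
pose rr l := iter l (fun t => (D t).1) r.
pose y l := (D (rr l)).2.
have H l : good (rr l) (rr l.+1, y l).
  by have := hD (rr l); rewrite /y /good /=.
have hr : {homo rr : i j / (i <= j)%N}.
  by apply: homo_leq => // [x z t|l]; [apply: leq_trans|have [[]] := H l].
have hb : block_seq y rr by split=> // l; have [[]] := H l.
have nQ t : (0 < 4 * n (Q t).-1)%N.
  by rewrite muln_gt0 /= (param_n_gt0 hparam) //; have := Q2 t; nlia.
have ynrm l : nrm (y l) <= 2 by have [_ _ /(l1_average_nrm (nQ _))] := H l.
have ycoord l k : `|y l k| <= 2.
  by apply: le_trans (ynrm l); apply: (coord_le_nrm hparam hsigma).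
have ylow L l p f : (1 <= p < Q (rr l))%N -> Kw L p f -> `|ev f (y l)| <= 4 / (m p)%:R.
  move=> /andP[p1 pQ] hf; have [_ _ hav _] := H l.
  apply: (l1_average_weight (nQ _) hav p1 _ hf).
  have q1 : (n p <= n (Q (rr l)).-1)%N.
    by apply: (param_n_mono hparam) => //; move: pQ; case: (Q (rr l)).
  by apply: leq_trans q1 _; rewrite leq_pmull.
have yhigh L l p f : (Q (rr l.+1) <= p)%N -> Kw L p f ->
    `|ev f (y l)| <= ((m P)%:R ^+ 5)^-1.
  move=> Qp hf; have [[_ wy] _ _ _] := H l.
  have p1 : (1 <= p)%N by have := Q2 (rr l.+1); nlia.
  have mp : 0 < (m p)%:R :> R by rewrite ltr0n (param_m_gt0 hparam).
  apply: le_trans (@ev_abs_le R f (y l) (rr l.+1) (m p)%:R^-1 _ _) _.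
  - exact: within_bound wy.
  - move=> k; have := Kw_bound hparam hsigma k hf; rewrite ifF //; nlia.
  rewrite ler_pdivrMl //.
  apply: (@le_trans _ _ (\sum_(k < rr l.+1) 2)); first by apply: ler_sum.
  rewrite sumr_const card_ord -[leLHS]mulr_natl ler_pdivlMr ?exprn_gt0 //.
  by rewrite -natrX -!natrM ler_nat [(_ * 2)%N]mulnC; apply: Qbig.
have hfun l : exists f, [/\ within (rr l) (rr l.+1) f, exists N q, Kl N q f & 1 / 2 <= ev f (y l)].
  have [[_ wy] _ _ y1] := H l; have y0 : 0 < nrm (y l) by lra.
  have [N [q [f [wf hf hev]]]] := norming_functional wy y0.
  by exists f; split=> //; [exists N, q|lra].
have [f hf] := choice hfun.
exists y, rr, f, y; split.
- split=> //; split=> //; split.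
  + move=> N p g k hg; apply: le_trans (Kw_nrm hparam hsigma _ hg) _.
    by apply: le_trans (ynrm k) _; rewrite ler_nat.
  + move=> N p g k hp hg; apply: ylow hg; have := PQ (rr k); nlia.
  + move=> N p g a b Pp ab hg.
    pose c l := (Q (rr l) <= p < Q (rr l.+1))%N.
    have cs : \sum_(l < b) (c l)%:R <= 1 :> R.
      apply: sum_atmost1 => i j _ _ /andP[i1 i2] /andP[j1 j2].
      case: (ltngtP i j) => // ij; first by have := Qmono _ _ (hr _ _ ij); nlia.
      by have := Qmono _ _ (hr _ _ ij); nlia.
    have cs' : \sum_(a <= l < b) (c l)%:R <= 1 :> R.
      apply: le_trans cs; rewrite -(big_mkord xpredT (fun l => (c l)%:R)).
      by rewrite (@big_cat_nat _ _ _ a 0 b) //= ?(ltnW ab) // lerDr sumr_ge0.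
    have i0 : 0 <= ((m P)%:R ^+ 5)^-1 :> R by rewrite invr_ge0 exprn_ge0.
    rewrite ev_sum; apply: le_trans (ler_norm_sum _ _ _) _.
    apply: (@le_trans _ _ (\sum_(a <= l < b) (4 * ((m P)%:R ^+ 5)^-1 + 2 * (c l)%:R))).
      apply: ler_sum => l _; have cl0 : 0 <= (c l)%:R :> R by [].
      have [pQ|Qp] := ltnP p (Q (rr l)).
        apply: le_trans (ylow _ _ _ _ _ hg) _; first by nlia.
        suff : (m p)%:R^-1 <= ((m P)%:R ^+ 5)^-1 :> R by lra.
        rewrite lef_pV2 ?posrE ?exprn_gt0 ?ltr0n ?(param_m_gt0 hparam) //; last by nlia.
        by rewrite -natrX ler_nat (param_m_lt hparam).
      have [pQ'|Qp'] := ltnP p (Q (rr l.+1)).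
        rewrite (_ : c l = true); last by rewrite /c Qp pQ'.
        rewrite mulr1; apply: le_trans (Kw_nrm hparam hsigma _ hg) _.
        apply: le_trans (ynrm l) _; lra.
      by apply: le_trans (yhigh _ _ _ _ Qp' hg) _; lra.
    rewrite big_split /= sumr_const_nat -big_distrr /= -[X in X + _]mulr_natl; lra.
- by move=> l; have [w1 w2 _] := hf l; have [[_ wy] _ _ _] := H l.
- by move=> l; have [_ _ h2] := hf l; have [_ [_ hd] _ _] := H l.
- split; first by move=> l; have [_ []] := H l.
  have [_ _ h2] := hf 0%N; have [|t [_ yt]] := @ev_neq0 R (f 0%N) (y 0%N).
    by rewrite gt_eqF //; lra.
  by exists t.
- by left.
Qed.

End Averages.

(** * The open mapping argument for complemented pairs *)

Section Complements.
Context {R : realType} (X : completeNormedModType R).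
Variables (P : {linear X -> X}) (Y Z : set X).
Hypotheses (hY : Defs.subspace Y) (hZ : Defs.subspace Z) (cY : closed Y) (cZ : closed Z).
Hypotheses (PY : forall x, Y (P x)) (PZ : forall x, Z (x - P x)).
Hypothesis PE : forall y z, Y y -> Z z -> P (y + z) = y.

Let V (N : nat) : set X := [set x | `|P x| <= N%:R /\ `|x - P x| <= N%:R].

Let scaleP b x : P (b *: x) = b *: P x. Proof. exact: linearZ. Qed.

(** The sets [V N] cover the space, so Baire's theorem applies. *)
Lemma somewhere_dense : exists (N : nat) x0 r, 0 < r /\
  forall x e, `|x0 - x| < r -> 0 < e -> exists v, V N v /\ `|x - v| < e.
Proof.
apply: contrapT => hn.
have dF i : open (~` closure (V i)) /\ dense (~` closure (V i)).
  split; first exact/closed_openC/closed_closure.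
  move=> D [x0 Dx0] oD; apply: contrapT => hD; apply: hn.
  have /nbhs_ballP[r /= r0 hr] : nbhs x0 D by apply: open_nbhs_nbhs.
  exists i, x0, r; split=> // x e xr e0.
  have : closure (V i) x.
    apply: contrapT => cx; apply: hD; exists x; split=> //.
    by apply: hr; rewrite -ball_normE.
  move=> /(_ (ball x e) (nbhsx_ballx x e e0))[v [Vv]]; rewrite -ball_normE => xv.
  by exists v.
have [||x [_ hx]] := Baire dF (O := setT).
- by exists 0.
- exact: openT.
pose N := maxn (Num.truncn `|P x|).+1 (Num.truncn `|x - P x|).+1.
apply: (hx N I); apply: subset_closure; split.
  apply: le_trans (ltW (truncnS_gt _)) _; by rewrite ler_nat leq_maxl.
apply: le_trans (ltW (truncnS_gt _)) _; by rewrite ler_nat leq_maxr.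
Qed.

(** Differences of elements of [V N] approximate all vectors of a ball around
    0. *)
Lemma half_approximation : exists K, 0 <= K /\ forall x, exists g,
  [/\ `|x - g| <= `|x| / 2, `|P g| <= K * `|x| & `|g - P g| <= K * `|x|].
Proof.
have [N [x0 [r [r0 h]]]] := somewhere_dense.
have N0 : 0 <= N%:R :> R by [].
exists (4 * N%:R / r); split; first by rewrite divr_ge0 ?mulr_ge0 // ltW.
move=> x; have [->|x_neq0] := eqVneq x 0.
  by exists 0; rewrite !(linear0 P) !subr0 !normr0 !mulr0 mul0r; split.
have x_gt0 : 0 < `|x| by rewrite normr_gt0.
pose t := r / (2 * `|x|).
have t0 : 0 < t by rewrite divr_gt0 // mulr_gt0.
have tx : t * `|x| = r / 2 by rewrite /t; field; rewrite gt_eqF.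
have r8 : 0 < r / 8 by rewrite divr_gt0.
have [|v1 [[v1P v1Q] xv1]] := h (x0 + t *: x) (r / 8) _ r8.
  rewrite opprD addrA subrr sub0r normrN normrZ gtr0_norm // tx; lra.
have [|v2 [[v2P v2Q] xv2]] := h x0 (r / 8) _ r8; first by rewrite subrr normr0.
have bnd (a b : X) : `|a| <= N%:R -> `|b| <= N%:R -> `|t^-1 *: (a - b)| <= 4 * N%:R / r * `|x|.
  move=> ha hb; rewrite normrZ gtr0_norm ?invr_gt0 // ler_pdivrMl //.
  have -> : t * (4 * N%:R / r * `|x|) = N%:R + N%:R.
    by rewrite /t; field; rewrite !gt_eqF.
  by apply: le_trans (ler_normB _ _) _; apply: lerD.
exists (t^-1 *: (v1 - v2)); split.
- have -> : x - t^-1 *: (v1 - v2) = t^-1 *: ((x0 + t *: x - v1) - (x0 - v2)).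
    have -> : x0 + t *: x - v1 - (x0 - v2) = t *: x - (v1 - v2).
      rewrite !opprB [x0 + _]addrC -!addrA; congr (_ + _).
      by rewrite [x0 + _]addrC -!addrA addNr addr0 addrC.
    by rewrite [RHS]scalerBr scalerA mulVf ?scale1r // gt_eqF.
  rewrite normrZ gtr0_norm ?invr_gt0 // ler_pdivrMl //.
  rewrite mulrA tx; apply: le_trans (ler_normB _ _) _; lra.
- by rewrite scaleP (linearB P); apply: bnd.
- rewrite scaleP (linearB P) -scalerBr.
  have -> : v1 - v2 - (P v1 - P v2) = (v1 - P v1) - (v2 - P v2).
    by rewrite !opprB addrACA [RHS]addrACA; congr (_ + _); exact: addrC.
  exact: bnd.
Qed.

Lemma cvgn_dist (f : nat -> X) l : f @ \oo --> l -> forall e, 0 < e ->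
  exists N, forall i, (N <= i)%N -> `|l - f i| <= e.
Proof.
by move=> /cvgrPdist_le h e e0; have [N _ hN] := h e e0; exists N.
Qed.

(** Repeated approximation writes [x] as the sum of a series in [Y] and a
    series in [Z], both of norm at most a multiple of [|x|]; since the
    subspaces are closed, the sum of the first series is [P x]. *)
Lemma projection_bounded : bounded_operator P.
Proof.
have [K [K0 hK]] := half_approximation.
have [g hg] := choice hK.
exists (2 * K) => x.
pose xs i := iter i (fun t => t - g t) x.
have xsS i : xs i.+1 = xs i - g (xs i) by [].
have xs_le i : `|xs i| <= `|x| * 2^-1 ^+ i.
  elim: i => [|i IH]; first by rewrite expr0 mulr1.
  rewrite xsS exprSr mulrA; have [h _ _] := hg (xs i).
  by apply: le_trans h _; rewrite ler_wpM2r // invr_ge0.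
pose u i := P (g (xs i)); pose w i := g (xs i) - P (g (xs i)).
have geo (a : nat -> X) : (forall i, `|a i| <= K * `|xs i|) -> cvgn (series a) /\
    forall N, `|series a N| <= 2 * K * `|x|.
  move=> ha; have ha' i : `|a i| <= geometric (K * `|x|) 2^-1 i.
    by apply: le_trans (ha i) _; rewrite /geometric /= -mulrA ler_wpM2l.
  have half : `|2^-1 : R| < 1 by rewrite ger0_norm ?invr_ge0 // invf_lt1 //; lra.
  split.
    apply: normed_cvg; apply: (series_le_cvg _ _ ha').
    - by [].
    - by move=> i; rewrite /geometric /= mulr_ge0 ?mulr_ge0 // exprn_ge0 // invr_ge0.
    - exact: is_cvg_geometric_series.
  move=> N; apply: le_trans (ler_norm_sum _ _ _) _.
  apply: (@le_trans _ _ (series (geometric (K * `|x|) 2^-1) N)); first exact: ler_sum.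
  rewrite geometric_seriesE; last by apply/eqP => h; lra.
  have p0 : 0 <= 2^-1 ^+ N :> R by rewrite exprn_ge0 // invr_ge0.
  have Kx : 0 <= K * `|x| by rewrite mulr_ge0.
  rewrite /= ler_pdivrMr; last by lra.
  nra.
have [cu bu] := geo u (fun i => let: And3 _ h _ := hg (xs i) in h).
have [cw bw] := geo w (fun i => let: And3 _ _ h := hg (xs i) in h).
have subsum (A : set X) (a : nat -> X) N : Defs.subspace A -> (forall i, A (a i)) -> A (series a N).
  move=> [A0 AD] ha; rewrite /series /=; elim: N => [|N IH]; first by rewrite big_geq.
  by rewrite big_nat_recr //= addrC -[a N]scale1r; apply: AD.
have Yy : Y (limn (series u)).
  apply: (closed_cvg Y cY _ _ cu); apply: nearW => N.
  by apply: (subsum _ _ _ hY) => i; exact: PY.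
have Zw : Z (limn (series w)).
  apply: (closed_cvg Z cZ _ _ cw); apply: nearW => N.
  by apply: (subsum _ _ _ hZ) => i; exact: PZ.
have split_x N : x - xs N = series u N + series w N.
  elim: N => [|N IH]; first by rewrite /series /= !big_geq // subrr addr0.
  rewrite /series /= !big_nat_recr //= addrACA.
  have <- : g (xs N) = u N + w N by rewrite /u /w addrC subrK.
  by move: IH; rewrite /series /= => <-; rewrite opprB addrCA addrC.
have xE : x = limn (series u) + limn (series w).
  apply/eqP; rewrite -subr_eq0 -normr_le0; apply/ler_addgt0Pr => e e0; rewrite add0r.
  have e3 : 0 < e / 3 by rewrite divr_gt0.
  have [N1 h1] := cvgn_dist cu e3; have [N2 h2] := cvgn_dist cw e3.
  have xs0 : (fun i => `|x| * 2^-1 ^+ i) @ \oo --> (0 : R).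
    rewrite -[0 in X in _ --> X](mulr0 `|x|); apply: cvgMr; apply: cvg_expr.
    by rewrite ger0_norm ?invr_ge0 // invf_lt1 //; lra.
  move/cvgrPdist_le : xs0 => /(_ _ e3)[N3 _ h3].
  pose N := maxn N1 (maxn N2 N3).
  have -> : x - (limn (series u) + limn (series w)) =
     xs N - ((limn (series u) - series u N) + (limn (series w) - series w N)).
    by rewrite addrACA -opprD -split_x opprB addrA [xs N + _]addrCA subrr addr0.
  have d1 := h1 N ltac:(rewrite /N; lia); have d2 := h2 N ltac:(rewrite /N; lia).
  have d3 : `|xs N| <= e / 3.
    apply: le_trans (xs_le N) _; have := h3 N ltac:(rewrite /N /=; lia).
    by rewrite /= sub0r normrN => /(le_trans (ler_norm _)).
  apply: le_trans (ler_normB _ _) _; apply: le_trans (lerD d3 (ler_normD _ _)) _; lra.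
have -> : P x = limn (series u) by rewrite {1}xE PE.
apply/ler_addgt0Pr => e e0.
have [N1 h1] := cvgn_dist cu e0.
have -> : limn (series u) = (limn (series u) - series u N1) + series u N1 by rewrite subrK.
apply: le_trans (ler_normD _ _) _; rewrite addrC; apply: lerD; first exact: bu.
exact: h1.
Qed.

End Complements.

(** * Projections *)

Section InfiniteDimension.
Context {R : realType} (X : normedModType R).
Implicit Types (Y : set X) (h : {scalar X}).

(** A basis of the kernel is completed by one vector outside of it. *)
Lemma finite_dim_kernel Y h : Defs.subspace Y ->
  finite_dim [set y | Y y /\ h y = 0] -> finite_dim Y.
Proof.
move=> [Y0 YD] [d [b bE]].
have [[y0 [Yy0 hy0]]|none] := pselect (exists y, Y y /\ h y != 0); last first.
  exists d, b; rewrite -bE; apply/seteqP; split=> y /=; last by case.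
  by move=> Yy; split=> //; apply/eqP/negPn/negP => hy; apply: none; exists y.
pose b' (i : 'I_d.+1) := if insub (val i) : option 'I_d is Some j then b j else y0.
have b'w (i : 'I_d) : b' (widen_ord (leqnSn d) i) = b i.
  by rewrite /b' /= valK.
have b'm : b' ord_max = y0 by rewrite /b' /= insubF // ltnn.
exists d.+1, b'; apply/seteqP; split=> y /=.
  move=> Yy; have : [set z | Y z /\ h z = 0] (y - (h y / h y0) *: y0).
    split; first by rewrite addrC -scaleNr; apply: YD.
    by rewrite addrC -scaleNr linearP /= mulNr mulfVK // addNr.
  rewrite bE => -[c _ cE].
  exists (fun i => if insub (val i) : option 'I_d is Some j then c j else h y / h y0) => //.
  rewrite big_ord_recr /= b'm insubF ?ltnn //.
  under eq_bigr do rewrite b'w valK.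
  by rewrite cE subrK.
move=> [c _ <-]; rewrite big_ord_recr /= b'm addrC; apply: YD => //.
have : [set \sum_(i < d) e i *: b i | e in [set: 'I_d -> R]]
    (\sum_(i < d) c (widen_ord (leqnSn d) i) *: b' (widen_ord (leqnSn d) i)).
  by exists (fun i => c (widen_ord (leqnSn d) i)) => //; apply: eq_bigr => i _; rewrite b'w.
by rewrite -bE => -[].
Qed.

Lemma infinite_dim_vector Y (h : nat -> {scalar X}) : Defs.subspace Y -> ~ finite_dim Y ->
  forall r, exists y, [/\ Y y, y != 0 & forall k, (k < r)%N -> h k y = 0].
Proof.
move=> hY nY r.
pose K r := [set y | Y y /\ forall k, (k < r)%N -> h k y = 0].
have hK t : Defs.subspace (K t) /\ ~ finite_dim (K t).
  elim: t => [|t [st nt]].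
    suff -> : K 0%N = Y by [].
    by apply/seteqP; split=> y /=; [case|].
  split.
    case: hY => Y0 YD; split; first by split=> // k _; rewrite linear0.
    move=> a u v [Yu hu] [Yv hv]; split; first exact: YD.
    by move=> k kt; rewrite linearP /= hu // hv // mulr0 addr0.
  move=> ft; apply: nt; apply: (finite_dim_kernel (h := h t) st).
  suff -> : [set y | K t y /\ h t y = 0] = K t.+1 by [].
  apply/seteqP; split=> y /=.
    by move=> [[Yy hy] hty]; split=> // k; rewrite ltnS leq_eqVlt => /predU1P[->|/hy].
  move=> [Yy hy]; split; last exact: hy.
  by split=> // k kt; apply: hy; apply: ltnW.
apply: contrapT => none; apply: (hK r).2; exists 0%N, (fun=> 0).
apply/seteqP; split=> y /=.
  move=> [Yy hy]; exists (fun=> 0) => //; rewrite big_ord0; apply/esym/eqP/negPn/negP => ny.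
  by apply: none; exists y.
by move=> [c _ <-]; rewrite big_ord0; have [[]] := hK r.
Qed.

End InfiniteDimension.

Section Projections.
Context {R : realType}.
Variables (m n s : nat -> nat) (sigma : vecs R -> nat).
Hypothesis hparam : parameters m n s.
Hypothesis hsigma : coding m sigma.

Local Notation nrm := (nrm m n sigma).
Local Coercion c00_val : c00 >-> Funclass.
Local Arguments c00_val : simpl never.

Variables (X : completeNormedModType R) (iota : {linear c00 R -> X}).
Hypothesis hX : is_Xius m n sigma iota.

Lemma ratvec_dense (u : c00 R) (e : R) : 0 < e ->
  exists u', ratvec u' /\ `|iota u - iota u'| <= e.
Proof.
move=> e0; have [M hM] := c00_bound u.
have M1 : 0 < M.+1%:R :> R by [].
set de := e / M.+1%:R.
have de0 : 0 < de by rewrite divr_gt0.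
have hq k : exists q : rat, `|u k - ratr q| <= de.
  have lt : u k - de < u k + de by lra.
  have [q] := rat_in_itvoo lt; rewrite in_itv /= => /andP[q1 q2].
  by exists q; rewrite ler_distl; apply/andP; split; lra.
have [q hqk] := choice hq.
have hv k : (M <= k)%N -> (if (k < M)%N then ratr (q k) else 0) = 0 :> R.
  by rewrite leqNgt => /negbTE ->.
exists (mkc00 hv); split.
  move=> k; have -> : mkc00 hv k = if (k < M)%N then ratr (q k) else 0 by [].
  by case: ifP => _; [exists (q k)|exists 0; rewrite rmorph0].
rewrite -raddfB (iota_norm hX).
have -> : u - mkc00 hv = cut (fun k => (k < M)%N) (u - mkc00 hv).
  apply: c00_eqP => k; rewrite cutE; case: ltnP => // Mk.
  by rewrite c00D c00N hM // [mkc00 hv k]hv // subr0.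
apply: le_trans (nrm_head hparam hsigma _ _) _.
apply: (@le_trans _ _ (\sum_(k < M) de)).
  apply: ler_sum => k _; rewrite c00D c00N.
  have -> : mkc00 hv k = ratr (q k).
    by have -> : mkc00 hv k = if (k < M)%N then ratr (q k) else 0 by []; rewrite ltn_ord.
  exact: hqk.
rewrite sumr_const card_ord -[leLHS]mulr_natl /de mulrCA ger_pMr // ler_pdivrMr // mul1r.
by rewrite ler_nat.
Qed.

Section Idempotent.
Variables (T : {linear X -> X}) (M : R).
Hypothesis M0 : 0 <= M.
Hypothesis hT : forall x, `|T x| <= M * `|x|.
Hypothesis TT : forall x, T (T x) = T x.
Hypothesis Tdim : ~ finite_dim (range T).

(** The range contains vectors whose first coordinates vanish. They are fixed
    by [T], hence a good approximation by a rational block is almost fixed. *)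
Lemma range_blocks (r : nat) (e : R) : 0 < e ->
  exists u : c00 R, [/\ forall k, u k != 0 -> (r <= k)%N,
    ratvec u, 1 / 2 <= nrm u <= 1 & defect iota T u <= e].
Proof.
move=> e0; have [coo hcoo] := coord_exists hparam hsigma hX.
have sT : Defs.subspace (range T).
  split; first by exists 0 => //; rewrite linear0.
  by move=> a _ _ [x _ <-] [y _ <-]; exists (a *: x + y) => //; rewrite linearP.
have [y [[x _ xy] y0 hy]] := infinite_dim_vector coo sT Tdim r.
have Ty : T y = y by rewrite -xy TT.
have y_gt0 : 0 < `|y| by rewrite normr_gt0.
pose z := (3 / 4 / `|y|) *: y.
have Tz : T z = z by rewrite /z TZ Ty.
have z34 : `|z| = 3 / 4 by rewrite normrZ gtr0_norm ?divr_gt0 // mulfVK // gt_eqF.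
have cz k : (k < r)%N -> coo k z = 0.
  by move=> kr; rewrite linearZ /= hy // mulr0.
pose e' := Num.min (1 / 4) (e / (M + 1)).
have M1 : 0 < M + 1 by rewrite ltr_wpDl.
have e'0 : 0 < e' by rewrite lt_min !divr_gt0.
have e'1 : e' <= 1 / 4 by rewrite ge_min lexx.
have e'2 : e' <= e / (M + 1) by rewrite ge_min lexx orbT.
have r1 : 0 < (2 * r + 1)%:R :> R by rewrite ltr0n addn1.
pose t := e' / (2 * r + 1)%:R; have t0 : 0 < t by rewrite divr_gt0.
have t2 : 0 < t / 2 by rewrite divr_gt0.
have [u0 hu0] := iota_dense hX z t2.
have [u [urat hu]] := ratvec_dense u0 t2.
have zu : `|z - iota u| <= t.
  have -> : z - iota u = (z - iota u0) + (iota u0 - iota u) by rewrite addrA subrK.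
  apply: le_trans (ler_normD _ _) _; have := ltW hu0; lra.
pose v := cut (fun k => (r <= k)%N) u.
have zv : `|z - iota v| <= e'.
  have -> : e' = (2 * r + 1)%:R * t by rewrite /t mulrCA mulfV ?mulr1 // gt_eqF.
  apply: (tail_approx hparam hsigma hX hcoo) zu => k kr; rewrite cz // normr0; exact: ltW.
have nv : `| `|z| - `|iota v| | <= e' by apply: le_trans (ler_dist_dist _ _) zv.
exists v; split.
- by move=> k; rewrite /v cutE; case: ifP => // _; rewrite eqxx.
- by move=> k; rewrite /v cutE; case: ifP => _; [exact: urat|exact: israt0].
- rewrite -(iota_norm hX); move: nv; rewrite ler_distl z34 => /andP[n1 n2].
  by apply/andP; split; lra.
- have -> : defect iota T v = `|T (iota v - z) + (z - iota v)|.
    by rewrite /defect (linearB T) Tz addrA subrK.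
  apply: le_trans (ler_normD _ _) _.
  have h1 : `|T (iota v - z)| <= M * e'.
    by apply: le_trans (hT _) _; rewrite ler_wpM2l // distrC.
  have h2 : (M + 1) * e' <= e by rewrite mulrC -ler_pdivlMr.
  have := lerD h1 zv; lra.
Qed.

(** A bounded idempotent of infinite rank does not vanish along any
    subsequence of the basis: averages of blocks in its range are a seed with
    [a = 1], and basis vectors along the subsequence supply the other
    entries. *)
Lemma idempotent_basis :
  ~ (forall r e, 0 < e -> exists2 i, (r <= i)%N & `|T (iota (eb i))| <= e).
Proof.
move=> hodd.
apply: (@link_contradiction R m n s sigma hparam hsigma X iota (iota_norm hX) T M 1 (1 / 2) 4 M0 hT
  (or_introl erefl)) => //.
  by move=> r e /(hodd r)[i ri hi]; exists i => //; rewrite mul1r.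
move=> P r e P2 _ e0.
exact: (averages_seed hparam hsigma hX range_blocks).
Qed.

(** If [T e_i] is close to [lam e_i], then [T T = T] makes [lam (1 - lam)]
    small, so that [lam] is close to 0 or to 1. *)
Lemma diagonal_values (e : R) : 0 < e -> exists r, forall i, (r <= i)%N ->
  `|T (iota (eb i))| <= e \/ `|iota (eb i) - T (iota (eb i))| <= e.
Proof.
move=> e0.
have M5 : 0 < 4 * M + 5 by have := M0; lra.
pose d := Num.min 1 (e / (4 * M + 5)).
have d0 : 0 < d by rewrite lt_min ltr01 divr_gt0.
have d1 : d <= 1 by rewrite ge_min lexx.
have d2 : (4 * M + 5) * d <= e.
  by rewrite mulrC -ler_pdivlMr // ge_min lexx orbT.
have [r hr] := almost_diagonal hparam hsigma hX M0 hT d0.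
exists r => i /hr[lam]; set x := iota (eb i) => hlam.
have x1 : `|x| = 1.
  apply/le_anti; rewrite (iota_norm hX) (nrm_eb hparam hsigma) /=.
  by have := coord_le_nrm hparam hsigma (eb i) i; rewrite ebE eqxx normr1.
set D := T x - lam *: x in hlam.
have TxE : T x = lam *: x + D by rewrite addrC subrK.
have lamM : `|lam| <= M + d.
  have -> : `|lam| = `|T x - D| by rewrite TxE addrK normrZ x1 mulr1.
  apply: le_trans (ler_normB _ _) _; apply: lerD => //.
  by have := hT x; rewrite x1 mulr1.
have lam1 : `|1 - lam| <= 1 + `|lam| by apply: le_trans (ler_normB _ _) _; rewrite normr1.
have key : `|lam| * `|1 - lam| <= (2 * M + 2) * d.
  have -> : `|lam| * `|1 - lam| = `|T D - (1 - lam) *: D|.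
    have -> : T D - (1 - lam) *: D = (lam * (1 - lam)) *: x.
      have -> : T D = (1 - lam) *: T x by rewrite /D (linearB T) TT TZ scalerBl scale1r.
      rewrite -scalerBr; have -> : T x - D = lam *: x by rewrite TxE addrK.
      by rewrite scalerA mulrC.
    by rewrite normrZ x1 mulr1 normrM.
  apply: le_trans (ler_normB _ _) _; rewrite normrZ.
  have h1 : `|T D| <= M * d by apply: le_trans (hT _) _; rewrite ler_wpM2l.
  have h2 : `|1 - lam| * `|D| <= (M + 2) * d.
    by apply: ler_pM => //; apply: le_trans lam1 _; lra.
  have := lerD h1 h2; lra.
have sum1 : 1 <= `|lam| + `|1 - lam|.
  by have := ler_normD lam (1 - lam); rewrite addrC subrK normr1.
have small b : `|b| <= (4 * M + 4) * d -> `|b *: x| + `|D| <= e.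
  by rewrite normrZ x1 mulr1 => hb; apply: le_trans (lerD hb hlam) _; lra.
have [l2|l2] := leP (1 / 2) `|1 - lam|.
  left; rewrite TxE; apply: le_trans (ler_normD _ _) (small lam _).
  by have := normr_ge0 lam; nra.
right; have -> : x - T x = (1 - lam) *: x - D.
  by rewrite TxE scalerBl scale1r opprD addrA.
apply: le_trans (ler_normB _ _) (small _ _).
by have := normr_ge0 (1 - lam); nra.
Qed.

End Idempotent.

(** One of [P] and [1 - P] is small on infinitely many basis vectors, and both
    have infinite-dimensional range. *)
Lemma no_nontrivial_projection (P : {linear X -> X}) : ~ nontrivial_projection P.
Proof.
move=> [[M0 hM0] PP rP kP].
pose M := `|M0|; have Mge : 0 <= M := normr_ge0 M0.
have hM x : `|P x| <= M * `|x|.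
  by apply: le_trans (hM0 x) _; rewrite ler_wpM2r // ler_norm.
have [small|large] := pselect
   (forall r e, 0 < e -> exists2 i, (r <= i)%N & `|P (iota (eb i))| <= e).
  exact: (idempotent_basis Mge hM PP rP).
pose q (x : X) := x - P x.
have qlin : linear q.
  by move=> a x y; rewrite /q linearP scalerBr opprD addrACA.
pose Q : {linear X -> X} := HB.pack q (GRing.isLinear.Build R X X *:%R q qlin).
have QE x : Q x = x - P x by [].
have hQ x : `|Q x| <= (1 + M) * `|x|.
  by rewrite QE mulrDl mul1r; apply: le_trans (ler_normB _ _) _; rewrite lerD2l.
have QQ x : Q (Q x) = Q x by rewrite !QE (linearB P) PP subrr subr0.
have rQ : ~ finite_dim (range Q).
  suff -> : range Q = P @^-1` [set 0] by [].
  apply/seteqP; split=> x /=; first by move=> [y _ <-]; rewrite [LHS]linearB PP subrr.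
  by move=> Px; exists x => //; rewrite /q Px subr0.
apply: (idempotent_basis (addr_ge0 ler01 Mge) hQ QQ rQ) => r e e0.
apply: contrapT => none; apply: large => r1 e1 e10.
pose e2 := Num.min e e1.
have e20 : 0 < e2 by rewrite lt_min e0.
have [r2 hr2] := diagonal_values Mge hM PP e20.
exists (maxn r1 (maxn r r2)); first exact: leq_maxl.
have [h|h] := hr2 (maxn r1 (maxn r r2)) ltac:(lia).
  by apply: le_trans h _; rewrite ge_min lexx orbT.
case: none; exists (maxn r1 (maxn r r2)); first by lia.
by rewrite QE; apply: le_trans h _; rewrite ge_min lexx.
Qed.

(** The projection onto [Y] along [Z] is bounded, because both subspaces are
    closed. *)
Lemma not_decomposable : ~ decomposable X.
Proof.
move=> [Y [Z [[sY cY fY] [sZ cZ fZ] YZ0 YZ]]].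
have [[Y0 YD] [Z0 ZD]] := (sY, sZ).
have YZ' x : exists y, Y y /\ Z (x - y).
  by have [y [z [Yy Zz ->]]] := YZ x; exists y; split=> //; rewrite addrC addrA addNr add0r.
have [p hp] := choice YZ'.
have YN y : Y y -> Y (- y) by move=> Yy; rewrite -scaleN1r -[_ *: _]addr0; apply: YD.
have ZN z : Z z -> Z (- z) by move=> Zz; rewrite -scaleN1r -[_ *: _]addr0; apply: ZD.
have YB y y' : Y y -> Y y' -> Y (y - y').
  by move=> Yy /YN Yy'; rewrite -[y]scale1r; apply: YD.
have ZB z z' : Z z -> Z z' -> Z (z - z').
  by move=> Zz /ZN Zz'; rewrite -[z]scale1r; apply: ZD.
have pE y z : Y y -> Z z -> p (y + z) = y.
  move=> Yy Zz; have [Yp Zp] := hp (y + z).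
  have : (Y `&` Z) (p (y + z) - y).
    split; first exact: YB.
    have -> : p (y + z) - y = z - (y + z - p (y + z)).
      by rewrite opprB opprD addrCA [z + _]addrCA subrr addr0.
    exact: ZB.
  by rewrite YZ0 => /eqP; rewrite subr_eq0 => /eqP.
have plin : linear p.
  move=> a x y; have [Yx Zx] := hp x; have [Yy Zy] := hp y.
  have -> : a *: x + y = (a *: p x + p y) + (a *: (x - p x) + (y - p y)).
    by rewrite scalerBr addrACA [a *: p x + _]addrC subrK [p y + _]addrC subrK.
  by rewrite pE //; [apply: YD|apply: ZD].
pose P : {linear X -> X} := HB.pack p (GRing.isLinear.Build R X X *:%R p plin).
have pY y : Y y -> p y = y by move=> Yy; have := pE y 0 Yy Z0; rewrite addr0.
have rP : range P = Y.
  apply/seteqP; split=> y /=; first by move=> [x _ <-]; have [] := hp x.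
  by move=> Yy; exists y => //; rewrite /= pY.
have kP : P @^-1` [set 0] = Z.
  apply/seteqP; split=> z /=.
    by move=> pz; have [_] := hp z; rewrite pz subr0.
  by move=> Zz; have := pE 0 z Y0 Zz; rewrite add0r.
apply: (@no_nontrivial_projection P); split; rewrite ?rP ?kP //.
  apply: (projection_bounded sY sZ cY cZ) => [x|x|y z]; [by have [] := hp x|by have [] := hp x|exact: pE].
by move=> x; apply: pY; have [] := hp x.
Qed.

End Projections.

Theorem corollary4p19 (R : realType) (m n s : nat -> nat)
    (sigma : vecs R -> nat)
    (hparam : parameters m n s) (hsigma : coding m sigma)
    (X : completeNormedModType R) (iota : {linear c00 R -> X})
    (hX : is_Xius m n sigma iota) :
  (~ exists P : {linear X -> X}, nontrivial_projection P) /\ ~ decomposable X.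
Proof.
split; last exact: (not_decomposable hparam hsigma hX).
by move=> [P]; apply: (no_nontrivial_projection hparam hsigma hX).
Qed.
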